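(* Let $K\subset\mathbb R^2$ be a convex body with boundary of class $C^2$, and let $\delta\in(0,\mathrm{Vol}_2(K))$. If $\Pi_\delta(K)$ is homothetic to $\Gamma_\delta(K)$, and if $\delta$ is such that every chord of flotation cuts off from $\partial K$ an arc whose affine arc length is exactly $\frac13$ of the total affine arc length of $\partial K$, then $K$ is an ellipse.
   Context: A convex body is a compact convex set with non-empty interior. For each unit vector $\boldsymbol\xi$ let $H_{\boldsymbol\xi}$ be the line orthogonal to $\boldsymbol\xi$ such that the half-plane $H_{\boldsymbol\xi}^-$ cuts off from $K$ area exactly $\delta$; the segments $K\cap H_{\boldsymbol\xi}$ are the chords of flotation and the arc cut off is the part of $\partial K$ in $H_{\boldsymbol\xi}^-$. $\Pi_\delta(K)$ is the envelope of the lines $H_{\boldsymbol\xi}$, and $\Gamma_\delta(K)$ is the locus of the centroids of $K\cap H_{\boldsymbol\xi}^-$. Two curves are homothetic if one is the image of the other under a map $x\mapsto q+\lambda(x-q)$ with $\lambda>0$. The affine arc length of an arc $\gamma|_{[a,b]}$ of a regular parametrization $\gamma$ of $\partial K$ is $\int_a^b\det(\gamma'(u),\gamma''(u))^{1/3}\,\mathrm du$. *)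

(* Defs.v *)
From HB Require Import structures.
From mathcomp Require Import all_boot all_order all_algebra.
From mathcomp Require Import all_classical all_reals all_analysis.
Set Implicit Arguments.
Unset Strict Implicit.
Unset Printing Implicit Defensive.
Import Order.TTheory GRing.Theory Num.Theory.
Import numFieldNormedType.Exports.
Local Open Scope classical_set_scope.
Local Open Scope ring_scope.

Section Defs.
Variable R : realType.

Definition dot (x y : R * R) : R := x.1 * y.1 + x.2 * y.2.

Definition leb2 : set (R * R) -> \bar R :=
  ((@lebesgue_measure R) \x (@lebesgue_measure R))%E.

Definition area (A : set (R * R)) : \bar R := leb2 A.

Definition convex_set (K : set (R * R)) : Prop :=
  forall x y (t : R), K x -> K y -> 0 <= t <= 1 ->
    K (t * x.1 + (1 - t) * y.1, t * x.2 + (1 - t) * y.2).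

Definition convex_body (K : set (R * R)) : Prop :=
  [/\ compact K, convex_set K & interior K !=set0].

Definition boundary (K : set (R * R)) : set (R * R) :=
  closure K `\` interior K.

Definition C2fun (f : R -> R) : Prop :=
  [/\ forall u, derivable f u 1,
      forall u, derivable (derive1 f) u 1 &
      continuous (derive1 (derive1 f))].

Definition C2_boundary_param (K : set (R * R)) (g : R -> R * R) (L : R)
  : Prop :=
  [/\ 0 < L,
      (forall u, g (u + L) = g u),
      (forall u v, 0 <= u < L -> 0 <= v < L -> g u = g v -> u = v) /\
        g @` setT = boundary K,
      (C2fun (fun u => (g u).1) /\ C2fun (fun u => (g u).2)) &
      forall u, (derive1 (fun w => (g w).1) u, derive1 (fun w => (g w).2) u) != 0].

Definition uvec (theta : R) : R * R := (cos theta, sin theta).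

Definition halfplane (theta t : R) : set (R * R) :=
  [set x | dot x (uvec theta) <= t].

(* the (unique) position t of the line H_xi orthogonal to xi = uvec theta
   such that H^-_xi cuts off area delta from K *)
Definition flot (K : set (R * R)) (delta theta : R) : R :=
  xget 0 [set t | area (K `&` halfplane theta t) = delta%:E].

Definition envelope (F : R * R -> R -> R) : set (R * R) :=
  [set x | exists theta, [/\ F x theta = 0,
                              derivable (F x) theta 1 &
                              derive1 (F x) theta = 0]].

Definition Pi_delta (K : set (R * R)) (delta : R) : set (R * R) :=
  envelope (fun x theta => dot x (uvec theta) - flot K delta theta).

Definition centroid (A : set (R * R)) : R * R :=
  ((\int[leb2]_(x in A) x.1) / fine (area A),
   (\int[leb2]_(x in A) x.2) / fine (area A)).

Definition Gamma_delta (K : set (R * R)) (delta : R) : set (R * R) :=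
  [set c | exists theta,
     c = centroid (K `&` halfplane theta (flot K delta theta))].

Definition homothetic (A B : set (R * R)) : Prop :=
  exists (q : R * R) (lam : R), 0 < lam /\
    A = (fun x : R * R => (q.1 + lam * (x.1 - q.1), q.2 + lam * (x.2 - q.2)))
          @` B.

Definition cbrt (x : R) : R := Num.sg x * (`|x| `^ (3^-1)).

Definition affine_arc_length (g : R -> R * R) (a b : R) : R :=
  let g1 := fun u => (g u).1 in
  let g2 := fun u => (g u).2 in
  \int[@lebesgue_measure R]_(u in `[a, b])
     cbrt (derive1 g1 u * derive1 (derive1 g2) u
           - derive1 g2 u * derive1 (derive1 g1) u).

Definition is_ellipse (K : set (R * R)) : Prop :=
  exists (c : R * R) (a b c' e : R), a * e - b * c' != 0 /\
    K = (fun x : R * R => (c.1 + a * x.1 + b * x.2, c.2 + c' * x.1 + e * x.2))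
          @` [set x : R * R | x.1 ^+ 2 + x.2 ^+ 2 <= 1].

End Defs.

(* Main.v *)
(* For a chord of flotation at angle [th], the centroid of the cap and the
   midpoint of the chord are, up to the given homothety, two parametrizations of
   the same curve; since the centroid curve is strictly supported by the lines
   it generates, a Clairaut type argument shows that they agree at every [th].
   As each chord cuts off a third of the affine length, three consecutive chords
   close up to a triangle, and [K] splits into this triangle and three caps.
   Comparing first moments, the centroid of the triangle does not depend on the
   triangle; the minimality of the support lines then says that each vertex moves
   parallel to the opposite side, up to second order. Hence the second moments of
   the triangles are constant and all vertices lie on one Steiner ellipse. *)
Require Import Defs.
From HB Require Import structures.
From mathcomp Require Import all_boot all_order all_algebra.
From mathcomp Require Import all_classical all_reals all_analysis.
From mathcomp Require Import measurable_realfun ring lra.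
Import Order.TTheory GRing.Theory Num.Theory.
Import numFieldNormedType.Exports.
Local Open Scope classical_set_scope.
Local Open Scope ring_scope.
Set Implicit Arguments.
Unset Strict Implicit.
Unset Printing Implicit Defensive.

(* Two obstacles shape the proof. The boundary is only $C^2$ and its curvature may vanish on arcs,
   so the affine length [S] is at first merely non-decreasing: a third of the length need not
   determine the end of an arc, and three consecutive chords might fail to close up. Triangles are
   therefore built only from points where the density [F] is non-zero; limits of such triangles are
   taken at both ends of a possible flat piece, and [no_jump] shows that the piece is a point.
   Secondly, chord ends are never shown to be differentiable in the angle, and the homothety is an
   equality of sets that relates no parameters. Only the support function [flot] is differentiated,
   and the constancy of the second moments comes from increments that are quadratic in a continuous
   parameter. The value one third enters twice. Three thirds close a triangle; and a third is less
   than a half, so that opposite caps are disjoint, [t_ th + t_ (th + pi) < 0], which rules out the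
   spurious solutions in the Clairaut argument. *)
Local Opaque cos sin pi.

(** * Invariance of plane Lebesgue measure under affine maps of determinant 1 *)

Section PlaneMeasure.
Variable R : realType.
Local Notation mR := (measurableTypeR R).
Local Notation lm := (@lebesgue_measure R).
Local Notation mu2 := (product_measure1 lm lm).
Implicit Types A B : set (R * R).

(** Lebesgue measure is determined by its values on half-open intervals, and a translation only
    shifts those. *)
Lemma lebesgue_measure_translate (A : set R) (c : R) : measurable A ->
  pushforward lm ((fun x : R => x + c) : mR -> mR) A = lm A.
Proof.
have mc : measurable_fun setT ((fun x : R => x + c) : mR -> mR).
  exact: measurable_funD.
move=> mA; apply/esym.
pose m : {measure set mR -> \bar R} := pushforward lm ((fun x : R => x + c) : mR -> mR).
refine (@lebesgue_measure_unique R (m mc) _ _ mA) => //= _ [[a b]] _ <-.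
rewrite /m /pushforward /=.
rewrite (_ : _ @^-1` _ = `]a - c, b - c]%classic); last first.
  by apply/seteqP; split => x /=; rewrite !in_itv /= ltrBlDr lerBrDr.
by rewrite !lebesgue_measure_itv/= !lte_fin; rewrite ltrD2r; case: ifP => // _; rewrite -!EFinB; congr EFin; ring.
Qed.

Lemma measurable_fun_aff (a b e : R) :
  measurable_fun setT ((fun x => a * x.1 + b * x.2 + e) : mR * mR -> mR).
Proof.
apply: measurable_funD => //; apply: measurable_funD; apply: measurable_funM => //.
Qed.

Lemma measurable_fun_aff2 (a b e c d f : R) :
  measurable_fun setT ((fun x => (a * x.1 + b * x.2 + e, c * x.1 + d * x.2 + f))
     : mR * mR -> mR * mR).
Proof. apply: measurable_fun_pair; exact: measurable_fun_aff. Qed.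

Definition affmap (a b e c d f : R) (x : R * R) : R * R :=
  (a * x.1 + b * x.2 + e, c * x.1 + d * x.2 + f).

Definition vshear k e (x : R * R) : R * R := (x.1, k * x.1 + x.2 + e).
Definition pswap (x : R * R) : R * R := (x.2, x.1).

(** Fubini: a vertical shear translates each vertical section by [k * x + e]. *)
Lemma leb2_vshear k e (A : set (mR * mR)) : measurable A ->
  leb2 (vshear k e @^-1` A) = leb2 A.
Proof.
move=> mA; rewrite /leb2 /product_measure1; apply: eq_integral => x _ /=.
rewrite -(lebesgue_measure_translate (k * x + e) (measurable_xsection x mA)).
rewrite /pushforward; congr lebesgue_measure; apply/seteqP; split=> y /=;
 by rewrite /xsection /= !inE /vshear /= (_ : y + _ = k * x + y + e)//; lra.
Qed.

Lemma leb2_pswap (A : set (mR * mR)) : measurable A ->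
  leb2 (pswap @^-1` A) = leb2 A.
Proof.
have mp : measurable_fun setT (pswap : mR * mR -> mR * mR).
  exact: measurable_fun_pair.
move=> mA; apply/esym.
pose m : {measure set (mR * mR) -> \bar R} := pushforward mu2 (pswap : mR * mR -> mR * mR).
apply: (@product_measure_unique _ _ _ _ _ lm lm (m mp)) => // B C mB mC.
transitivity (mu2 (C `*` B)); last by rewrite [LHS]product_measure1E // muleC.
rewrite /m /= /pushforward; congr (mu2 _).
by apply/seteqP; split => -[x y] [].
Qed.

Lemma measurable_vshear k e : measurable_fun setT (vshear k e : mR * mR -> mR * mR).
Proof.
apply: measurable_fun_pair => //.
apply: measurable_funD => //; apply: measurable_funD => //; exact: measurable_funM.
Qed.

Lemma measurable_pswap : measurable_fun setT (pswap : mR * mR -> mR * mR).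
Proof. exact: measurable_fun_pair. Qed.

Lemma measurable_pre (phi : R * R -> R * R) A :
  measurable_fun setT (phi : mR * mR -> mR * mR) ->
  measurable (A : set (mR * mR)) -> measurable ((phi @^-1` A) : set (mR * mR)).
Proof. by move=> mp mA; rewrite -[X in measurable X]setTI; exact: mp. Qed.

Lemma leb2_hshear k e (A : set (mR * mR)) : measurable A ->
  leb2 ((fun x => (x.1 + k * x.2 + e, x.2)) @^-1` A) = leb2 A.
Proof.
move=> mA; rewrite -(leb2_pswap mA).
rewrite -(leb2_vshear k e (measurable_pre measurable_pswap mA)) -[RHS]leb2_pswap; last first.
  exact: measurable_pre (measurable_vshear _ _) (measurable_pre measurable_pswap mA).
congr leb2; apply/seteqP; split => -[x y];
  by rewrite /= /pswap /vshear /= (_ : x + k * y + e = k * y + x + e)//; ring.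
Qed.

Lemma measurable_hshear k e : measurable_fun setT
  ((fun x => (x.1 + k * x.2 + e, x.2)) : mR * mR -> mR * mR).
Proof.
apply: measurable_fun_pair => //.
apply: measurable_funD => //; apply: measurable_funD => //; exact: measurable_funM.
Qed.

Lemma measurable_affmap a b e c d f :
  measurable_fun setT (affmap a b e c d f : mR * mR -> mR * mR).
Proof. exact: measurable_fun_aff2. Qed.

(** When the lower left entry is non-zero, a matrix of determinant 1 is a product of a horizontal, a
    vertical and a horizontal shear; the translation is absorbed into them. *)
Lemma leb2_affmap a b e c d f (A : set (mR * mR)) :
  a * d - b * c = 1 -> measurable A ->
  leb2 (affmap a b e c d f @^-1` A) = leb2 A.
Proof.
have gen a' b' e' c' d' f' (B : set (mR * mR)) : c' != 0 ->
  a' * d' - b' * c' = 1 -> measurable B ->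
  leb2 (affmap a' b' e' c' d' f' @^-1` B) = leb2 B.
  move=> c0 D1 mB.
  have m1 := measurable_pre (measurable_hshear ((a' - 1) / c') (e' - (a' - 1) / c' * f')) mB.
  have m2 := measurable_pre (measurable_vshear c' f') m1.
  rewrite -(leb2_hshear ((a' - 1) / c') (e' - (a' - 1) / c' * f') mB).
  rewrite -(leb2_vshear c' f' m1) -(leb2_hshear ((d' - 1) / c') 0 m2).
  congr leb2; apply/seteqP; split => -[x y]; rewrite /= /affmap /vshear /= => H.
  - apply: eq_ind H _ _; congr (_, _).
      have -> : b' = (a' * d' - 1) / c' by rewrite -D1; field.
      by field.
    by field.
  - apply: eq_ind H _ _; congr (_, _).
      have -> : b' = (a' * d' - 1) / c' by rewrite -D1; field.
      by field.
    by field.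
move=> D1 mA; have [c0|] := eqVneq c 0; last by move=> c0; exact: gen.
have d0 : d != 0 by apply/eqP => d0; move: D1; rewrite c0 d0; lra.
have m1 := measurable_pre (measurable_affmap a b e c d f) mA.
(* For [c = 0], composing with a vertical shear turns the lower left entry into [c + d = d], which
   is non-zero. *)
rewrite -(leb2_vshear 1 0 m1).
rewrite -(@gen (a + b) b e (c + d) d f A) //; last 2 first.
- by rewrite c0 add0r.
- by rewrite -D1; ring.
congr leb2; apply/seteqP; split => -[x y]; rewrite /= /affmap /vshear /= => H;
  by apply: eq_ind H _ _; congr (_, _); ring.
Qed.

(* Open sets are unions of the rational boxes they contain. *)
Lemma measurable_open2 A : open A -> measurable (A : set (mR * mR)).
Proof.
move=> oA.
pose B (q : rat * rat * rat) : set (mR * mR) :=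
  `](ratr q.1.1 - ratr q.2), (ratr q.1.1 + ratr q.2)[%classic `*`
  `](ratr q.1.2 - ratr q.2), (ratr q.1.2 + ratr q.2)[%classic.
have -> : A = \bigcup_(q in [set q | B q `<=` A]) B q.
  apply/seteqP; split => [x Ax|x [q /= qA /qA]//].
  have [e /= e0 eA] : nbhs_ball x A by apply/nbhs_ballP; exact: oA.
  have [r re] : exists r : rat, ratr r \in `]0, (e / 2)[.
    by apply: rat_in_itvoo; lra.
  move: re; rewrite in_itv /= => /andP[r0 re].
  have [p pe] : exists p : rat, ratr p \in `](x.1 - ratr r), (x.1 + ratr r)[.
    by apply: rat_in_itvoo; lra.
  have [q qe] : exists q : rat, ratr q \in `](x.2 - ratr r), (x.2 + ratr r)[.
    by apply: rat_in_itvoo; lra.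
  move: pe qe; rewrite !in_itv /= => /andP[p1 p2] /andP[q1 q2].
  exists (p, q, r) => /=; last first.
    by split; rewrite /= in_itv /=; apply/andP; split; lra.
  move=> [y1 y2] [/= ]; rewrite !in_itv /= => /andP[? ?] /andP[? ?].
  by apply: eA; split; rewrite /ball /= ltr_norml; apply/andP; split; lra.
rewrite bigcup_mkcond; apply: countable_bigcupT_measurable => // q.
case: ifP => _ //; apply: measurableX; exact: measurable_itv.
Qed.

Lemma measurable_closed2 A : closed A -> measurable (A : set (mR * mR)).
Proof.
by move=> /closed_openC/measurable_open2/measurableC; rewrite setCK.
Qed.

Lemma measurable_dot_le (a b t : R) :
  measurable ([set x | a * x.1 + b * x.2 <= t] : set (mR * mR)).
Proof.
rewrite (_ : [set _ | _] = (fun x : R * R => a * x.1 + b * x.2 + 0) @^-1` `]-oo, t]%classic).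
  rewrite -[X in measurable X]setTI; exact: measurable_fun_aff.
by apply/seteqP; split => x /=; rewrite in_itv /= addr0.
Qed.

Lemma leb2_box (a b c d : R) : a <= b -> c <= d ->
  leb2 (`[a, b]%classic `*` `[c, d]%classic) = ((b - a) * (d - c))%:E.
Proof.
move=> ab cd; rewrite [LHS]product_measure1E //.
rewrite [X in (X * _)%E]lebesgue_measure_itv [X in (_ * X)%E]lebesgue_measure_itv /= !lte_fin.
have [->|/negPf ab'] := eqVneq a b; first by rewrite ltxx subrr mul0r mul0e.
have [->|/negPf cd'] := eqVneq c d; first by rewrite ltxx subrr mulr0 mule0.
by rewrite !lt_neqAle ab' cd' ab cd /=.
Qed.

End PlaneMeasure.

(** * Area and first moments of bounded measurable sets *)

Section BoundedSets.
Variable R : realType.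
Local Notation mR := (measurableTypeR R).
Local Notation lm := (@lebesgue_measure R).
Local Notation mu2 := (product_measure1 lm lm).
Implicit Types A B : set (R * R).

(** On such sets every affine function is integrable, which removes the integrability side
    conditions from all later splittings. *)
Definition bmset A := measurable (A : set (mR * mR)) /\
  exists D, forall x, A x -> `|x.1| <= D /\ `|x.2| <= D.

Definition ar A : R := fine (leb2 A).

(** Integrals of affine functions treat the area (coefficients 0, 0, 1) and both first moments
    uniformly, and the family is stable under affine changes of variables. *)
Definition aint A (p q r : R) : R :=
  \int[mu2]_(x in A) (p * x.1 + q * x.2 + r).

Lemma bmset_sub A B : bmset A -> measurable (B : set (mR * mR)) -> B `<=` A -> bmset B.
Proof. by move=> [mA [D hD]] mB BA; split => //; exists D => x /BA /hD. Qed.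

Lemma bmsetI A B : bmset A -> measurable (B : set (mR * mR)) -> bmset (A `&` B).
Proof.
move=> bA mB; apply: bmset_sub (bA) _ _; last by move=> x [].
by apply: measurableI => //; case: bA.
Qed.

Lemma bmsetD A B : bmset A -> measurable (B : set (mR * mR)) -> bmset (A `\` B).
Proof.
move=> bA mB; apply: bmset_sub (bA) _ _; last by move=> x [].
by apply: measurableD => //; case: bA.
Qed.

Lemma bmset_leb2 A : bmset A -> leb2 A = (ar A)%:E.
Proof.
move=> [mA [D hD]]; rewrite /ar fineK // ge0_fin_numE; last exact: measure_ge0.
apply: (@le_lt_trans _ _ (leb2 (`[- `|D|, `|D|]%classic `*` `[- `|D|, `|D|]%classic))).
  rewrite /leb2; apply: le_measure; rewrite ?inE //.
    by apply: measurableX; exact: measurable_itv.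
  move=> x /hD [h1 h2]; split => /=; rewrite in_itv /= -ler_norml;
    exact: le_trans (ler_norm D).
by rewrite leb2_box ?ltry // ge0_cp // normr_ge0.
Qed.

Lemma ar_ge0 A : 0 <= ar A.
Proof. by apply: fine_ge0; exact: measure_ge0. Qed.

Lemma ar_le A B : bmset A -> bmset B -> A `<=` B -> ar A <= ar B.
Proof.
move=> bA bB AB; rewrite -lee_fin -!bmset_leb2 //.
by apply: le_measure; rewrite ?inE; [case: bA|case: bB|].
Qed.

Lemma bmset_int A p q r : bmset A ->
  mu2.-integrable A (EFin \o (fun x : R * R => p * x.1 + q * x.2 + r)).
Proof.
move=> bA; apply: measurable_bounded_integrable.
- by case: bA.
- by change (leb2 A < +oo)%E; rewrite bmset_leb2 // ltry.
- by apply: measurable_funTS; exact: measurable_fun_aff.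
- have [_ [D hD]] := bA.
  exists (`|p| * D + `|q| * D + `|r|); split; first exact: num_real.
  move=> M hM x Ax /=; apply/ltW; apply: le_lt_trans hM.
  have [h1 h2] := hD _ Ax.
  rewrite (le_trans (ler_normD _ _)) // lerD2r (le_trans (ler_normD _ _)) //.
  by rewrite !normrM; apply: lerD; apply: ler_wpM2l.
Qed.

Lemma aint_lin A p q r : bmset A ->
  aint A p q r = p * aint A 1 0 0 + q * aint A 0 1 0 + r * ar A.
Proof.
move=> bA; have mA : measurable (A : set (mR * mR)) by case: bA.
have i1 := bmset_int 1 0 0 bA; have i2 := bmset_int 0 1 0 bA.
have i3 := bmset_int p q 0 bA; have i4 := bmset_int 0 0 r bA.
have i5 := bmset_int p 0 0 bA; have i6 := bmset_int 0 q 0 bA.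
rewrite /aint -!RintegralZl // -(Rintegral_cst mu2 mA) -!RintegralD //=.
- have E (u v : R) : p * u + q * v + r =
      p * (1 * u + 0 * v + 0) + q * (0 * u + 1 * v + 0) + r by ring.
  by apply: eq_Rintegral => x _; exact: E.
- have E (u v : R) : p * u + q * v + 0 =
      p * (1 * u + 0 * v + 0) + q * (0 * u + 1 * v + 0) by ring.
  by apply: eq_integrable i3 => // x _ /=; congr EFin; exact: E.
- have E (u v : R) : 0 * u + 0 * v + r = r by ring.
  by apply: eq_integrable i4 => // x _ /=; congr EFin; exact: E.
- have E (u v : R) : p * u + 0 * v + 0 = p * (1 * u + 0 * v + 0) by ring.
  by apply: eq_integrable i5 => // x _ /=; congr EFin; exact: E.
- have E (u v : R) : 0 * u + q * v + 0 = q * (0 * u + 1 * v + 0) by ring.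
  by apply: eq_integrable i6 => // x _ /=; congr EFin; exact: E.
Qed.

Lemma aint_setU A B p q r : bmset (A `|` B) -> measurable (A : set (mR * mR)) ->
  measurable (B : set (mR * mR)) -> A `&` B = set0 ->
  aint (A `|` B) p q r = aint A p q r + aint B p q r.
Proof.
move=> bAB mA mB AB; apply: Rintegral_setU => //; first exact: bmset_int.
exact/disj_set2P.
Qed.

Lemma aint_split A B p q r : bmset A -> measurable (B : set (mR * mR)) ->
  aint A p q r = aint (A `&` B) p q r + aint (A `\` B) p q r.
Proof.
move=> bA mB; rewrite -aint_setU ?setUIDK //.
- by case: (bmsetI bA mB).
- by case: (bmsetD bA mB).
- by apply/seteqP; split => // x [[_ ?] [_]].
Qed.

Lemma aint1 A : bmset A -> aint A 0 0 1 = ar A.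
Proof. by move=> bA; rewrite aint_lin //; ring. Qed.

Lemma ar_split A B : bmset A -> measurable (B : set (mR * mR)) ->
  ar A = ar (A `&` B) + ar (A `\` B).
Proof.
move=> bA mB; rewrite -!aint1 //; [exact: aint_split|exact: bmsetD|exact: bmsetI].
Qed.

Lemma aint_ge A p q r c : bmset A ->
  (forall x, A x -> c <= p * x.1 + q * x.2 + r) -> c * ar A <= aint A p q r.
Proof.
move=> bA h; have mA : measurable (A : set (mR * mR)) by case: bA.
rewrite /ar /leb2 -(Rintegral_cst mu2 mA); apply: le_Rintegral => //.
  have E (u v : R) : 0 * u + 0 * v + c = c by ring.
  by have := bmset_int 0 0 c bA; apply: eq_integrable => // x _ /=; congr EFin; exact: E.
exact: bmset_int.
Qed.

Lemma aint_le A p q r c : bmset A ->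
  (forall x, A x -> p * x.1 + q * x.2 + r <= c) -> aint A p q r <= c * ar A.
Proof.
move=> bA h; have mA : measurable (A : set (mR * mR)) by case: bA.
rewrite /ar /leb2 -(Rintegral_cst mu2 mA); apply: le_Rintegral => //.
  exact: bmset_int.
have E (u v : R) : 0 * u + 0 * v + c = c by ring.
by have := bmset_int 0 0 c bA; apply: eq_integrable => // x _ /=; congr EFin; exact: E.
Qed.

Lemma aint_null A p q r : bmset A -> ar A = 0 -> aint A p q r = 0.
Proof.
move=> bA A0; have [_ [D hD]] := bA.
have b x : A x -> `|p * x.1 + q * x.2 + r| <= `|p| * D + `|q| * D + `|r|.
  move=> /hD [h1 h2].
  rewrite (le_trans (ler_normD _ _)) // lerD2r (le_trans (ler_normD _ _)) //.
  by rewrite !normrM; apply: lerD; apply: ler_wpM2l.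
apply/eqP; rewrite eq_le; apply/andP; split.
  rewrite (le_trans (@aint_le A p q r (`|p| * D + `|q| * D + `|r|) bA _)) ?A0 ?mulr0 //.
  by move=> x /b; rewrite ler_norml => /andP[].
rewrite (le_trans _ (@aint_ge A p q r (- (`|p| * D + `|q| * D + `|r|)) bA _)) ?A0 ?mulr0 //.
by move=> x /b; rewrite ler_norml => /andP[].
Qed.

(** If the integral were zero, the integrand would vanish almost everywhere; being positive on all
    of [A], it would make [A] a null set. *)
Lemma aint_gt0 A p q r : bmset A -> 0 < ar A ->
  (forall x, A x -> 0 < p * x.1 + q * x.2 + r) -> 0 < aint A p q r.
Proof.
move=> bA A0 h; have mA : measurable (A : set (mR * mR)) by case: bA.
have ge : 0 <= aint A p q r.
  by rewrite -[0](mul0r (ar A)); apply: aint_ge => // x /h /ltW.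
rewrite lt_neqAle ge andbT; apply/eqP => e0.
pose f x : \bar R := (p * x.1 + q * x.2 + r)%:E.
have mf : measurable_fun (A : set (mR * mR)) f.
  apply/measurable_EFinP; apply: measurable_funTS; exact: measurable_fun_aff.
have : (\int[mu2]_(x in A) `|f x| = 0)%E.
  transitivity (\int[mu2]_(x in A) f x)%E.
    by apply: eq_integral => x /set_mem /h hx; rewrite gee0_abs // lee_fin ltW.
  have fn := integrable_fin_num mA (bmset_int p q r bA).
  by apply: (etrans (esym (fineK fn))); congr EFin; exact: esym e0.
move/(ae_eq_integral_abs mu2 mA mf) => [N [mN N0 AN]].
have : (leb2 A <= mu2 N)%E.
  apply: le_measure; rewrite ?inE // => x Ax; apply: AN => /= /(_ Ax) [].
  by move=> e; have := h _ Ax; rewrite e ltxx.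
by rewrite N0 bmset_leb2 // lee_fin leNgt A0.
Qed.

Lemma ar_open A (U : set (R * R)) : bmset A -> open U -> U !=set0 -> U `<=` A -> 0 < ar A.
Proof.
move=> bA oU [x Ux] UA.
have [e /= e0 eA] : nbhs_ball x U by apply/nbhs_ballP; exact: oU.
pose B := `[x.1 - e / 2, x.1 + e / 2]%classic `*` `[x.2 - e / 2, x.2 + e / 2]%classic.
have BA : B `<=` A.
  move=> y [/=]; rewrite !in_itv /= => /andP[? ?] /andP[? ?]; apply/UA/eA.
  by split; rewrite /ball /= ltr_norml; apply/andP; split; lra.
have mB : measurable (B : set (mR * mR)).
  by apply: measurableX; exact: measurable_itv.
have bB := bmset_sub bA mB BA.
apply: lt_le_trans (ar_le bB bA BA).
rewrite /ar leb2_box /=; [|lra|lra].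
by apply: mulr_gt0; lra.
Qed.

Lemma affmap_ar a b e c d f A : a * d - b * c = 1 -> measurable (A : set (mR * mR)) ->
  ar (affmap a b e c d f @^-1` A) = ar A.
Proof. by move=> D1 mA; rewrite /ar leb2_affmap. Qed.

(** Change of variables; the coefficients on the left are those of the integrand composed with the
    map. *)
Lemma affmap_aint a b e c d f A p q r : a * d - b * c = 1 -> bmset A ->
  bmset (affmap a b e c d f @^-1` A) ->
  aint (affmap a b e c d f @^-1` A) (p * a + q * c) (p * b + q * d) (p * e + q * f + r)
  = aint A p q r.
Proof.
move=> D1 bA bpA; have mA : measurable (A : set (mR * mR)) by case: bA.
pose phi := affmap a b e c d f : mR * mR -> mR * mR.
have mphi : measurable_fun setT phi by exact: measurable_affmap.
pose F x : \bar R := (p * x.1 + q * x.2 + r)%:E.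
have mF : measurable_fun (setT : set (mR * mR)) F.
  apply/measurable_EFinP; exact: measurable_fun_aff.
have iF := bmset_int (p * a + q * c) (p * b + q * d) (p * e + q * f + r) bpA.
have E x : (EFin \o (fun x : R * R =>
    (p * a + q * c) * x.1 + (p * b + q * d) * x.2 + (p * e + q * f + r))) x = (F \o phi) x.
  by rewrite /= /F /phi /affmap /=; congr EFin; ring.
rewrite /aint /Rintegral; congr fine.
transitivity (\int[mu2]_(x in phi @^-1` A) (F \o phi) x)%E.
  by apply: eq_integral => x _; rewrite -E.
have iF' : mu2.-integrable (phi @^-1` A) (F \o phi).
  by apply: eq_integrable iF => //; case: bpA.
apply: (etrans (esym (integral_pushforward mphi mF iF' mA))).
by apply: eq_measure_integral => B mB _; exact: leb2_affmap.
Qed.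

Lemma ar_box (a b c d : R) : a <= b -> c <= d ->
  ar (`[a, b]%classic `*` `[c, d]%classic) = (b - a) * (d - c).
Proof. by move=> ab cd; rewrite /ar leb2_box. Qed.

Lemma ar_set0 : ar (set0 : set (R * R)) = 0.
Proof. by rewrite /ar /leb2 measure0. Qed.

Lemma centroidE A : centroid A = (aint A 1 0 0 / ar A, aint A 0 1 0 / ar A).
Proof.
have E1 (u v : R) : u = 1 * u + 0 * v + 0 by ring.
have E2 (u v : R) : v = 0 * u + 1 * v + 0 by ring.
rewrite /centroid /ar /area; congr (_ / _, _ / _).
  by apply: eq_Rintegral => x _; exact: E1.
by apply: eq_Rintegral => x _; exact: E2.
Qed.

End BoundedSets.

Global Opaque ar aint.

(** * Elementary estimates for rotations and thin strips *)

Section Basic.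
Variable R : realType.
Implicit Types (x y z : R * R) (A : set (R * R)).

Lemma interiorP A x : interior A x <->
  exists2 e, 0 < e & forall y, `|x.1 - y.1| < e -> `|x.2 - y.2| < e -> A y.
Proof.
split.
  move=> /nbhs_ballP [e /= e0 eA]; exists e => // y h1 h2; apply: eA; split; exact.
move=> [e e0 h]; apply/nbhs_ballP; exists e => //= y [h1 h2]; exact: h.
Qed.

Lemma dot_continuous (v : R * R) : continuous (fun x => dot x v).
Proof.
move=> x; rewrite /dot; apply: cvgD; apply: cvgM; try exact: cvg_cst.
  exact: cvg_fst.
exact: cvg_snd.
Qed.

Lemma sin_lip (a b : R) : `|sin a - sin b| <= `|a - b|.
Proof.
wlog ab : a b / a <= b => [h|].
  by have [/h//|/ltW/h] := leP a b; rewrite distrC [X in _ <= X]distrC.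
have [] := @MVT_segment R sin cos a b ab.
- by apply: continuous_subspaceT; exact: continuous_sin.
- move=> c _ e; rewrite distrC [X in _ <= X]distrC e normrM.
  by rewrite -[X in _ <= X]mul1r ler_wpM2r // cos_max.
Qed.

Lemma cos_lip (a b : R) : `|cos a - cos b| <= `|a - b|.
Proof.
rewrite -!sinDpihalf; apply: le_trans (sin_lip _ _) _.
by rewrite (_ : _ - _ = a - b) //; ring.
Qed.

Lemma sin2Dcos2 (a : R) : sin a ^+ 2 + cos a ^+ 2 = 1.
Proof. by rewrite cos2sin2; ring. Qed.

Lemma uvecDpi a : uvec (a + pi) = (- cos a, - sin a) :> R * R.
Proof. by rewrite /uvec cosDpi sinDpi. Qed.

Lemma uvec_shift a b : uvec (a + b) =
  (cos a * cos b - sin a * sin b, sin a * cos b + cos a * sin b) :> R * R.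
Proof. by rewrite /uvec cosD sinD. Qed.

Lemma measurable_halfplane (th t : R) :
  measurable (halfplane th t : set (measurableTypeR R * measurableTypeR R)).
Proof.
have := measurable_dot_le (cos th) (sin th) t; congr measurable.
by apply/seteqP; split => x; rewrite /halfplane /dot /uvec /= ![_ * cos _]mulrC ![_ * sin _]mulrC.
Qed.

(* Rotating the strip to an axis-parallel position puts it in a box. *)
Lemma ar_strip A D (th t t' : R) : bmset A -> 0 <= D ->
  (forall x, A x -> `|x.1| <= D /\ `|x.2| <= D) -> t <= t' ->
  (forall x, A x -> t <= dot x (uvec th) <= t') -> ar A <= 4 * D * (t' - t).
Proof.
move=> bA D0 hD tt h.
(* A point with both entries at most [D] in absolute value has rotated coordinates at most [2 * D],
   whence the width [4 * D]. *)
pose B := `[- (2 * D), 2 * D]%classic `*` `[t, t']%classic : set (R * R).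
have mB : measurable (B : set (measurableTypeR R * measurableTypeR R)).
  by apply: measurableX; exact: measurable_itv.
pose f := affmap (sin th) (- cos th) 0 (cos th) (sin th) 0.
have d1 : sin th * sin th - (- cos th) * cos th = 1.
  by rewrite -(sin2Dcos2 th); ring.
have AB : A `<=` f @^-1` B.
  move=> x Ax; rewrite /f /affmap; have [h1 h2] := hD _ Ax; split => /=.
    rewrite in_itv /= -ler_norml addr0 (le_trans (ler_normD _ _)) // !normrM normrN.
    have := sin_max th; have := cos_max th => c1 c2.
    rewrite (_ : 2 * D = 1 * D + 1 * D); last by ring.
    by apply: lerD; apply: ler_pM.
  rewrite in_itv /= addr0 mulrC [sin th * _]mulrC; exact: (h _ Ax).
have -> : 4 * D * (t' - t) = ar (f @^-1` B).
  by rewrite affmap_ar // ar_box //; [ring|lra].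
have bf : bmset (f @^-1` B).
  split; first exact: measurable_pre (measurable_affmap _ _ _ _ _ _) mB.
  exists (2 * D + `|t| + `|t'|) => x; rewrite /f /affmap /B /= !in_itv /= !addr0.
  move=> [/andP[u1 u2] /andP[v1 v2]].
  have bt : `|cos th * x.1 + sin th * x.2| <= `|t| + `|t'|.
    rewrite ler_norml; apply/andP; split.
      rewrite (le_trans _ v1) // -[leRHS]opprK lerN2.
      by rewrite (le_trans (ler_norm _)) // normrN lerDl.
    by rewrite (le_trans v2) // (le_trans (ler_norm _)) // lerDr.
  have bs : `|sin th * x.1 + - cos th * x.2| <= 2 * D.
    by rewrite ler_norml; apply/andP; split; lra.
  have e1 : x.1 = sin th * (sin th * x.1 + - cos th * x.2) +
    cos th * (cos th * x.1 + sin th * x.2).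
    transitivity ((sin th ^+ 2 + cos th ^+ 2) * x.1); last by ring.
    by rewrite sin2Dcos2 mul1r.
  have e2 : x.2 = - cos th * (sin th * x.1 + - cos th * x.2) +
    sin th * (cos th * x.1 + sin th * x.2).
    transitivity ((sin th ^+ 2 + cos th ^+ 2) * x.2); last by ring.
    by rewrite sin2Dcos2 mul1r.
  move: bt bs e1 e2; move: (_ + - cos th * _) (_ + sin th * _) => u v bv bu -> ->.
  have := sin_max th; have := cos_max th => c1 c2.
  rewrite -addrA; split; rewrite (le_trans (ler_normD _ _)) // !normrM ?normrN.
    by apply: lerD; rewrite -[leRHS]mul1r; apply: ler_pM.
  by apply: lerD; rewrite -[leRHS]mul1r; apply: ler_pM.
exact: ar_le.
Qed.

End Basic.

(** * Caps of a convex body and the position of the flotation line *)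

Section Body.
Variables (R : realType) (K : set (R * R)).
Hypothesis cK : convex_body K.
Implicit Types (x y z : R * R) (A : set (R * R)).

Lemma body_closed : closed K.
Proof. by case: cK => h _ _; apply: compact_closed => //; exact: norm_hausdorff. Qed.

Lemma body_convex : Defs.convex_set K. Proof. case: cK => _ h _; exact: h. Qed.

Lemma body_bounded : exists2 D, 0 < D & forall x, K x -> `|x.1| <= D /\ `|x.2| <= D.
Proof.
case: cK => /compact_bounded [M [_ h]] _ _.
exists (`|M| + 1); first by rewrite ltr_wpDl.
move=> x Kx; have hM : `|M| + 1 > M by rewrite (le_lt_trans (ler_norm M)) // ltrDl.
have := h _ hM x Kx => /=; rewrite prod_normE /= ge_max; by move=> /andP[].
Qed.

Lemma bmset_body : bmset K.
Proof.
split; first exact: measurable_closed2 body_closed.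
by have [D _ h] := body_bounded; exists D.
Qed.

Lemma body_inner : exists z, interior K z. Proof. by case: cK. Qed.

Lemma interior_sub x : interior K x -> K x. Proof. exact: interior_subset. Qed.

(** The ball around [z], shrunk by the factor [1 - s] towards [x], is a neighbourhood of the mixed
    point inside [K]. *)
Lemma interior_seg z x s : interior K z -> K x -> 0 <= s < 1 ->
  interior K (s * x.1 + (1 - s) * z.1, s * x.2 + (1 - s) * z.2).
Proof.
move=> /interiorP [e e0 h] Kx /andP[s0 s1]; apply/interiorP.
have t0 : 0 < 1 - s by lra.
exists ((1 - s) * e); first exact: mulr_gt0.
move=> y /= h1 h2.
pose w := ((y.1 - s * x.1) / (1 - s), (y.2 - s * x.2) / (1 - s)).
have -> : y = (s * x.1 + (1 - s) * w.1, s * x.2 + (1 - s) * w.2).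
  by rewrite /w /= [y in LHS]surjective_pairing; congr (_, _); field; lra.
apply: body_convex => //; last by rewrite s0 ltW.
apply: h; rewrite /w /=.
- have -> : z.1 - (y.1 - s * x.1) / (1 - s) =
    (s * x.1 + (1 - s) * z.1 - y.1) / (1 - s) by field; lra.
  by rewrite normrM normfV (gtr0_norm t0) ltr_pdivrMr // [e * _]mulrC.
- have -> : z.2 - (y.2 - s * x.2) / (1 - s) =
    (s * x.2 + (1 - s) * z.2 - y.2) / (1 - s) by field; lra.
  by rewrite normrM normfV (gtr0_norm t0) ltr_pdivrMr // [e * _]mulrC.
Qed.

Definition cap th t := K `&` halfplane th t.

Lemma bmset_cap th t : bmset (cap th t).
Proof. by apply: bmsetI; [exact: bmset_body|exact: measurable_halfplane]. Qed.

Lemma dot_seg x z s (v : R * R) :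
  dot (s * x.1 + (1 - s) * z.1, s * x.2 + (1 - s) * z.2) v = s * dot x v + (1 - s) * dot z v.
Proof. by rewrite /dot /=; ring. Qed.

Lemma cap_le th t t' : t <= t' -> ar (cap th t) <= ar (cap th t').
Proof.
move=> tt; apply: ar_le; [exact: bmset_cap|exact: bmset_cap|].
by move=> x [Kx h]; split => //; exact: le_trans h tt.
Qed.

Lemma ar_line_body A th t : measurable (A : set (measurableTypeR R * measurableTypeR R)) ->
  A `<=` K -> (forall x, A x -> dot x (uvec th) = t) -> ar A = 0.
Proof.
move=> mA AK h; have [D D0 hD] := body_bounded.
have bA : bmset A by exact: bmset_sub bmset_body mA AK.
apply/eqP; rewrite eq_le ar_ge0 andbT.
rewrite (le_trans (@ar_strip _ A D th t t bA (ltW D0) _ (lexx _) _)) //.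
- by move=> x /AK /hD.
- by move=> x /h ->; rewrite lexx.
- by rewrite subrr mulr0.
Qed.

Lemma inner_below th t : 0 < ar (cap th t) ->
  exists2 x, interior K x & dot x (uvec th) < t.
Proof.
move=> h; have [[x Kx xt]|n] := pselect (exists2 x, K x & dot x (uvec th) < t).
  have [z iz] := body_inner.
  have [zt|zt] := ltP (dot z (uvec th)) t; first by exists z.
  pose u := dot z (uvec th) - dot x (uvec th).
  have u0 : 0 < u by rewrite /u; lra.
  (* With this weight the mixture lies halfway between the height of [x] and [t]. *)
  pose s := 1 - (t - dot x (uvec th)) / (2 * u).
  have s1 : 0 < (t - dot x (uvec th)) / (2 * u) by apply: divr_gt0; lra.
  have s2 : (t - dot x (uvec th)) / (2 * u) <= 1.
    by rewrite ler_pdivrMr; [rewrite /u; lra|lra].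
  exists (s * x.1 + (1 - s) * z.1, s * x.2 + (1 - s) * z.2).
    by apply: interior_seg => //; rewrite /s; apply/andP; split; lra.
  rewrite dot_seg /s (_ : _ + _ = (t + dot x (uvec th)) / 2); first by lra.
  by rewrite /u; field; rewrite -/u; lra.
suff : ar (cap th t) = 0 by lra.
apply: (@ar_line_body _ th t); [by case: (bmset_cap th t)|by move=> x []|].
move=> x [Kx /= xt]; apply/eqP; rewrite eq_le xt /= leNgt; apply/negP => h'.
by apply: n; exists x.
Qed.

Lemma inner_above th t : ar (cap th t) < ar K ->
  exists2 x, interior K x & t < dot x (uvec th).
Proof.
move=> h; have [[x Kx xt]|n] := pselect (exists2 x, K x & t < dot x (uvec th)).
  have [z iz] := body_inner.
  have [zt|zt] := ltP t (dot z (uvec th)); first by exists z.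
  pose u := dot x (uvec th) - dot z (uvec th).
  have u0 : 0 < u by rewrite /u; lra.
  pose s := 1 - (dot x (uvec th) - t) / (2 * u).
  have s1 : 0 < (dot x (uvec th) - t) / (2 * u) by apply: divr_gt0; lra.
  have s2 : (dot x (uvec th) - t) / (2 * u) <= 1.
    by rewrite ler_pdivrMr; [rewrite /u; lra|lra].
  exists (s * x.1 + (1 - s) * z.1, s * x.2 + (1 - s) * z.2).
    by apply: interior_seg => //; rewrite /s; apply/andP; split; lra.
  rewrite dot_seg /s (_ : _ + _ = (t + dot x (uvec th)) / 2); first by lra.
  by rewrite /u; field; rewrite -/u; lra.
suff : cap th t = K by move=> e; move: h; rewrite e ltxx.
apply/seteqP; split => [x []//|x Kx]; split => //.
by rewrite /halfplane /= leNgt; apply/negP => h'; apply: n; exists x.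
Qed.

Lemma inner_between th t t' : 0 < ar (cap th t) -> ar (cap th t) < ar K -> t < t' ->
  exists2 x, interior K x & t < dot x (uvec th) < t'.
Proof.
move=> /inner_below [x ix xt] /inner_above [y iy ty] tt.
have [yt|yt] := ltP (dot y (uvec th)) t'; first by exists y => //; rewrite ty.
pose u := dot y (uvec th) - dot x (uvec th).
have u0 : 0 < u by rewrite /u; lra.
pose s := ((t + t') / 2 - dot x (uvec th)) / u.
have s0 : 0 <= s by apply: divr_ge0; lra.
have s1 : s < 1 by rewrite /s ltr_pdivrMr // /u; lra.
exists (s * y.1 + (1 - s) * x.1, s * y.2 + (1 - s) * x.2).
  by apply: interior_seg => //; [exact: interior_sub|rewrite s0 s1].
rewrite dot_seg (_ : _ + _ = (t + t') / 2); first by lra.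
by rewrite /s /u; field; rewrite -/u; lra.
Qed.

Lemma inner_on th t : 0 < ar (cap th t) -> ar (cap th t) < ar K ->
  exists2 x, interior K x & dot x (uvec th) = t.
Proof.
move=> /inner_below [x ix xt] /inner_above [y iy ty].
pose u := dot y (uvec th) - dot x (uvec th).
have u0 : 0 < u by rewrite /u; lra.
pose s := (t - dot x (uvec th)) / u.
have s0 : 0 <= s by apply: divr_ge0; lra.
have s1 : s < 1 by rewrite /s ltr_pdivrMr // /u; lra.
exists (s * y.1 + (1 - s) * x.1, s * y.2 + (1 - s) * x.2).
  by apply: interior_seg => //; [exact: interior_sub|rewrite s0 s1].
rewrite dot_seg /s; apply: (@mulfI _ u); first by lra.
by rewrite /u; field; rewrite -/u; lra.
Qed.

(** Interior points with height strictly between the two levels form a non-empty open set that only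
    the larger cap contains. *)
Lemma cap_lt th t t' : 0 < ar (cap th t) -> ar (cap th t) < ar K -> t < t' ->
  ar (cap th t) < ar (cap th t').
Proof.
move=> h1 h2 tt; have [x ix /andP[xt1 xt2]] := inner_between h1 h2 tt.
rewrite (ar_split (bmset_cap th t') (measurable_halfplane th t)).
have -> : cap th t' `&` halfplane th t = cap th t.
  apply/seteqP; split => y; first by move=> [[]].
  by move=> [Ky h]; split => //; split => //=; apply: le_trans h (ltW tt).
rewrite ltrDl.
pose U := interior K `&` ((fun x => dot x (uvec th)) @^-1` `]t, t'[%classic).
apply: (@ar_open _ _ U).
- by apply: bmsetD; [exact: bmset_cap|exact: measurable_halfplane].
- apply: openI; first exact: open_interior.
  apply: open_comp; last exact: interval_open.
  by move=> y _; exact: dot_continuous.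
- by exists x; split => //=; rewrite in_itv /= xt1.
- move=> y [iy /=]; rewrite in_itv /= => /andP[y1 y2]; split.
    by split; [exact: interior_sub|exact: ltW].
  by rewrite /halfplane /=; apply/negP; rewrite -ltNge.
Qed.

Lemma dot_uvec_lip D x (th th' : R) : `|x.1| <= D -> `|x.2| <= D ->
  `|dot x (uvec th) - dot x (uvec th')| <= 2 * D * `|th - th'|.
Proof.
move=> h1 h2; rewrite /dot /uvec /=.
have -> : x.1 * cos th + x.2 * sin th - (x.1 * cos th' + x.2 * sin th') =
  x.1 * (cos th - cos th') + x.2 * (sin th - sin th') by ring.
rewrite (le_trans (ler_normD _ _)) // !normrM.
rewrite (_ : 2 * D * _ = D * `|th - th'| + D * `|th - th'|); last by ring.
by apply: lerD; apply: ler_pM => //; [exact: cos_lip|exact: sin_lip].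
Qed.

(** Heights of points of [K] change by at most [2 * D * |th - th'|] when the direction turns, so the
    points of one cap missed by the other lie in a strip of controlled width. *)
Lemma cap_diff : exists2 C, 0 < C & forall th t th' t',
  ar (cap th' t' `\` halfplane th t) <= C * (`|th - th'| + `|t - t'|).
Proof.
have [D D0 hD] := body_bounded.
exists (4 * D * (2 * D + 1)); first by apply: mulr_gt0; lra.
move=> th t th' t'.
have bD : bmset (cap th' t' `\` halfplane th t).
  by apply: bmsetD; [exact: bmset_cap|exact: measurable_halfplane].
pose rho := 2 * D * `|th - th'| + `|t - t'|.
have rho0 : 0 <= rho by rewrite addr_ge0 // !mulr_ge0 // ltW.
have h1 : rho <= (2 * D + 1) * (`|th - th'| + `|t - t'|).
  rewrite /rho mulrDr; apply: lerD; first by apply: ler_wpM2r => //; lra.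
  by rewrite ler_peMl //; lra.
have D4 : 0 <= 4 * D by lra.
apply: (@le_trans _ _ (4 * D * (t + rho - t))); last first.
  have -> : t + rho - t = rho by ring.
  by rewrite -[leRHS]mulrA ler_wpM2l.
apply: (@ar_strip _ _ D th) => //; first exact: ltW.
- by move=> x [[/hD]].
- by rewrite lerDl.
- move=> x [[Kx h2]]; rewrite /halfplane /= => /negP; rewrite -ltNge => h3.
  rewrite /halfplane /= in h2; rewrite (ltW h3) /=.
  have [k1 k2] := hD _ Kx.
  have := dot_uvec_lip th th' k1 k2; rewrite ler_norml => /andP[_ h4].
  have := ler_norm (t' - t); rewrite distrC /rho => h5; lra.
Qed.

Lemma cap_lip : exists2 C, 0 < C & forall th t th' t',
  `|ar (cap th t) - ar (cap th' t')| <= C * (`|th - th'| + `|t - t'|).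
Proof.
have [C C0 hC] := cap_diff; exists C => //.
suff H th t th' t' : ar (cap th' t') - ar (cap th t) <=
    C * (`|th - th'| + `|t - t'|).
  move=> th t th' t'; rewrite ler_norml; apply/andP; split.
    by rewrite -[leRHS]opprK lerN2 opprB; exact: H.
  by have := H th' t' th t; rewrite [`|th' - _|]distrC [`|t' - _|]distrC.
rewrite (ar_split (bmset_cap th' t') (measurable_halfplane th t)) lerBlDl.
apply: lerD; last exact: hC.
apply: ar_le; [|exact: bmset_cap|by move=> x [[]]].
by apply: bmsetI; [exact: bmset_cap|exact: measurable_halfplane].
Qed.

Variable delta : R.
Hypothesis delta0 : 0 < delta.
Hypothesis delta_lt : delta < ar K.

Local Notation t_ := (flot K delta).

Lemma flot_area th : ar (cap th (t_ th)) = delta.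
Proof.
(* [flot] is an [xget]: one solution suffices for it to be a solution, and the default value 0 never
   intervenes. *)
suff [t ht] : exists t, ar (cap th t) = delta.
  rewrite /flot; case: xgetP => [s -> /= |/(_ t)]; last first.
    by rewrite /= /area -/(cap _ _) bmset_leb2 ?ht //; exact: bmset_cap.
  by rewrite /area -/(cap _ _) bmset_leb2 => [[]//|]; exact: bmset_cap.
have [D D0 hD] := body_bounded; have [C C0 hC] := cap_lip.
have dD x : K x -> `|dot x (uvec th)| <= 2 * D.
  move=> /hD [h1 h2]; rewrite (le_trans (ler_normD _ _)) // !normrM.
  have := sin_max th; have := cos_max th => c1 c2.
  rewrite (_ : 2 * D = D * 1 + D * 1); last by ring.
  by apply: lerD; apply: ler_pM.
have e0 : ar (cap th (- (2 * D + 1))) = 0.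
  suff -> : cap th (- (2 * D + 1)) = set0 by rewrite ar_set0.
  apply/seteqP; split => // x [/dD h]; rewrite /halfplane /= => h'; move: h; rewrite ler_norml => /andP[]; lra.
have e1 : ar (cap th (2 * D + 1)) = ar K.
  congr ar; apply/seteqP; split => [x []//|x Kx]; split => //; rewrite /halfplane /=.
  by have := dD _ Kx; rewrite ler_norml => /andP[]; lra.
have dK := delta_lt.
have [] := @IVT R (fun t => ar (cap th t)) (- (2 * D + 1)) (2 * D + 1) delta.
- lra.
- apply: continuous_subspaceT => t; apply/cvgrPdist_le => e e0'.
  near=> s; apply: le_trans (hC _ _ _ _) _; rewrite subrr normr0 add0r.
  rewrite mulrC -ler_pdivlMr //; near: s.
  by apply: cvgr_dist_le; [exact: cvg_id|exact: divr_gt0].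
- rewrite e0 e1 ge_min le_max (ltW delta0) /=; apply/orP; right; exact: ltW.
- by move=> c _ hc; exists c.
Unshelve. all: by end_near.
Qed.

Opaque flot.

Lemma flot_uniq th t : ar (cap th t) = delta -> t = t_ th.
Proof.
move=> h; have h' := flot_area th; have dK := delta_lt.
have [tt|tt|//] := ltgtP t (t_ th).
  by have := @cap_lt th t (t_ th); rewrite h h' => /(_ delta0 dK tt); rewrite ltxx.
by have := @cap_lt th (t_ th) t; rewrite h h' => /(_ delta0 dK tt); rewrite ltxx.
Qed.

Lemma flot_lt th t : delta < ar (cap th t) -> t_ th < t.
Proof.
move=> h; rewrite ltNge; apply/negP => /(cap_le th); rewrite flot_area; lra.
Qed.

Lemma flot_gt th t : ar (cap th t) < delta -> t < t_ th.
Proof.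
move=> h; rewrite ltNge; apply/negP => /(cap_le th); rewrite flot_area; lra.
Qed.

Lemma flot_inner th : exists2 x, interior K x & dot x (uvec th) = t_ th.
Proof. by apply: inner_on; rewrite flot_area //; exact: delta_lt. Qed.

(** The caps at levels [t_ th + e] and [t_ th - e] have areas strictly on either side of [delta]; by
    [cap_lip] this persists for nearby angles and traps [t_ th'] between the two levels. *)
Lemma flot_continuous : continuous t_.
Proof.
move=> th; apply/cvgrPdist_le => e e0.
have [C C0 hC] := cap_lip; have dK := delta_lt; have aE := flot_area th.
have h1 : delta < ar (cap th (t_ th + e)).
  apply: (@le_lt_trans _ _ (ar (cap th (t_ th)))); first by rewrite aE.
  by apply: cap_lt; rewrite ?aE // ltrDl.
have h2 : ar (cap th (t_ th - e)) < delta.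
  rewrite lt_neqAle; apply/andP; split.
    by apply/eqP => /flot_uniq; move: (t_ th) => s; lra.
  apply: (@le_trans _ _ (ar (cap th (t_ th)))); last by rewrite aE.
  by apply: cap_le; rewrite gerBl ltW.
near=> th'.
have d1 : `|ar (cap th (t_ th + e)) - ar (cap th' (t_ th + e))| < ar (cap th (t_ th + e)) - delta.
  apply: le_lt_trans (hC _ _ _ _) _; rewrite subrr normr0 addr0 mulrC -ltr_pdivlMr //.
  by near: th'; apply: cvgr_dist_lt; [exact: cvg_id|apply: divr_gt0; rewrite ?subr_gt0].
have d2 : `|ar (cap th (t_ th - e)) - ar (cap th' (t_ th - e))| < delta - ar (cap th (t_ th - e)).
  apply: le_lt_trans (hC _ _ _ _) _; rewrite subrr normr0 addr0 mulrC -ltr_pdivlMr //.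
  by near: th'; apply: cvgr_dist_lt; [exact: cvg_id|apply: divr_gt0; rewrite ?subr_gt0].
move: d1 d2; rewrite !ltr_norml => /andP[_ d1] /andP[d2 _].
have k1 : t_ th' < t_ th + e.
  by apply: flot_lt; move: d1; rewrite ltrD2l ltrN2.
have k2 : t_ th - e < t_ th'.
  by apply: flot_gt; move: d2; rewrite opprB ltrD2l ltrN2.
by rewrite distrC ler_distl (ltW k1) (ltW k2).
Unshelve. all: by end_near.
Qed.

End Body.

Global Opaque flot.

(** * Boundary points of a convex body on a line or a ray *)

Section Boundary.
Variables (R : realType) (K : set (R * R)).
Hypothesis cK : convex_body K.
Implicit Types (p q x y z : R * R).

(** Against [uvec th], this is the coordinate along the line orthogonal to [uvec th], while [dot] is
    the height of that line. *)
Definition det x y : R := x.1 * y.2 - x.2 * y.1.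

Lemma boundaryP x : boundary K x <-> K x /\ ~ interior K x.
Proof.
have e : closure K = K by apply/esym/closure_id; exact: body_closed.
by rewrite /boundary e.
Qed.

Lemma uvec_coords th x : x = (dot x (uvec th) * cos th - det x (uvec th) * - sin th,
  dot x (uvec th) * sin th - det x (uvec th) * cos th).
Proof.
case: x => x y; rewrite /dot /det /uvec /=; have := sin2Dcos2 th => e.
congr (_, _).
  transitivity ((sin th ^+ 2 + cos th ^+ 2) * x); first by rewrite e mul1r.
  by ring.
transitivity ((sin th ^+ 2 + cos th ^+ 2) * y); first by rewrite e mul1r.
by ring.
Qed.

Lemma uvec_inj th x y : dot x (uvec th) = dot y (uvec th) ->
  det x (uvec th) = det y (uvec th) -> x = y.
Proof. by move=> h1 h2; rewrite (uvec_coords th x) (uvec_coords th y) h1 h2. Qed.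

(** On a line through the interior point [z], the nearer of two boundary points on one side would be
    a proper mixture of [z] and the farther one, hence interior. *)
Lemma boundary_same_side th z p q : interior K z -> boundary K p -> boundary K q ->
  dot p (uvec th) = dot z (uvec th) -> dot q (uvec th) = dot z (uvec th) ->
  0 < (det p (uvec th) - det z (uvec th)) * (det q (uvec th) - det z (uvec th)) -> p = q.
Proof.
move=> iz /boundaryP [Kp nip] /boundaryP [Kq niq] dp dq.
set a := det p _; set b := det q _; set c := det z _ => h.
wlog le_ab : p q nip niq Kp Kq dp dq @a @b h / `|a - c| <= `|b - c| => [W|].
  have [le|/ltW le] := leP `|a - c| `|b - c|; first exact: W.
  by apply/esym; apply: W => //; rewrite mulrC.
have [ab|ab] := eqVneq a b; first by apply: (@uvec_inj th); [rewrite dp dq|].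
exfalso; apply: nip.
have bc : b - c != 0 by apply/eqP => e; move: h; rewrite e mulr0 ltxx.
pose s := (a - c) / (b - c).
have s0 : 0 <= s.
  have -> : s = ((a - c) * (b - c)) / (b - c) ^+ 2 by rewrite /s; field.
  by apply: divr_ge0; [exact: ltW|exact: sqr_ge0].
have s1 : s < 1.
  rewrite -(ger0_norm s0) /s normrM normfV ltr_pdivrMr ?normr_gt0 // mul1r.
  rewrite lt_neqAle le_ab andbT; apply/eqP => e.
  have : (a - c) ^+ 2 = (b - c) ^+ 2 by rewrite -[LHS]real_normK ?num_real // e real_normK ?num_real.
  move/eqP; rewrite eqf_sqr => /orP[/eqP|/eqP] e'.
    by move/eqP: ab; apply; lra.
  by move: h; rewrite e' mulNr oppr_gt0 ltNge -expr2 sqr_ge0.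
have -> : p = (s * q.1 + (1 - s) * z.1, s * q.2 + (1 - s) * z.2).
  apply: (@uvec_inj th); first by rewrite dot_seg dp dq; ring.
  have -> : det (s * q.1 + (1 - s) * z.1, s * q.2 + (1 - s) * z.2) (uvec th) =
     s * (b - c) + c by rewrite /b /c /det /=; ring.
  by rewrite /s divfK // -/a; ring.
by apply: interior_seg => //; rewrite s0.
Qed.

(** Of three points on the line, none of them equal to [z], two lie on the same side of [z]. *)
Lemma boundary_line3 th z p q r : interior K z ->
  boundary K p -> boundary K q -> boundary K r ->
  dot p (uvec th) = dot z (uvec th) -> dot q (uvec th) = dot z (uvec th) ->
  dot r (uvec th) = dot z (uvec th) -> p <> q -> r = p \/ r = q.
Proof.
move=> iz bp bq br dp dq dr npq.
have nz y : boundary K y -> dot y (uvec th) = dot z (uvec th) ->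
    det y (uvec th) - det z (uvec th) != 0.
  move=> /boundaryP [_ ni] dy; apply/eqP => e; apply: ni.
  suff -> : y = z by [].
  by apply: (@uvec_inj th) => //; lra.
have := nz _ bp dp; have := nz _ bq dq; have := nz _ br dr.
have S1 := boundary_same_side iz bp bq dp dq.
have S2 := boundary_same_side iz br bp dr dp.
have S3 := boundary_same_side iz br bq dr dq.
move: S1 S2 S3; move: (_ - _) (_ - _) (_ - _) => a b c S1 S2 S3.
rewrite !neq_lt => /orP[c0|c0] /orP[b0|b0] /orP[a0|a0].
- by case: npq; apply: S1; rewrite nmulr_lgt0.
- by right; apply: S3; rewrite nmulr_lgt0.
- by left; apply: S2; rewrite nmulr_lgt0.
- by case: npq; apply: S1; rewrite mulr_gt0.
- by case: npq; apply: S1; rewrite nmulr_lgt0.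
- by left; apply: S2; rewrite mulr_gt0.
- by right; apply: S3; rewrite mulr_gt0.
- by case: npq; apply: S1; rewrite mulr_gt0.
Qed.

(** The exit point belongs to the largest parameter that stays in [K]: closedness puts it into [K],
    and an interior point could be pushed further along [v]. *)
Lemma boundary_exit x (v : R * R) : K x -> v != 0 -> exists2 s, 0 <= s &
  boundary K (x.1 + s * v.1, x.2 + s * v.2).
Proof.
move=> Kx v0; have [D D0 hD] := body_bounded cK.
pose S := [set s : R | 0 <= s /\ K (x.1 + s * v.1, x.2 + s * v.2)].
pose m := Num.max `|v.1| `|v.2|.
have m0 : 0 < m.
  rewrite /m lt_max !normr_gt0; apply/orP.
  have [e1|] := eqVneq v.1 0; last by left.
  have [e2|] := eqVneq v.2 0; last by right.
  by move/eqP: v0; case; rewrite [v]surjective_pairing e1 e2.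
have S0 : S 0 by split => //; rewrite !mul0r !addr0 -surjective_pairing.
have hS : has_sup S.
  split; first by exists 0.
  exists (2 * D / m) => s [s0 /hD /= [h1 h2]]; have [k1 k2] := hD _ Kx.
  rewrite ler_pdivlMr // /m; case: (leP `|v.1| `|v.2|) => _.
    rewrite -(ger0_norm s0) -normrM.
    have -> : s * v.2 = (x.2 + s * v.2) - x.2 by ring.
    by apply: le_trans (ler_normB _ _) _; lra.
  rewrite -(ger0_norm s0) -normrM.
  have -> : s * v.1 = (x.1 + s * v.1) - x.1 by ring.
  by apply: le_trans (ler_normB _ _) _; lra.
pose s := sup S.
have s0 : 0 <= s by apply: (sup_upper_bound hS).
exists s => //; apply/boundaryP; split.
  apply: contrapT => nK.
  have oC : open (~` K) by apply: closed_openC; exact: body_closed cK.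
  have : interior (~` K) (x.1 + s * v.1, x.2 + s * v.2) by rewrite openE in oC; exact: oC.
  move=> /interiorP [e e0 h].
  have em : 0 < e / (m + 1) by apply: divr_gt0; lra.
  have [r [r0 Kr] rs] := sup_adherent em hS.
  rewrite -/s in rs; have rles : r <= s by apply: (sup_upper_bound hS).
  apply: (h _ _ _ Kr) => /=.
    have -> : x.1 + s * v.1 - (x.1 + r * v.1) = (s - r) * v.1 by ring.
    rewrite normrM ger0_norm; last by lra.
    apply: (@le_lt_trans _ _ ((s - r) * m)).
      by apply: ler_wpM2l; [lra|rewrite /m le_max lexx].
    apply: (@le_lt_trans _ _ ((s - r) * (m + 1))); first by apply: ler_wpM2l; lra.
    by rewrite -ltr_pdivlMr; lra.
  have -> : x.2 + s * v.2 - (x.2 + r * v.2) = (s - r) * v.2 by ring.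
  rewrite normrM ger0_norm; last by lra.
  apply: (@le_lt_trans _ _ ((s - r) * m)).
    by apply: ler_wpM2l; [lra|rewrite /m le_max lexx orbT].
  apply: (@le_lt_trans _ _ ((s - r) * (m + 1))); first by apply: ler_wpM2l; lra.
  by rewrite -ltr_pdivlMr; lra.
move=> /interiorP [e e0 h].
have em : 0 < e / (m + 1) by apply: divr_gt0; lra.
suff : S (s + e / (m + 1) / 2) by move/(sup_upper_bound hS); rewrite -/s; lra.
have e1 : e / (m + 1) / 2 * (m + 1) < e by rewrite mulrAC divfK; lra.
split; first by lra.
apply: h => /=.
  have -> : x.1 + s * v.1 - (x.1 + (s + e / (m + 1) / 2) * v.1) = - (e / (m + 1) / 2 * v.1) by ring.
  rewrite normrN normrM ger0_norm; last by lra.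
  apply: le_lt_trans e1; apply: ler_wpM2l; first by lra.
  by apply: (@le_trans _ _ m); [rewrite /m le_max lexx|lra].
have -> : x.2 + s * v.2 - (x.2 + (s + e / (m + 1) / 2) * v.2) = - (e / (m + 1) / 2 * v.2) by ring.
rewrite normrN normrM ger0_norm; last by lra.
apply: le_lt_trans e1; apply: ler_wpM2l; first by lra.
by apply: (@le_trans _ _ m); [rewrite /m le_max lexx orbT|lra].
Qed.

Lemma dot_uvec_uvec (th : R) : dot (uvec th) (uvec th) = 1.
Proof. by rewrite /dot /uvec /= -[RHS](sin2Dcos2 th); ring. Qed.

Lemma boundary_above th t : ar (cap K th t) < ar K ->
  exists2 x, boundary K x & t < dot x (uvec th).
Proof.
move=> /(inner_above cK) [x /interior_sub Kx xt].
have [|s s0 bs] := @boundary_exit x (uvec th) Kx.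
  by apply/eqP => e; have := dot_uvec_uvec th; rewrite e /dot /=; lra.
exists (x.1 + s * (uvec th).1, x.2 + s * (uvec th).2) => //.
have -> : dot (x.1 + s * (uvec th).1, x.2 + s * (uvec th).2) (uvec th) =
  dot x (uvec th) + s * dot (uvec th) (uvec th) by rewrite /dot /=; ring.
by rewrite dot_uvec_uvec mulr1; apply: lt_le_trans xt _; rewrite lerDl.
Qed.

Lemma boundary_below th t : 0 < ar (cap K th t) ->
  exists2 x, boundary K x & dot x (uvec th) < t.
Proof.
move=> /(inner_below cK) [x /interior_sub Kx xt].
have [|s s0 bs] := @boundary_exit x (- (uvec th).1, - (uvec th).2) Kx.
  apply/eqP => -[e1 e2]; have := dot_uvec_uvec th; rewrite /dot /uvec /= in e1 e2 *.
  by move: e1 e2 => /eqP; rewrite oppr_eq0 => /eqP -> /eqP; rewrite oppr_eq0 => /eqP ->; lra.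
exists (x.1 + s * - (uvec th).1, x.2 + s * - (uvec th).2) => //.
have -> : dot (x.1 + s * - (uvec th).1, x.2 + s * - (uvec th).2) (uvec th) =
  dot x (uvec th) - s * dot (uvec th) (uvec th) by rewrite /dot /=; ring.
by rewrite dot_uvec_uvec mulr1; apply: le_lt_trans xt; rewrite gerBl.
Qed.

End Boundary.

(** * The boundary arc cut off by a chord of flotation *)

Section Arcs.
Variables (R : realType) (K : set (R * R)) (delta : R).
Hypothesis cK : convex_body K.
Hypothesis delta0 : 0 < delta.
Hypothesis delta_lt : delta < ar K.
Local Notation t_ := (flot K delta).
Variables (g : R -> R * R) (L : R).
Hypothesis L0 : 0 < L.
Hypothesis gper : forall u, g (u + L) = g u.
Hypothesis ginj : forall u v, 0 <= u < L -> 0 <= v < L -> g u = g v -> u = v.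
Hypothesis gsurj : g @` setT = boundary K.
Hypothesis gcont : forall v : R * R, continuous (fun u => dot (g u) v).

Lemma gboundary u : boundary K (g u).
Proof. by rewrite -gsurj; exists u. Qed.

Lemma gperz (k : int) u : g (u + k%:~R * L) = g u.
Proof.
have H (n : nat) v : g (v + n%:R * L) = g v.
  elim: n v => [|n IH] v; first by rewrite mul0r addr0.
  by rewrite -natr1 mulrDl mul1r addrA gper.
case: k => n; first exact: H.
rewrite NegzE mulrNz mulNr -[in RHS](subrK (n.+1%:R * L) u) H.
by rewrite pmulrn.
Qed.

Lemma shift_window v : exists k : int, 0 <= v + k%:~R * L < L.
Proof.
exists (- Num.floor (v / L)); rewrite mulrNz mulNr.
have /andP[h1 h2] := floor_itv (v / L).
rewrite subr_ge0 -ler_pdivlMr // h1 /= ltrBlDr -[X in X + _]mul1r -mulrDl.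
by rewrite -ltr_pdivrMr // addrC; move: h2; rewrite intrD.
Qed.

Lemma ginjz u v : g u = g v -> exists k : int, v = u + k%:~R * L.
Proof.
move=> e; have [k hk] := shift_window u; have [l hl] := shift_window v.
have := ginj hk hl; rewrite !gperz => /(_ e) h.
by exists (k - l); rewrite intrD mulrDl mulrNz mulNr; lra.
Qed.

Variables (th a b : R).
Hypothesis ab : a <= b <= a + L.
Hypothesis arc : g @` `[a, b] = boundary K `&` halfplane th (t_ th).

Lemma arc_in u : a <= u <= b -> dot (g u) (uvec th) <= t_ th.
Proof.
move=> h; have : (g @` `[a, b]) (g u) by exists u => //=; rewrite in_itv.
by rewrite arc => -[].
Qed.

Lemma arc_out u : dot (g u) (uvec th) <= t_ th -> exists2 c, a <= c <= b & g c = g u.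
Proof.
move=> h; have : (g @` `[a, b]) (g u).
  by rewrite arc; split => //; exact: gboundary.
by move=> [c /=]; rewrite in_itv /= => hc e; exists c.
Qed.

Lemma int_small (k : int) : - L < k%:~R * L -> k%:~R * L < L -> k = 0.
Proof.
rewrite -mulN1r ltr_pM2r // => h1; rewrite -[X in _ < X]mul1r ltr_pM2r // => h2.
have {}h1 : (-1 < k)%R by rewrite -(ltr_int R) mulrNz.
have {}h2 : (k < 1)%R by rewrite -(ltr_int R).
by case: k h1 h2 => [[|n]|n].
Qed.

(** An arc of full period would be the whole boundary, but the cap does not exhaust [K], so some
    boundary point lies beyond the line. *)
Lemma arc_lt_period : b < a + L.
Proof.
case/andP: ab => ab1; rewrite le_eqVlt => /orP[/eqP e|//].
have [|x bx hx] := @boundary_above _ _ cK th (t_ th); first by rewrite flot_area.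
move: bx; rewrite -gsurj => -[u _ ux].
have [k hk] := shift_window (u - a).
have : dot (g (u + k%:~R * L)) (uvec th) <= t_ th.
  by apply: arc_in; rewrite e; case/andP: hk => h1 h2; apply/andP; split; lra.
by rewrite gperz ux leNgt hx.
Qed.

Lemma arc_nontrivial : a < b.
Proof.
case/andP: ab => + _; rewrite le_eqVlt => /orP[/eqP e|//].
have [|x bx hx] := @boundary_below _ _ cK th (t_ th); first by rewrite flot_area.
have [|y by_ hy] := @boundary_above _ _ cK th (t_ th); first by rewrite flot_area.
exfalso.
have one w : dot (g w) (uvec th) <= t_ th -> g w = g a.
  move=> /arc_out [c]; rewrite e => /andP[c1 c2] <-.
  by congr g; apply/eqP; rewrite eq_le; apply/andP; split; lra.
move: bx by_; rewrite -gsurj => -[u _ ux] [v _ vy].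
(* the boundary is connected, so it meets the line in a point other than [x] *)
have [w hw] : exists w, dot (g w) (uvec th) = t_ th.
  pose f w := dot (g w) (uvec th).
  have fc : continuous f by exact: gcont.
  have fu : f u < t_ th by rewrite /f ux.
  have fv : t_ th < f v by rewrite /f vy.
  have [uv|vu] := leP u v.
    have [|c _ fc'] := @IVT R f u v (t_ th) uv (continuous_subspaceT fc).
      by rewrite ge_min le_max (ltW fu) (ltW fv) orbT.
    by exists c.
  have [|c _ fc'] := @IVT R f v u (t_ th) (ltW vu) (continuous_subspaceT fc).
    by rewrite ge_min le_max (ltW fu) (ltW fv) orbT.
  by exists c.
have := one w; rewrite hw => /(_ (lexx _)) e1.
have := one u; rewrite ux => /(_ (ltW hx)) e2.
by move: hw hx; rewrite e1 -e2 => ->; rewrite ltxx.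
Qed.

Let near_lt u e : dot (g u) (uvec th) < t_ th -> 0 < e ->
  exists2 h, 0 < h < e & dot (g (u - h)) (uvec th) < t_ th /\ dot (g (u + h)) (uvec th) < t_ th.
Proof.
move=> hu e0; have c1 := @gcont (uvec th) u.
have /nbhs_ballP [r /= r0 hr] : nbhs u [set w | dot (g w) (uvec th) < t_ th].
  exact: (cvgr_lt _ c1).
have m0 : 0 < Num.min r e / 2 by rewrite divr_gt0 // lt_min r0 e0.
have mr : Num.min r e / 2 < r.
  by rewrite ltr_pdivrMr //; apply: (@le_lt_trans _ _ r); [rewrite ge_min lexx|lra].
have me : Num.min r e / 2 < e.
  by rewrite ltr_pdivrMr //; apply: (@le_lt_trans _ _ e); [rewrite ge_min lexx orbT|lra].
exists (Num.min r e / 2); first by rewrite m0 me.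
split; apply: hr; rewrite /ball /=.
  by rewrite opprB addrC subrK gtr0_norm.
by rewrite opprD addNKr normrN gtr0_norm.
Qed.

(** Were [g a] strictly below the line, so would be some [g (a - h)]; it would then be a point of
    the arc as well, against injectivity modulo [L], since [h] is less than the gap [a + L - b]. *)
Lemma arc_left : dot (g a) (uvec th) = t_ th.
Proof.
have bL := arc_lt_period; have ab' := arc_nontrivial.
have := @arc_in a; rewrite lexx (ltW ab') => /(_ isT).
rewrite le_eqVlt => /orP[/eqP //|lt].
have d0 : 0 < a + L - b by rewrite subr_gt0.
have [h /andP[h0 h1] [/ltW/arc_out [c /andP[c1 c2] e] _]] := near_lt lt d0.
have [k ek] := ginjz e.
suff k0 : k = 0 by move: ek; rewrite k0 mul0r; lra.
by apply: int_small => //; lra.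
Qed.

Lemma arc_right : dot (g b) (uvec th) = t_ th.
Proof.
have bL := arc_lt_period; have ab' := arc_nontrivial.
have := @arc_in b; rewrite lexx (ltW ab') => /(_ isT).
rewrite le_eqVlt => /orP[/eqP //|lt].
have d0 : 0 < a + L - b by rewrite subr_gt0.
have [h /andP[h0 h1] [_ /ltW/arc_out [c /andP[c1 c2] e]]] := near_lt lt d0.
have [k ek] := ginjz e.
suff k0 : k = 0 by move: ek; rewrite k0 mul0r; lra.
by apply: int_small => //; lra.
Qed.

Lemma arc_endpoints_neq : g a <> g b.
Proof.
move=> /ginjz [k ek]; have bL := arc_lt_period; have ab' := arc_nontrivial.
suff k0 : k = 0 by move: ek; rewrite k0 mul0r; lra.
by apply: int_small => //; lra.
Qed.

Lemma arc_line p : boundary K p -> dot p (uvec th) = t_ th -> p = g a \/ p = g b.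
Proof.
move=> bp dp; have [z iz dz] := flot_inner cK delta0 delta_lt th.
apply: (@boundary_line3 _ _ cK th z (g a) (g b) p iz) => //.
- exact: gboundary.
- exact: gboundary.
- by rewrite arc_left.
- by rewrite arc_right.
- by rewrite dp.
- exact: arc_endpoints_neq.
Qed.

Lemma arc_outside u : b < u < a + L -> t_ th < dot (g u) (uvec th).
Proof.
move=> /andP[u1 u2]; rewrite ltNge; apply/negP => /arc_out [c /andP[c1 c2] /ginjz [k ek]].
suff k0 : k = 0 by move: ek; rewrite k0 mul0r; lra.
by apply: int_small => //; lra.
Qed.

End Arcs.

(** * One-variable calculus *)

Section Calculus.
Variable R : realType.
Implicit Types f : R -> R.

(** The first-order estimate with a non-strict inequality includes [h = 0], which spares the
    punctured neighbourhood in all later uses. *)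
Lemma is_deriveP f (u l : R) : is_derive u 1 f l <->
  (forall e, 0 < e -> exists2 r, 0 < r & forall h, `|h| < r ->
     `|f (u + h) - f u - h * l| <= e * `|h|).
Proof.
split.
  move=> [df <-] e e0; move: df => /cvg_ex [l' hl].
  have el : 'D_1 f u = l' by apply: cvg_lim hl => //; exact: norm_hausdorff.
  rewrite el; move: hl => /cvgrPdist_le /(_ e e0); rewrite near_withinE.
  move=> /nbhs_ballP [r /= r0 hr]; exists r => // h hh.
  have [->|h0] := eqVneq h 0; first by rewrite addr0 subrr mul0r subrr !normr0 mulr0.
  have := hr h; rewrite /ball /= sub0r normrN => /(_ hh h0).
  rewrite /shift /= /GRing.scale /= mulr1 [h + u]addrC => H.
  have -> : f (u + h) - f u - h * l' = - (l' - h^-1 * (f (u + h) - f u)) * h by field.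
  by rewrite normrM normrN; apply: ler_wpM2r.
move=> H; suff hl : (fun h => h^-1 *: ((f \o shift u) (h *: (1 : R)) - f u)) @ 0^' --> l.
  split; first by apply/cvg_ex; exists l.
  by apply: cvg_lim hl => //; exact: norm_hausdorff.
apply/cvgrPdist_le => e e0; have [r r0 hr] := H e e0.
rewrite near_withinE; apply/nbhs_ballP; exists r => //= h; rewrite /ball /= sub0r normrN => hh h0.
have := hr h hh; rewrite /shift /= /GRing.scale /= mulr1 [h + u]addrC => {}H.
have hp : 0 < `|h| by rewrite normr_gt0.
rewrite -(ler_pM2r hp) -normrM.
have -> : (l - h^-1 * (f (u + h) - f u)) * h = - (f (u + h) - f u - h * l) by field.
by rewrite normrN.
Qed.

Lemma is_derive_continuous f (u l : R) : is_derive u 1 f l -> {for u, continuous f}.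
Proof.
by move=> [df _]; apply: differentiable_continuous; apply/derivable1_diffP.
Qed.

Lemma is_derive_lin f g (u l m a b c : R) : is_derive u 1 f l -> is_derive u 1 g m ->
  is_derive u 1 (fun w => a * f w + b * g w + c) (a * l + b * m).
Proof.
move=> /is_deriveP hf /is_deriveP hg; apply/is_deriveP => e e0.
have M0 : 0 < `|a| + `|b| + 1 by rewrite ltr_wpDl // addr_ge0.
have e1 : 0 < e / (`|a| + `|b| + 1) by exact: divr_gt0.
have [r r0 hr] := hf _ e1; have [s s0 hs] := hg _ e1.
exists (Num.min r s); first by rewrite lt_min r0.
move=> h; rewrite lt_min => /andP[/hr h1 /hs h2].
have -> : a * f (u + h) + b * g (u + h) + c - (a * f u + b * g u + c) - h * (a * l + b * m) =
  a * (f (u + h) - f u - h * l) + b * (g (u + h) - g u - h * m) by ring.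
rewrite (le_trans (ler_normD _ _)) // !normrM.
apply: (@le_trans _ _ ((`|a| + `|b|) * (e / (`|a| + `|b| + 1) * `|h|))).
  by rewrite mulrDl; apply: lerD; apply: ler_wpM2l.
rewrite mulrA; apply: ler_wpM2r => //.
rewrite mulrA ler_pdivrMr // mulrC; apply: ler_wpM2l; first exact: ltW.
by rewrite lerDl.
Qed.

Lemma mvt f (df : R -> R) (a b : R) : (forall x : R, is_derive x 1 f (df x)) -> a < b ->
  exists2 c, a < c < b & f b - f a = df c * (b - a).
Proof.
move=> h ab; have [c] := @MVT R f df a b ab (fun x _ => h x)
  (continuous_subspaceT (fun x => is_derive_continuous (h x))).
by rewrite in_itv /= => hc e; exists c.
Qed.

Lemma ndecr_of_derive f (df : R -> R) : (forall x : R, is_derive x 1 f (df x)) ->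
  (forall x, 0 <= df x) -> forall a b, a <= b -> f a <= f b.
Proof.
move=> h h0 a b; rewrite le_eqVlt => /orP[/eqP ->//|ab].
have [c _ e] := mvt h ab; rewrite -subr_ge0 e mulr_ge0 // subr_ge0 ltW //.
Qed.

Lemma antiderivative f : continuous f -> exists S : R -> R,
  (forall x : R, is_derive x 1 S (f x)) /\
  forall a b, a <= b -> \int[@lebesgue_measure R]_(u in `[a, b]) f u = S b - S a.
Proof.
move=> cf.
have fint a b : (@lebesgue_measure R).-integrable `[a, b] (EFin \o f).
  apply: continuous_compact_integrable; first exact: segment_compact.
  exact: continuous_subspaceT.
pose I a b := \int[@lebesgue_measure R]_(u in `[a, b]) f u.
have chas a b c : a <= b -> b <= c -> I a c - I a b = I b c.
  move=> ab bc; rewrite /I Rintegral_itvB // Rintegral_itv_obnd_cbnd //.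
  by apply: integrableS (fint b c) => //; apply: subset_itvr; rewrite bnd_simp.
pose S x := if 0 <= x then I 0 x else - I x 0.
(* Up to a constant, [S] is the integral from any base point [c] left of 0 and of [x], so the
   fundamental theorem is only applied at interior points of an interval. *)
have SE c x : c < 0 -> c <= x -> S x = I c x - I c 0.
  move=> c0 cx; rewrite /S; case: ifPn => [x0|].
    by rewrite chas // ltW.
  rewrite -ltNge => x0; rewrite -(@chas c x 0) //; last exact: ltW.
  by rewrite opprB.
exists S; split; last first.
  move=> a b ab; pose c := Num.min a 0 - 1.
  have c0 : c < 0 by rewrite /c ltrBlDr add0r gt_min ltr01 orbT.
  have ca : c <= a by rewrite /c lerBlDr ge_min lerDl ler01.
  rewrite (@SE c b) //; last exact: le_trans ab.
  by rewrite (@SE c a) // -[LHS](@chas c a b) //; ring.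
move=> x; pose c := Num.min x 0 - 1.
have c0 : c < 0 by rewrite /c ltrBlDr add0r gt_min ltr01 orbT.
have cx : c < x by rewrite /c ltrBlDr gt_min ltrDl ltr01.
have x1 : x < x + 1 by rewrite ltrDl.
have [d1 d2] := continuous_FTC1_closed x1 (fint c (x + 1)) cx (cf x).
have H : is_derive x 1 (fun y => 1 * I c y + 0 * I c y + - I c 0) (1 * f x + 0 * f x).
  by apply: is_derive_lin; first [split; [exact: d1|rewrite -derive1E; exact: d2]|split => //; rewrite -derive1E].
rewrite mul1r mul0r addr0 in H.
move/is_deriveP: H => H; apply/is_deriveP => e e0; have [r r0 hr] := H e e0.
exists (Num.min r (x - c)); first by rewrite lt_min r0 subr_gt0.
move=> h; rewrite lt_min => /andP[/hr hh hc].
rewrite (SE c x) //; last exact: ltW.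
rewrite (SE c (x + h)) //; last first.
  by move: hc; rewrite ltr_norml => /andP[]; lra.
by apply: le_trans hh; rewrite le_eqVlt; apply/orP; left; apply/eqP; congr `| _ |; ring.
Qed.

Lemma continuous_cuberoot : continuous (fun x : R => `|x| `^ 3^-1).
Proof.
have t0 : (0 : R) < 3^-1 by rewrite invr_gt0.
move=> x; have [->|x0] := eqVneq x 0; last first.
  have -> : (fun x : R => `|x| `^ 3^-1) = (fun y => powR y 3^-1) \o (fun x => `|x|) by [].
  apply: continuous_comp; first exact: norm_continuous.
  have xp : 0 < `|x| by rewrite normr_gt0.
  exact: (is_derive_continuous (@is_derive1_powR R 3^-1 _ xp)).
rewrite /continuous_at normr0 powR0; last by rewrite gt_eqF.
apply/cvgrPdist_le => e e0.
have e3 : 0 < e ^+ 3 by rewrite exprn_gt0.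
near=> y.
rewrite sub0r normrN norm_powR // normr_id.
have ye : `|y| <= e ^+ 3.
  by near: y; apply/nbhs_ballP; exists (e ^+ 3) => //= y; rewrite /ball /= sub0r normrN => /ltW.
have -> : e = (e ^+ 3) `^ 3^-1.
  by rewrite -powR_mulrn ?(ltW e0) // -powRrM divff ?powRr1 // ltW.
by apply: ge0_ler_powR => //; rewrite ?nnegrE ltW.
Unshelve. all: by end_near.
Qed.

End Calculus.

(** * Tangent lines, orientation and curvature of the boundary curve *)

Section Tangent.
Variables (R : realType) (K : set (R * R)).
Hypothesis cK : convex_body K.
Variables (g dg ddg : R -> R * R).
Hypothesis g1D : forall u : R, is_derive u 1 (fun w => (g w).1) (dg u).1.
Hypothesis g2D : forall u : R, is_derive u 1 (fun w => (g w).2) (dg u).2.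
Hypothesis dg1D : forall u : R, is_derive u 1 (fun w => (dg w).1) (ddg u).1.
Hypothesis dg2D : forall u : R, is_derive u 1 (fun w => (dg w).2) (ddg u).2.
Hypothesis dg0 : forall u, dg u != 0.
Hypothesis gbd : forall u, boundary K (g u).
Implicit Types (x y z p : R * R).

(** The determinant of [dg u] and [x - g u]: its sign tells on which side of the tangent at [g u]
    the point lies. *)
Definition tg u x := (dg u).1 * (x.2 - (g u).2) - (dg u).2 * (x.1 - (g u).1).

Lemma dg_norm u : 0 < (dg u).1 ^+ 2 + (dg u).2 ^+ 2.
Proof.
rewrite lt_neqAle addr_ge0 ?sqr_ge0 // andbT eq_sym paddr_eq0 ?sqr_ge0 // !sqrf_eq0.
apply/negP => /andP[/eqP e1 /eqP e2]; move/eqP: (dg0 u); apply.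
by rewrite [dg u]surjective_pairing e1 e2.
Qed.

(* An inner point [p + s * tau] on the tangent line would make the curve enter
   the interior, because [g (u + h)] is a proper mixture of [p] and a point
   close to [p + s * tau]. *)
Lemma tangent_avoids_inner u s :
  ~ interior K ((g u).1 + s * (dg u).1, (g u).2 + s * (dg u).2).
Proof.
move=> i0; have s0 : s != 0.
  apply/eqP => e; move: i0; rewrite e !mul0r !addr0 -surjective_pairing.
  by move: (gbd u) => /(boundaryP cK) [].
move/interiorP: (i0) => [e e0 he].
have sp : 0 < `|s| by rewrite normr_gt0.
have e1 : 0 < e / (2 * `|s|) by apply: divr_gt0 => //; lra.
have [r1 r10 h1] := (is_deriveP _ _ _).1 (g1D u) _ e1.
have [r2 r20 h2] := (is_deriveP _ _ _).1 (g2D u) _ e1.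
pose m := Num.min (Num.min r1 r2) `|s| / 2.
have m0 : 0 < m by rewrite divr_gt0 // !lt_min r10 r20.
have mr1 : m < r1.
  rewrite /m ltr_pdivrMr //; apply: (@le_lt_trans _ _ r1); last by lra.
  by rewrite !ge_min lexx.
have mr2 : m < r2.
  rewrite /m ltr_pdivrMr //; apply: (@le_lt_trans _ _ r2); last by lra.
  by rewrite !ge_min lexx orbT.
have ms : m < `|s|.
  rewrite /m ltr_pdivrMr //; apply: (@le_lt_trans _ _ `|s|); last by lra.
  by rewrite !ge_min lexx !orbT.
pose h := m * Num.sg s.
have hn : `|h| = m by rewrite /h normrM normr_sg s0 mulr1 gtr0_norm.
have hs : h / s = m / `|s|.
  apply: (mulIf s0); rewrite divfK // [X in _ = _ * X]numEsg /h.
  by field; rewrite gt_eqF.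
have q0 : 0 < h / s by rewrite hs divr_gt0.
have q1 : h / s < 1 by rewrite hs ltr_pdivrMr // mul1r.
have hh0 : h != 0 by rewrite -normr_eq0 hn gt_eqF.
have := h1 h; have := h2 h; rewrite hn => /(_ mr2) k2 /(_ mr1) k1.
pose y := ((g u).1 + s / h * ((g (u + h)).1 - (g u).1),
           (g u).2 + s / h * ((g (u + h)).2 - (g u).2)).
have sm : `|s / h| * (e / (2 * `|s|) * m) = e / 2.
  rewrite normrM normfV hn; field; rewrite ?gt_eqF //.
have iy : interior K y.
  apply/interiorP; exists (e / 2); first by lra.
  move=> w w1 w2; apply: he => /=.
    have d1 : `|(g u).1 + s * (dg u).1 - y.1| <= e / 2.
      rewrite -sm /y /=.
      have -> : (g u).1 + s * (dg u).1 - ((g u).1 + s / h * ((g (u + h)).1 - (g u).1)) =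
        - (s / h) * ((g (u + h)).1 - (g u).1 - h * (dg u).1) by field.
      by rewrite normrM normrN; apply: ler_wpM2l.
    have -> : (g u).1 + s * (dg u).1 - w.1 = ((g u).1 + s * (dg u).1 - y.1) + (y.1 - w.1) by ring.
    by apply: le_lt_trans (ler_normD _ _) _; lra.
  have d2 : `|(g u).2 + s * (dg u).2 - y.2| <= e / 2.
    rewrite -sm /y /=.
    have -> : (g u).2 + s * (dg u).2 - ((g u).2 + s / h * ((g (u + h)).2 - (g u).2)) =
      - (s / h) * ((g (u + h)).2 - (g u).2 - h * (dg u).2) by field.
    by rewrite normrM normrN; apply: ler_wpM2l.
  have -> : (g u).2 + s * (dg u).2 - w.2 = ((g u).2 + s * (dg u).2 - y.2) + (y.2 - w.2) by ring.
  by apply: le_lt_trans (ler_normD _ _) _; lra.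
have [Kp _] := (boundaryP cK _).1 (gbd u).
have [_] := (boundaryP cK _).1 (gbd (u + h)); apply.
have -> : g (u + h) = ((1 - h / s) * (g u).1 + (1 - (1 - h / s)) * y.1,
                       (1 - h / s) * (g u).2 + (1 - (1 - h / s)) * y.2).
  by rewrite [LHS]surjective_pairing /y /=; congr (_, _); field; rewrite hh0 s0.
by apply: (interior_seg cK) => //; apply/andP; split; lra.
Qed.

Lemma tg_inner_neq0 u x : interior K x -> tg u x != 0.
Proof.
move=> ix; apply/eqP => e; have n0 := dg_norm u.
pose n := (dg u).1 ^+ 2 + (dg u).2 ^+ 2.
(* Coefficient of the orthogonal projection of [x - g u] to the tangent direction; when [tg u x]
   vanishes, the projection is [x - g u] itself. *)
pose s := ((x.1 - (g u).1) * (dg u).1 + (x.2 - (g u).2) * (dg u).2) / n.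
apply: (@tangent_avoids_inner u s); move: ix; congr (interior K _).
rewrite [LHS]surjective_pairing /s; move: e n0; rewrite /tg -/n => e n0.
have nn : n != 0 by rewrite gt_eqF.
congr (_, _); apply: (mulfI nn); rewrite mulrDr.
  have -> : n * (((x.1 - (g u).1) * (dg u).1 + (x.2 - (g u).2) * (dg u).2) / n * (dg u).1) =
     ((x.1 - (g u).1) * (dg u).1 + (x.2 - (g u).2) * (dg u).2) * (dg u).1 by field.
  have -> : ((x.1 - (g u).1) * (dg u).1 + (x.2 - (g u).2) * (dg u).2) * (dg u).1 =
     n * (x.1 - (g u).1) + (dg u).2 * ((dg u).1 * (x.2 - (g u).2) - (dg u).2 * (x.1 - (g u).1))
     by rewrite /n; ring.
  by rewrite e; ring.
have -> : n * (((x.1 - (g u).1) * (dg u).1 + (x.2 - (g u).2) * (dg u).2) / n * (dg u).2) =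
     ((x.1 - (g u).1) * (dg u).1 + (x.2 - (g u).2) * (dg u).2) * (dg u).2 by field.
have -> : ((x.1 - (g u).1) * (dg u).1 + (x.2 - (g u).2) * (dg u).2) * (dg u).2 =
     n * (x.2 - (g u).2) - (dg u).1 * ((dg u).1 * (x.2 - (g u).2) - (dg u).2 * (x.1 - (g u).1))
     by rewrite /n; ring.
by rewrite e; ring.
Qed.

Lemma g1c : continuous (fun w => (g w).1).
Proof. by move=> u; exact: is_derive_continuous (g1D u). Qed.
Lemma g2c : continuous (fun w => (g w).2).
Proof. by move=> u; exact: is_derive_continuous (g2D u). Qed.
Lemma dg1c : continuous (fun w => (dg w).1).
Proof. by move=> u; exact: is_derive_continuous (dg1D u). Qed.
Lemma dg2c : continuous (fun w => (dg w).2).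
Proof. by move=> u; exact: is_derive_continuous (dg2D u). Qed.

Lemma gdot_continuous (v : R * R) : continuous (fun u => dot (g u) v).
Proof.
move=> u; rewrite /dot; apply: cvgD; apply: cvgM; try exact: cvg_cst.
  exact: g1c.
exact: g2c.
Qed.

(* The sign cannot change along the curve, by the intermediate value theorem. *)
Lemma orientation : exists2 sigma, sigma ^+ 2 = 1 &
  (forall u x, interior K x -> 0 < sigma * tg u x) /\
  (forall u x, K x -> 0 <= sigma * tg u x).
Proof.
have [z iz] := body_inner cK.
have tc x : continuous (tg ^~ x).
  move=> u; rewrite /tg; apply: cvgB; apply: cvgM.
  - exact: dg1c. - apply: cvgB; [exact: cvg_cst|exact: g2c].
  - exact: dg2c. - apply: cvgB; [exact: cvg_cst|exact: g1c].
have same u v : 0 < tg u z * tg v z.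
  wlog uv : u v / u <= v => [W|].
    by have [/W//|/ltW/W] := leP u v; rewrite mulrC.
  rewrite lt_neqAle eq_sym mulf_neq0 ?tg_inner_neq0 //= leNgt; apply/negP => neg.
  have [|c _] := @IVT R (tg ^~ z) u v 0 uv (continuous_subspaceT (tc z)).
    rewrite ge_min le_max; have [p|p] := leP (tg u z) 0.
      rewrite /=; apply/orP; right; rewrite leNgt; apply/negP => q.
      by move: neg; rewrite ltNge mulr_le0 // ltW.
    rewrite (ltW p) andbT /=; rewrite leNgt; apply/negP => q.
    by move: neg; rewrite ltNge mulr_ge0 // ltW.
  by move/eqP; rewrite (negPf (tg_inner_neq0 c iz)).
pose sigma := Num.sg (tg 0 z).
have s2 : sigma ^+ 2 = 1 by rewrite sqr_sg tg_inner_neq0.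
have sz u : 0 < sigma * tg u z.
  have p : 0 < `|tg 0 z| by rewrite normr_gt0 tg_inner_neq0.
  have := same 0 u; rewrite {1}[tg 0 z]numEsg -/sigma -mulrA mulrCA.
  by rewrite (pmulr_rgt0 _ p).
have si u x : interior K x -> 0 < sigma * tg u x.
  move=> ix; rewrite ltNge; apply/negP => neg.
  have n0 : sigma * tg u x != 0.
    by rewrite mulf_neq0 ?tg_inner_neq0 // -sqrf_eq0 s2 oner_eq0.
  have {}neg : sigma * tg u x < 0 by rewrite lt_neqAle n0.
  pose a := sigma * tg u z; pose b := sigma * tg u x.
  have a0 : 0 < a by exact: sz.
  pose s := a / (a - b).
  have ab : 0 < a - b by rewrite /b; lra.
  have s01 : 0 <= s < 1.
    by rewrite /s divr_ge0 ?(ltW a0) ?(ltW ab) //= ltr_pdivrMr // mul1r /b; lra.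
  have := interior_seg cK iz (interior_sub ix) s01 => iy.
  have := tg_inner_neq0 u iy; rewrite (_ : tg u _ = s * tg u x + (1 - s) * tg u z); last first.
    by rewrite /tg /=; ring.
  move/eqP; apply; apply: (@mulfI _ sigma); first by rewrite -sqrf_eq0 s2 oner_eq0.
  rewrite mulr0 mulrDr mulrCA -/b [sigma * (_ * _)]mulrCA -/a /s; field; rewrite gt_eqF //.
exists sigma => //; split => // u x Kx.
rewrite leNgt; apply/negP => neg.
pose a := sigma * tg u z; pose b := sigma * tg u x.
have a0 : 0 < a by exact: sz.
pose s := (a - b / 2) / (a - b).
have ab : 0 < a - b by rewrite /b; lra.
have s01 : 0 <= s < 1.
  apply/andP; split; first by apply: divr_ge0; rewrite /b; lra.
  by rewrite /s ltr_pdivrMr // mul1r /b; lra.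
have := si u _ (interior_seg cK iz Kx s01).
rewrite (_ : tg u _ = s * tg u x + (1 - s) * tg u z); last by rewrite /tg /=; ring.
rewrite mulrDr mulrCA -/b [sigma * (_ * _)]mulrCA -/a.
have -> : s * b + (1 - s) * a = b / 2 by rewrite /s; field; rewrite gt_eqF.
by rewrite /b; lra.
Qed.

Variable sigma : R.
Hypothesis s2 : sigma ^+ 2 = 1.
Hypothesis tgi : forall u x, interior K x -> 0 < sigma * tg u x.
Hypothesis tgK : forall u x, K x -> 0 <= sigma * tg u x.

(** The height [tg u (g w)] over the tangent has value and slope zero at [w = u]. A second
    derivative of the wrong sign would carry the curve, just after [u], to the side of the tangent
    that [K] avoids. *)
Lemma curvature_ge0 u : 0 <= sigma * det (dg u) (ddg u).
Proof.
rewrite leNgt; apply/negP => neg.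
have ph (w : R) : is_derive w 1 (fun w => tg u (g w)) ((dg u).1 * (dg w).2 + (- (dg u).2) * (dg w).1).
  have := is_derive_lin (dg u).1 (- (dg u).2)
     (- (dg u).1 * (g u).2 + (dg u).2 * (g u).1) (g2D w) (g1D w).
  by congr (is_derive _ _ _ _); apply/funext => x; rewrite /tg; ring.
have pd : is_derive u 1 (fun w => (sigma * (dg u).1) * (dg w).2 + (- (sigma * (dg u).2)) * (dg w).1 + 0)
    (sigma * (dg u).1 * (ddg u).2 + (- (sigma * (dg u).2)) * (ddg u).1).
  by apply: is_derive_lin.
pose k := sigma * det (dg u) (ddg u).
have kE : sigma * (dg u).1 * (ddg u).2 + (- (sigma * (dg u).2)) * (ddg u).1 = k.
  by rewrite /k /det; ring.
have e0 : 0 < - k / 2 by rewrite /k; lra.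
have [r r0 hr] := (is_deriveP _ _ _).1 pd _ e0.
have [|c /andP[c1 c2] ec] := mvt ph (a := u) (b := u + r / 2); first by lra.
have := hr (c - u); rewrite gtr0_norm; last by lra.
have -> : u + (c - u) = c by ring.
rewrite kE => /(_ ltac:(lra)) hc.
have Kg : K (g (u + r / 2)) by have [] := (boundaryP cK _).1 (gbd (u + r / 2)).
have := tgK u Kg; have : tg u (g u) = 0 by rewrite /tg !subrr; ring.
move=> e; move: ec; rewrite e subr0 => ->.
have r2 : u + r / 2 - u = r / 2 by ring.
rewrite r2 mulrA pmulr_lge0; last by lra.
move: hc; rewrite ler_norml => /andP[_].
set A := _ - _ - _; have -> : A = sigma * ((dg u).1 * (dg c).2 + - (dg u).2 * (dg c).1) - (c - u) * k.
  by rewrite /A; ring.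
move=> h1 h2.
have : (c - u) * k < (c - u) * (k / 2) by rewrite ltr_pM2l; [rewrite /k; lra|lra].
by move: h1; rewrite -[- k / 2 * _]mulrC; lra.
Qed.

(* Vanishing curvature on [al, be] makes [det (dg al) (dg w)^2 / |dg w|^2] constant. *)
Lemma flat_straight al be : al < be ->
  (forall w, al <= w <= be -> det (dg w) (ddg w) = 0) ->
  exists2 c, 0 < c & [/\ (g be).1 - (g al).1 = c * (dg al).1,
    (g be).2 - (g al).2 = c * (dg al).2 &
    exists2 d, 0 < d & (dg be).1 = d * (dg al).1 /\ (dg be).2 = d * (dg al).2].
Proof.
move=> ab flat.
pose n w := (dg w).1 ^+ 2 + (dg w).2 ^+ 2.
pose z w := (dg al).1 * (dg w).2 - (dg al).2 * (dg w).1.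
pose y w := (dg al).1 * (dg w).1 + (dg al).2 * (dg w).2.
have n0 w : 0 < n w by exact: dg_norm.
have z0 w : al <= w <= be -> z w = 0.
  move=> /andP[]; rewrite le_eqVlt => /orP[/eqP <- _|aw wb]; first by rewrite /z; ring.
  have zD (x : R) : is_derive x 1 z ((dg al).1 * (ddg x).2 - (dg al).2 * (ddg x).1).
    have := is_derive_lin (dg al).1 (- (dg al).2) 0 (dg2D x) (dg1D x).
    have -> : (fun w => (dg al).1 * (dg w).2 + - (dg al).2 * (dg w).1 + 0) = z.
      by apply/funext => v; rewrite /z; ring.
    by rewrite mulNr.
  have nD (x : R) : is_derive x 1 n (2 * ((dg x).1 * (ddg x).1 + (dg x).2 * (ddg x).2)).
    have d1 := dg1D x; have d2 := dg2D x.
    apply: is_derive_eq; rewrite /GRing.scale /= ?expr1 ?mulr_natl; ring.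
  pose q w := (z w * z w) * (n w)^-1.
  have qD (x : R) : is_derive x 1 q
      (2 * z x * (z x * 0 + ((dg al).1 * (ddg x).2 - (dg al).2 * (ddg x).1) * n x
         - z x * ((dg x).1 * (ddg x).1 + (dg x).2 * (ddg x).2)) / (n x) ^+ 2).
    have d1 := zD x; have d2 := nD x.
    have nn : n x != 0 by rewrite gt_eqF.
    have iD : is_derive x 1 (fun w => (n w)^-1) (- (n x) ^- 2 *: (2 * ((dg x).1 * (ddg x).1 + (dg x).2 * (ddg x).2))).
      exact: is_deriveV.
    apply: is_derive_eq; rewrite /GRing.scale /=; field.
    by rewrite nn.
  have qc (x : R) : al < x < w -> is_derive x 1 q 0.
    move=> /andP[x1 x2]; have := qD x.
    (* The derivative of [q] contains the curvature determinant as a factor, because the rest of the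
       numerator collapses to [y x]. *)
    have -> : z x * 0 + ((dg al).1 * (ddg x).2 - (dg al).2 * (ddg x).1) * n x
         - z x * ((dg x).1 * (ddg x).1 + (dg x).2 * (ddg x).2) = y x * det (dg x) (ddg x).
      by rewrite /z /n /y /det; ring.
    rewrite flat; last by apply/andP; split; lra.
    by rewrite !mulr0 mul0r.
  have qc' (v : R) : v \in `]al, w[ -> is_derive v 1 q 0 by rewrite in_itv; exact: qc.
  have qcont : continuous q by move=> x; exact: is_derive_continuous (qD x).
  have [c _ e] := @MVT R q (fun=> 0) al w aw qc'  (continuous_subspaceT qcont).
  have za : z al = 0 by rewrite /z; ring.
  move: e; rewrite mul0r /q za !mul0r subr0 => /eqP.
  by rewrite !mulf_eq0 invr_eq0 (gt_eqF (n0 w)) orbF orbb => /eqP.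
have yz w : y w ^+ 2 + z w ^+ 2 = n al * n w by rewrite /y /z /n; ring.
have yc : continuous y.
  move=> x; apply: cvgD; apply: cvgM; try exact: cvg_cst; [exact: dg1c|exact: dg2c].
(* On the interval [y ^+ 2 = n al * n w] is non-zero, so [y] keeps its sign at [al]: the tangent
   vector never reverses. *)
have y0 w : al <= w <= be -> 0 < y w.
  move=> /andP[aw wb]; have yn v : al <= v <= be -> y v != 0.
    move=> hv; rewrite -sqrf_eq0; have := yz v; rewrite z0 // expr0n addr0 => ->.
    by rewrite gt_eqF // mulr_gt0.
  rewrite ltNge; apply/negP => neg.
  have [|c] := @IVT R y al w 0 aw (continuous_subspaceT yc).
    by rewrite ge_min le_max neg orbT /=; apply/orP; left; exact: ltW (n0 al).
  rewrite in_itv /= => /andP[c1 c2] /eqP; rewrite (negPf (yn c _)) //.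
  by rewrite c1 (le_trans c2).
have par w : al <= w <= be -> (dg w).1 = y w / n al * (dg al).1 /\
    (dg w).2 = y w / n al * (dg al).2.
  move=> hw; have nn : n al != 0 by rewrite gt_eqF.
  have zw := z0 _ hw; split; apply: (mulfI nn).
    have -> : n al * (y w / n al * (dg al).1) = y w * (dg al).1 by field.
    have -> : n al * (dg w).1 = y w * (dg al).1 - (dg al).2 * z w by rewrite /n /y /z; ring.
    by rewrite zw mulr0 subr0.
  have -> : n al * (y w / n al * (dg al).2) = y w * (dg al).2 by field.
  have -> : n al * (dg w).2 = y w * (dg al).2 + (dg al).1 * z w by rewrite /n /y /z; ring.
  by rewrite zw mulr0 addr0.
have D1 (x : R) : is_derive x 1 (fun w => (dg al).1 * (g w).2 + - (dg al).2 * (g w).1 + 0) (z x).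
  have := is_derive_lin (dg al).1 (- (dg al).2) 0 (g2D x) (g1D x).
  by rewrite mulNr.
have D2 (x : R) : is_derive x 1 (fun w => (dg al).1 * (g w).1 + (dg al).2 * (g w).2 + 0) (y x).
  exact: is_derive_lin.
have [c1 /andP[p1 q1]] := mvt D1 ab; rewrite z0; last by apply/andP; split; lra.
have [c2 /andP[p2 q2]] := mvt D2 ab.
rewrite mul0r !addr0 => E2 E1.
have yc2 : 0 < y c2 by apply: y0; apply/andP; split; lra.
have nn : n al != 0 by rewrite gt_eqF.
exists (y c2 * (be - al) / n al); first by rewrite divr_gt0 // mulr_gt0 // subr_gt0.
split.
- apply: (mulfI nn); rewrite -E2.
  rewrite mulrA mulrA.
  have -> : n al * ((dg al).1 * (g be).1 + (dg al).2 * (g be).2 -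
    ((dg al).1 * (g al).1 + (dg al).2 * (g al).2)) / n al * (dg al).1 = 
    ((dg al).1 * (g be).1 + (dg al).2 * (g be).2 -
    ((dg al).1 * (g al).1 + (dg al).2 * (g al).2)) * (dg al).1
    + (dg al).2 * ((dg al).1 * (g be).2 + - (dg al).2 * (g be).1 -
       ((dg al).1 * (g al).2 + - (dg al).2 * (g al).1)) *- 1 by rewrite E1; field.
  by rewrite /n; ring.
- apply: (mulfI nn); rewrite -E2 mulrA mulrA.
  have -> : n al * ((dg al).1 * (g be).1 + (dg al).2 * (g be).2 -
    ((dg al).1 * (g al).1 + (dg al).2 * (g al).2)) / n al * (dg al).2 = 
    ((dg al).1 * (g be).1 + (dg al).2 * (g be).2 -
    ((dg al).1 * (g al).1 + (dg al).2 * (g al).2)) * (dg al).2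
    + (dg al).1 * ((dg al).1 * (g be).2 + - (dg al).2 * (g be).1 -
       ((dg al).1 * (g al).2 + - (dg al).2 * (g al).1)) by rewrite E1; field.
  by rewrite /n; ring.
- have hb : al <= be <= be by rewrite lexx ltW.
  exists (y be / n al); first by rewrite divr_gt0 // y0.
  exact: par.
Qed.

End Tangent.

(** * Area of a cap near its chord, up to a quadratic error *)

Section Expansion.
Variable R : realType.
Local Notation mR := (measurableTypeR R).

(** Model of a cap near a chord on the first axis, with tilt [k], shift [s] and depth [e]; the
    strict lower bound matches the complement of [under 0 (- e)]. *)
Definition slab (l e k s : R) : set (R * R) :=
  [set x | [/\ - l <= x.1 <= l, - e < x.2 & x.2 <= k * x.1 + s]].

Lemma measurable_slab l e k s : measurable (slab l e k s : set (mR * mR)).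
Proof.
have -> : slab l e k s = ([set x | 1 * x.1 + 0 * x.2 <= l] `&` [set x | (- 1) * x.1 + 0 * x.2 <= l])
  `&` (~` [set x | 0 * x.1 + 1 * x.2 <= - e] `&` [set x | (- k) * x.1 + 1 * x.2 <= s]).
  apply/seteqP; split => -[x y]; rewrite /slab /=.
    move=> [/andP[h1 h2] h3 h4]; split; split; try (apply/negP; rewrite -ltNge); lra.
  move=> [[h1 h2] [/negP]]; rewrite -ltNge => h3 h4; split; [apply/andP; split|idtac|idtac]; lra.
by apply: measurableI; apply: measurableI; [| |apply: measurableC|]; exact: measurable_dot_le.
Qed.

Lemma bmset_slab l e k s : bmset (slab l e k s).
Proof.
split; first exact: measurable_slab.
exists (`|l| + `|e| + `|k| * `|l| + `|s|) => -[x y] [/= /andP[h1 h2] h3 h4].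
have hx : `|x| <= `|l|.
  by rewrite (le_trans _ (ler_norm l)) // ler_norml h1.
have k0 : 0 <= `|k| * `|l| by rewrite mulr_ge0.
have e0 := normr_ge0 e; have l0 := normr_ge0 l; have s0 := normr_ge0 s.
split; first by lra.
have h5 : k * x <= `|k| * `|l|.
  by rewrite (le_trans (ler_norm _)) // normrM ler_wpM2l.
have := ler_norm e; have := ler_norm s; rewrite ler_norml => ? ?; apply/andP; split; lra.
Qed.

(** The slope drops out because the linear part integrates to zero over the symmetric interval; the
    bound on [e] keeps all vertical sections of non-negative length. *)
Lemma ar_slab (l e k s : R) : 0 <= l -> `|k| * l + `|s| <= e -> ar (slab l e k s) = 2 * l * (s + e).
Proof.
move=> l0 he.
have pos (x : R) : - l <= x <= l -> 0 <= k * x + s + e.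
  move=> /andP[h1 h2]; have : `|k * x| <= `|k| * l.
    by rewrite normrM ler_wpM2l // ler_norml h1.
  rewrite ler_norml => /andP[h3 _]; have := ler_norm (- s); rewrite normrN; lra.
pose f x : R := k * x + s + e.
have fD (x : R) : is_derive x 1 (fun x => k / 2 * x ^+ 2 + (s + e) * x) (f x).
  by apply: is_derive_eq; rewrite /GRing.scale /= /f; field.
have fc : continuous f.
  move=> x; apply: cvgD; last exact: cvg_cst.
  apply: cvgD; last exact: cvg_cst.
  by apply: cvgM; [exact: cvg_cst|exact: cvg_id].
have [S [SD SI]] := antiderivative fc.
have E : S l - S (- l) = 2 * l * (s + e).
  have DD (x : R) : is_derive x 1 (fun x => 1 * S x + (-1) * (k / 2 * x ^+ 2 + (s + e) * x) + 0) 0.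
    have := is_derive_lin 1 (-1) 0 (SD x) (fD x).
    by rewrite mul1r mulN1r subrr.
  have [ll|ll] := leP l (- l).
    have -> : l = 0 by lra.
    by rewrite oppr0 subrr; ring.
  have [c _] := mvt DD ll; rewrite mul0r => H.
  transitivity ((k / 2 * l ^+ 2 + (s + e) * l) - (k / 2 * (- l) ^+ 2 + (s + e) * (- l))); last by ring.
  by move: H; lra.
rewrite -E -SI; last by lra.
suff H : leb2 (slab l e k s) = (\int[@lebesgue_measure R]_(u in `[(- l)%R, l]) (f u)%:E)%E.
  apply: EFin_inj; rewrite -bmset_leb2; last exact: bmset_slab.
  rewrite H /Rintegral fineK // integrable_fin_num //.
  apply: continuous_compact_integrable; first exact: segment_compact.
  exact: continuous_subspaceT.
rewrite /leb2 /product_measure1 [RHS]integral_mkcond; apply: eq_integral => x _ /=.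
rewrite patchE; case: ifPn => [|hx].
  rewrite inE /= in_itv /= => hx.
  have -> : xsection (slab l e k s) x = `]- e, k * x + s]%classic.
    apply/seteqP; split => y; rewrite /xsection /slab /= inE /= in_itv /=.
      by move=> [_ -> ->].
    by move=> /andP[-> ->].
  rewrite [LHS]lebesgue_measure_itv /= lte_fin /f; have := pos _ hx.
  rewrite le_eqVlt => /orP[/eqP e1|e1].
    have -> : k * x + s = - e by lra.
    by rewrite ltxx addNr.
  have -> : - e < k * x + s by lra.
  by rewrite -EFinB opprK.
have -> : xsection (slab l e k s) x = set0.
  apply/seteqP; split => // y; rewrite /xsection /slab /= inE /= => -[h _ _].
  by move: hx; rewrite notin_setE /= in_itv /=; apply.
by rewrite measure0.
Qed.

Lemma ar_setU_le A B C : bmset A -> bmset B -> bmset C -> A `<=` B `|` C ->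
  ar A <= ar B + ar C :> R.
Proof.
move=> bA bB bC ABC; have mB : measurable (B : set (mR * mR)) by case: bB.
rewrite (ar_split bA mB); apply: lerD; apply: ar_le => //.
- exact: bmsetI.
- exact: bmsetD.
- by move=> x [/ABC []].
Qed.

Variables (K : set (R * R)) (l C r M : R).
Hypotheses (l0 : 0 < l) (C0 : 0 < C) (lM : l <= M).
Hypothesis bK : bmset K.
Hypothesis Kin : forall x y, `|x| <= l - C * `|y| -> `|y| <= r -> K (x, y).
Hypothesis Kout : forall x y, K (x, y) -> `|x| <= l + C * `|y|.
Hypothesis KM : forall x y, K (x, y) -> `|x| <= M.

Definition under (k s : R) : set (R * R) := [set x | x.2 <= k * x.1 + s].

Lemma measurable_under k s : measurable (under k s : set (mR * mR)).
Proof.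
have -> : under k s = [set x | (- k) * x.1 + 1 * x.2 <= s].
  by apply/seteqP; split => x; rewrite /under /=; lra.
exact: measurable_dot_le.
Qed.

(* Outside two boxes of size [C e] by [e] around the end points of the chord,
   the parts of [K] and of the slab in [- e < y] agree. *)
Lemma cap_slab e k s : 0 < e -> e <= r -> C * e <= l -> `|k| * M + `|s| <= e ->
  `|ar (K `&` under k s) - ar (K `&` under 0 (- e)) - 2 * l * (s + e)| <= 8 * C * e ^+ 2.
Proof.
move=> e0 er Cel he.
have he' : `|k| * l + `|s| <= e.
  by apply: le_trans he; rewrite lerD2r ler_wpM2l.
(* Each box measures [2 * C * e] by [2 * e]; the two together give the constant [8 * C * e ^+ 2]. *)
pose Z1 := `[l - C * e, l + C * e]%classic `*` `[- e, e]%classic : set (R * R).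
pose Z2 := `[- l - C * e, - l + C * e]%classic `*` `[- e, e]%classic : set (R * R).
have Ce : 0 < C * e by exact: mulr_gt0.
have box u v : u <= v -> bmset (`[u, v]%classic `*` `[- e, e]%classic : set (R * R)).
  move=> uv; split; first by apply: measurableX; exact: measurable_itv.
  exists (`|u| + `|v| + e) => -[x y] [/=]; rewrite !in_itv /= => /andP[h1 h2] /andP[h3 h4].
  have u0 := normr_ge0 u; have v0 := normr_ge0 v.
  have := ler_norm v; have := ler_norm (- u); rewrite normrN !ler_norml => ? ?.
  by split; apply/andP; split; lra.
have bZ1 : bmset Z1 by apply: box; lra.
have bZ2 : bmset Z2 by apply: box; lra.
have lin (x : R) : `|x| <= M -> - e <= k * x + s <= e.
  move=> hx; have : `|k * x + s| <= e.
    rewrite (le_trans (ler_normD _ _)) // normrM (le_trans _ he) // lerD2r.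
    by rewrite ler_wpM2l.
  by rewrite ler_norml.
have eK : K `&` under k s `&` under 0 (- e) = K `&` under 0 (- e).
  apply/seteqP; split => [x [[Kx _] h]//|[x y] [Kx h]]; split => //; split => //.
  by rewrite /under /= in h *; have /andP[h1 _] := lin _ (KM Kx); lra.
have sub1 : K `&` under k s `\` under 0 (- e) `<=` slab l e k s `|` (Z1 `|` Z2).
  move=> [x y] [[Kx]]; rewrite /under /= => h1 /negP; rewrite -ltNge => h2.
  have /andP[_ h3] := lin _ (KM Kx).
  have ye : `|y| <= e by rewrite ler_norml; apply/andP; split; lra.
  have := Kout Kx; have : C * `|y| <= C * e by rewrite ler_wpM2l // ltW.
  move=> h4 h5; have : `|x| <= l + C * e by lra.
  rewrite ler_norml => /andP[x1 x2].
  move: ye; rewrite ler_norml => /andP[y1 y2].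
  have [xl|xl] := leP x l; last first.
    by right; left; split; rewrite /= in_itv /= ?x2 ?y1 ?y2 // andbT; lra.
  have [xl'|xl'] := leP (- l) x; last first.
    by right; right; split; rewrite /= in_itv /= ?y1 ?y2 //; apply/andP; split; lra.
  by left; split => //=; [rewrite xl'|lra].
have sub2 : slab l e k s `<=` (K `&` under k s `\` under 0 (- e)) `|` (Z1 `|` Z2).
  move=> [x y] [/= /andP[x1 x2] y1 y2].
  have xM : `|x| <= M by rewrite ler_norml (le_trans _ x1) ?lerN2 // (le_trans x2).
  have /andP[_ h3] := lin _ xM.
  have ye : `|y| <= e by rewrite ler_norml; apply/andP; split; lra.
  have h4 : C * `|y| <= C * e by rewrite ler_wpM2l // ltW.
  have := ye; rewrite ler_norml => /andP[y3 y4].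
  have [xl|xl] := leP x (l - C * e); last first.
    by right; left; split; rewrite /= in_itv /= ?y3 ?y4 // (ltW xl); lra.
  have [xl'|xl'] := leP (- l + C * e) x; last first.
    by right; right; split; rewrite /= in_itv /= ?y3 ?y4 // (ltW xl') andbT; lra.
  left; split; last by rewrite /under /=; apply/negP; rewrite -ltNge; lra.
  split => //; apply: Kin; last by lra.
  by rewrite ler_norml; apply/andP; split; lra.
have bKu : bmset (K `&` under k s) by apply: bmsetI => //; exact: measurable_under.
have bZ : bmset (Z1 `|` Z2).
  case: bZ1 => m1 [D1 h1]; case: bZ2 => m2 [D2 h2]; split; first exact: measurableU.
  exists (`|D1| + `|D2|) => x [/h1|/h2] [p q].
    by split; rewrite (le_trans _ (_ : `|D1| <= _)) ?lerDl // ?(le_trans p) ?(le_trans q) ?ler_norm.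
  by split; rewrite (le_trans _ (_ : `|D2| <= _)) ?lerDr // ?(le_trans p) ?(le_trans q) ?ler_norm.
have a1 : l - C * e <= l + C * e by lra.
have a2 : - l - C * e <= - l + C * e by lra.
have a3 : - e <= e by lra.
have aZ : ar (Z1 `|` Z2) <= 8 * C * e ^+ 2.
  have -> : 8 * C * e ^+ 2 = ar Z1 + ar Z2 by rewrite !ar_box //; ring.
  exact: ar_setU_le.
have bT : bmset (K `&` under k s `\` under 0 (- e)).
  by apply: bmsetD => //; exact: measurable_under.
have inc1 := ar_setU_le bT (bmset_slab l e k s) bZ sub1.
have inc2 := ar_setU_le (bmset_slab l e k s) bT bZ sub2.
rewrite -(ar_slab (ltW l0) he') (ar_split bKu (measurable_under 0 (- e))) eK.
have re (a b c : R) : a + b - a - c = b - c by ring.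
rewrite re ler_distl; apply/andP; split.
  by rewrite lerBlDr (le_trans inc2) // lerD2l.
by rewrite (le_trans inc1) // lerD2l.
Qed.

End Expansion.

(** * Dupin's theorem: the envelope touches each chord of flotation at its midpoint *)

Section Dupin.
Variables (R : realType) (K : set (R * R)) (delta : R).
Hypothesis cK : convex_body K.
Hypothesis delta0 : 0 < delta.
Hypothesis delta_lt : delta < ar K.
Local Notation t_ := (flot K delta).

Lemma dot_uvecD (x : R * R) (th h : R) : dot x (uvec (th + h)) =
  cos h * dot x (uvec th) - sin h * det x (uvec th).
Proof. by rewrite uvec_shift /dot /det /uvec /=; ring. Qed.

(** For [A * h <= 1] the depth [2 * h * M + A * h ^+ 2] is at most [N * h], so the error is at most
    [16 * C * N ^+ 2 * h ^+ 2]. The summand [8 * C * N ^+ 2 / l] of [A] matches it exactly and the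
    extra 1 makes the inequality strict. The 16 anticipates two uses of [cap_slab]. *)
Lemma quadratic_choice (l C M r : R) : 0 < l -> 0 < C -> 0 <= M -> 0 < r ->
  exists2 A, 0 < A & exists2 h0, 0 < h0 & forall h, 0 < h < h0 ->
   [/\ h <= 2^-1, 0 < 2 * h * M + A * h ^+ 2, 2 * h * M + A * h ^+ 2 <= r,
     C * (2 * h * M + A * h ^+ 2) <= l &
     16 * C * (2 * h * M + A * h ^+ 2) ^+ 2 < 2 * l * (A * h ^+ 2)].
Proof.
move=> l0 C0 M0 r0; pose N := 2 * M + 1; pose A := 8 * C * N ^+ 2 / l + 1.
have N0 : 0 < N by rewrite /N; lra.
have A1 : 0 <= 8 * C * N ^+ 2 / l.
  by rewrite divr_ge0 // ?(ltW l0) // mulr_ge0 ?sqr_ge0 //; lra.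
have A0 : 0 < A by rewrite /A; lra.
exists A => //.
pose h0 := Num.min (Num.min 2^-1 A^-1) (Num.min (r / N) (l / (C * N))).
have CN : 0 < C * N by exact: mulr_gt0.
exists h0; first by rewrite !lt_min !divr_gt0 // !invr_gt0 A0 ltr0n.
move=> h /andP[hp]; rewrite !lt_min => /andP[/andP[h1 h2] /andP[h3 h4]].
have Ah : A * h <= 1 by rewrite -ler_pdivlMl // mulr1 ltW.
have eps : 2 * h * M + A * h ^+ 2 <= N * h.
  have -> : 2 * h * M + A * h ^+ 2 = (2 * M + A * h) * h by ring.
  by rewrite ler_pM2r // /N lerD2l.
have e0 : 0 < 2 * h * M + A * h ^+ 2.
  by rewrite ltr_wpDl // ?mulr_gt0 ?exprn_gt0 // !mulr_ge0 // ltW.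
split => //; first exact: ltW.
- by rewrite (le_trans eps) // mulrC -ler_pdivlMr // ltW.
- rewrite (le_trans (_ : _ <= C * (N * h))) ?ler_pM2l // mulrA.
  by rewrite mulrC -ler_pdivlMr // ltW.
- apply: (@le_lt_trans _ _ (16 * C * (N * h) ^+ 2)).
    rewrite ler_pM2l; last by lra.
    by rewrite ler_pXn2r // nnegrE ltW // mulr_gt0.
  have -> : 16 * C * (N * h) ^+ 2 = 2 * l * ((8 * C * N ^+ 2 / l) * h ^+ 2).
    by field; rewrite gt_eqF.
  rewrite ltr_pM2l; last by lra.
  by rewrite ltr_pM2r ?exprn_gt0 // /A ltrDl.
Qed.

Variables (th : R) (p q : R * R).
Hypothesis bp : boundary K p.
Hypothesis bq : boundary K q.
Hypothesis dp : dot p (uvec th) = t_ th.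
Hypothesis dq : dot q (uvec th) = t_ th.
Hypothesis pq : det q (uvec th) < det p (uvec th).

Let m : R * R := ((p.1 + q.1) / 2, (p.2 + q.2) / 2).
Let dm := det m (uvec th).
Let t := t_ th.
(** Isometric coordinates with origin at the midpoint [m], first axis along the chord and second
    axis along [uvec th]; the chord becomes the segment from [(- l, 0)] to [(l, 0)]. *)
Let psi := affmap (sin th) (cos th) (sin th * dm + cos th * t)
  (- cos th) (sin th) (- cos th * dm + sin th * t).
Let l := (det p (uvec th) - det q (uvec th)) / 2.

Let c2 := sin2Dcos2 th.

Let psi_dot X : dot (psi X) (uvec th) = X.2 + t.
Proof.
transitivity ((sin th ^+ 2 + cos th ^+ 2) * (X.2 + t)); last by rewrite c2 mul1r.
by rewrite /psi /affmap /dot /uvec /=; ring.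
Qed.

Let psi_det X : det (psi X) (uvec th) = X.1 + dm.
Proof.
transitivity ((sin th ^+ 2 + cos th ^+ 2) * (X.1 + dm)); last by rewrite c2 mul1r.
by rewrite /psi /affmap /det /uvec /=; ring.
Qed.

Let l0 : 0 < l. Proof. by rewrite /l divr_gt0 // subr_gt0. Qed.

Let psi_p : psi (l, 0) = p.
Proof.
apply: (@uvec_inj _ th); first by rewrite psi_dot /= add0r dp.
by rewrite psi_det /l /dm /m /det /=; field.
Qed.

Let psi_q : psi (- l, 0) = q.
Proof.
apply: (@uvec_inj _ th); first by rewrite psi_dot /= add0r dq.
by rewrite psi_det /l /dm /m /det /=; field.
Qed.

Let psi_0 : psi (0, 0) = m.
Proof.
apply: (@uvec_inj _ th); last by rewrite psi_det /= add0r.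
have -> : dot m (uvec th) = (dot p (uvec th) + dot q (uvec th)) / 2.
  by rewrite /m /dot /=; field.
by rewrite psi_dot /= add0r dp dq /t; field.
Qed.

Let psi_seg s X Y : psi (s * X.1 + (1 - s) * Y.1, s * X.2 + (1 - s) * Y.2) =
  (s * (psi X).1 + (1 - s) * (psi Y).1, s * (psi X).2 + (1 - s) * (psi Y).2).
Proof. by rewrite /psi /affmap /=; congr (_, _); ring. Qed.

Let Kp : K p. Proof. by have [] := (boundaryP cK p).1 bp. Qed.
Let Kq : K q. Proof. by have [] := (boundaryP cK q).1 bq. Qed.

(** Otherwise [p], [q] and [m] would be three boundary points on a line through an interior
    point. *)
Lemma midpoint_inner : interior K m.
Proof.
apply: contrapT => ni.
have Km : K m.
  have := body_convex cK (t := 2^-1) Kp Kq; rewrite /m => H.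
  have -> : ((p.1 + q.1) / 2, (p.2 + q.2) / 2) =
    (2^-1 * p.1 + (1 - 2^-1) * q.1, 2^-1 * p.2 + (1 - 2^-1) * q.2) by congr (_, _); field.
  by apply: H; apply/andP; split; lra.
have bm : boundary K m by apply/boundaryP.
have [z iz dz] := flot_inner cK delta0 delta_lt th.
have dmt : dot m (uvec th) = t by rewrite -psi_0 psi_dot /= add0r.
have npq : p <> q by move=> e; move: pq; rewrite e ltxx.
have := @boundary_line3 _ _ cK th z p q m iz bp bq bm; rewrite dz dp dq dmt.
move=> /(_ erefl erefl erefl npq) [e|e].
  by have := psi_det (0, 0); rewrite psi_0 e -psi_p psi_det /= -/dm; move: l0; lra.
by have := psi_det (0, 0); rewrite psi_0 e -psi_q psi_det /= -/dm; move: l0; lra.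
Qed.

Let radius : exists2 r, 0 < r & forall y, `|y| <= r -> interior K (psi (0, y)).
Proof.
have /interiorP [e e0 he] := midpoint_inner; exists (e / 3); first by lra.
move=> y hy; apply/interiorP; exists (e / 3); first by lra.
have sy : `|sin th * y| <= e / 3.
  by rewrite normrM (le_trans _ hy) // ler_piMl // sin_max.
have cy : `|cos th * y| <= e / 3.
  by rewrite normrM (le_trans _ hy) // ler_piMl // cos_max.
move=> w w1 w2; apply: he; rewrite -psi_0.
  have -> : (psi (0, 0)).1 - w.1 = - (cos th * y) + ((psi (0, y)).1 - w.1).
    by rewrite /psi /affmap /=; ring.
  by apply: le_lt_trans (ler_normD _ _) _; rewrite normrN; lra.
have -> : (psi (0, 0)).2 - w.2 = - (sin th * y) + ((psi (0, y)).2 - w.2).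
  by rewrite /psi /affmap /=; ring.
by apply: le_lt_trans (ler_normD _ _) _; rewrite normrN; lra.
Qed.

Let K' := psi @^-1` K.

(** Such a point is a mixture of the chord end on its side and a point of the second axis at
    distance at most [r] from the origin. *)
Let Kin r : 0 < r -> (forall y, `|y| <= r -> interior K (psi (0, y))) ->
  forall x y, `|x| <= l - l / r * `|y| -> `|y| <= r -> K' (x, y).
Proof.
move=> r0 hr x y hx hy; rewrite /K' /=.
have C0 : 0 < l / r by exact: divr_gt0.
have gen (x1 : R) (a : R * R) : K a -> 0 <= x1 -> x1 <= l - l / r * `|y| ->
    psi (x, y) = (x1 / l * a.1 + (1 - x1 / l) * (psi (0, y / (1 - x1 / l))).1,
                  x1 / l * a.2 + (1 - x1 / l) * (psi (0, y / (1 - x1 / l))).2) \/ x1 = l ->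
    (x1 = l -> psi (x, y) = a) -> K (psi (x, y)).
  move=> Ka x0 x1l eq1 eq2.
  have y0 : 0 <= l / r * `|y| by rewrite mulr_ge0 // ltW.
  have [e|ne] := eqVneq x1 l; first by rewrite eq2.
  have {ne} x1lt : x1 < l by rewrite lt_neqAle ne /=; lra.
  case: eq1 => [->|e]; last by move: x1lt; rewrite e ltxx.
  have s1 : x1 / l < 1 by rewrite ltr_pdivrMr // mul1r.
  have s0 : 0 <= x1 / l by rewrite divr_ge0 // ltW.
  apply: (body_convex cK) => //; last by rewrite s0 ltW.
  apply: interior_sub; apply: hr; rewrite normrM normfV [`|1 - _|]gtr0_norm; last by lra.
  rewrite ler_pdivrMr; last by lra.
  have -> : r * (1 - x1 / l) = (l - x1) / (l / r) by field; rewrite !gt_eqF.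
  by rewrite ler_pdivlMr // mulrC; lra.
have y1 (x1 : R) : x1 = l -> x1 <= l - l / r * `|y| -> y = 0.
  move=> -> h; apply/eqP; rewrite -normr_eq0 eq_le normr_ge0 andbT.
  rewrite -(pmulr_rle0 _ C0); lra.
have ln : l != 0 by rewrite gt_eqF.
have [x0|x0] := leP 0 x.
  rewrite ger0_norm // in hx.
  apply: (@gen x p) => //; last first.
    by move=> xl; rewrite xl (y1 x) // ?xl // psi_p.
  have [->|xl] := eqVneq x l; [by right|left].
  rewrite -{1 2}psi_p -psi_seg /=; congr psi; congr (_, _); first by rewrite divfK //; ring.
  by rewrite mulr0 add0r mulrC divfK // subr_eq0 eq_sym -(inj_eq (mulIf ln)) divfK // mul1r.
rewrite ltr0_norm // in hx.
apply: (@gen (- x) q) => //; [by lra| |].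
  have [->|xl] := eqVneq (- x) l; [by right|left].
  rewrite -{1 2}psi_q -psi_seg /=; congr psi; congr (_, _); first by rewrite mulrN divfK //; ring.
  by rewrite mulr0 add0r mulrC divfK // subr_eq0 eq_sym -(inj_eq (mulIf ln)) divfK // mul1r.
by move=> xl; rewrite (y1 (- x)) // -[x]opprK xl psi_q.
Qed.

(** For a point of [K] further out, the chord end on its side would be a proper mixture of that
    point and an interior point of the second axis, hence interior. *)
Let Kout r : 0 < r -> (forall y, `|y| <= r -> interior K (psi (0, y))) ->
  forall x y, K' (x, y) -> `|x| <= l + l / r * `|y|.
Proof.
move=> r0 hr x y Kx; rewrite leNgt; apply/negP => hx.
have C0 : 0 < l / r by exact: divr_gt0.
have y0 : 0 <= l / r * `|y| by rewrite mulr_ge0 // ltW.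
have xp : 0 < `|x| by move: l0; lra.
pose s := l / `|x|; have s0 : 0 <= s by rewrite divr_ge0 // ltW.
have s1 : s < 1 by rewrite ltr_pdivrMr // mul1r; lra.
have i0 : interior K (psi (0, - (s * y) / (1 - s))).
  apply: hr; rewrite normrM normfV [`|1 - _|]gtr0_norm; last by lra.
  rewrite ler_pdivrMr; last by lra.
  rewrite normrN normrM ger0_norm // /s.
  have -> : r * (1 - l / `|x|) = (`|x| - l) / (l / r) * (l / `|x|).
    by field; rewrite !gt_eqF.
  rewrite [X in X <= _]mulrC; apply: ler_wpM2r; first by rewrite divr_ge0 // ltW.
  by rewrite ler_pdivlMr // mulrC; lra.
have := interior_seg cK i0 Kx (s := s); rewrite s0 s1 => /(_ isT).
rewrite -psi_seg /=.
have -> : s * y + (1 - s) * (- (s * y) / (1 - s)) = 0 by field; rewrite gt_eqF //; lra.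
have [x0|x0] := leP 0 x.
  have -> : s * x + (1 - s) * 0 = l by rewrite /s ger0_norm // mulr0 addr0 divfK // -normr_eq0 gt_eqF.
  by rewrite psi_p; have [] := (boundaryP cK p).1 bp.
have -> : s * x + (1 - s) * 0 = - l.
  by rewrite /s ltr0_norm // mulr0 addr0 invrN mulrN mulNr divfK // -normr_eq0 gt_eqF.
by rewrite psi_q; have [] := (boundaryP cK q).1 bq.
Qed.

Let det1 : sin th * sin th - cos th * - cos th = 1.
Proof. by rewrite -[RHS]c2; ring. Qed.

Let KM : exists2 M, 0 <= M & l <= M /\ bmset K' /\ forall x y, K' (x, y) -> `|x| <= M.
Proof.
have [D D0 hD] := body_bounded cK.
have H X : K (psi X) -> `|X.1| <= 2 * D + `|dm| /\ `|X.2| <= 2 * D + `|t|.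
  move=> /hD [h1 h2].
  have b1 : `|dot (psi X) (uvec th)| <= 2 * D.
    rewrite (le_trans (ler_normD _ _)) // !normrM (_ : 2 * D = D * 1 + D * 1); last by ring.
    by apply: lerD; apply: ler_pM => //; [exact: cos_max|exact: sin_max].
  have b2 : `|det (psi X) (uvec th)| <= 2 * D.
    rewrite (le_trans (ler_normB _ _)) // !normrM (_ : 2 * D = D * 1 + D * 1); last by ring.
    by apply: lerD; apply: ler_pM => //; [exact: sin_max|exact: cos_max].
  rewrite psi_dot in b1; rewrite psi_det in b2; split.
    by rewrite -[X.1](addrK dm) (le_trans (ler_normB _ _)) // lerD2r.
  by rewrite -[X.2](addrK t) (le_trans (ler_normB _ _)) // lerD2r.
exists (2 * D + `|dm|); first by rewrite addr_ge0 //; lra.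
split.
  have := H (l, 0); rewrite psi_p => /(_ Kp) [/= + _].
  by apply: le_trans; exact: ler_norm.
split; last by move=> x y /H [].
split.
  by apply: measurable_pre (measurable_affmap _ _ _ _ _ _) _; case: (bmset_body cK).
exists (2 * D + `|dm| + `|t|) => X /H [h1 h2]; have := normr_ge0 dm; have := normr_ge0 t.
by split; lra.
Qed.

(** In the coordinates [psi] the turned line has slope [tan h]; the subtracted number
    [t * cos h - dm * sin h] is the position of the turned line through [m]. *)
Let cap_under (h T : R) : 0 < cos h ->
  ar (cap K (th + h) T) = ar (K' `&` under (sin h / cos h) ((T - (t * cos h - dm * sin h)) / cos h)).
Proof.
move=> ch; rewrite -(affmap_ar (sin th * dm + cos th * t) (- cos th * dm + sin th * t) det1); last first.
  by case: (bmset_cap cK (th + h) T).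
congr ar; rewrite -/psi; apply/seteqP; split => X.
  move=> [Kx]; rewrite /halfplane /= dot_uvecD psi_dot psi_det => H; split => //.
  rewrite /under /= -(ler_pM2r ch) mulrDl divfK ?gt_eqF // mulrAC divfK ?gt_eqF //.
  by rewrite [X.2 * _]mulrC [t * _]mulrC [dm * _]mulrC; lra.
move=> [Kx]; rewrite /under /= -(ler_pM2r ch) mulrDl divfK ?gt_eqF // mulrAC divfK ?gt_eqF //.
move=> H; split => //; rewrite /halfplane /= dot_uvecD psi_dot psi_det.
by move: H; rewrite [X.2 * _]mulrC [t * _]mulrC [dm * _]mulrC; lra.
Qed.

(** Turning the line about the midpoint [m] trades two triangles of equal area to first order, so
    the area changes by a quadratic amount only, and a shift of order [h ^+ 2] compensates it. *)
Lemma flot_expansion : exists2 A, 0 < A & exists2 h0, 0 < h0 & forall h, `|h| < h0 ->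
  `|t_ (th + h) - (t * cos h - dm * sin h)| <= A * h ^+ 2.
Proof.
have [r r0 hr] := radius; have [M M0 [lM [bK' hM]]] := KM.
have C0 : 0 < l / r by exact: divr_gt0.
have [A A0 [h0 h00 H]] := quadratic_choice l0 C0 M0 r0.
exists A => //; exists h0 => // h hh.
have [->|hn] := eqVneq h 0.
  by rewrite addr0 cos0 sin0 mulr1 mulr0 subr0 subrr normr0 expr0n mulr0.
have hp : 0 < `|h| by rewrite normr_gt0.
have := H `|h|; rewrite hp hh => /(_ isT); rewrite real_normK ?num_real // => -[k1 k2 k3 k4 k5].
set e := 2 * `|h| * M + A * h ^+ 2 in k2 k3 k4 k5.
have ch1 : 1 - `|h| <= cos h.
  by have := cos_lip h 0; rewrite cos0 subr0 ler_norml => /andP[]; lra.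
have ch : 0 < cos h by lra.
have ch2 : cos h <= 1 by have := cos_max h; rewrite ler_norml => /andP[].
have sh : `|sin h| <= `|h| by have := sin_lip h 0; rewrite sin0 !subr0.
have kh : `|sin h / cos h| <= 2 * `|h|.
  rewrite normrM normfV (gtr0_norm ch) ler_pdivrMr //.
  rewrite (le_trans sh) // -mulrA [_ * cos h]mulrC mulrA -[X in X <= _]mul1r ler_wpM2r //.
  lra.
have h2 : 0 <= A * h ^+ 2 by rewrite mulr_ge0 ?sqr_ge0 // ltW.
(* Subtracting the estimate for the untilted chord, whose cap has area [delta], eliminates the
   unknown area below depth [e] and doubles the error. *)
have area s : `|s| <= A * h ^+ 2 ->
    `|ar (K' `&` under (sin h / cos h) s) - delta - 2 * l * s| <= 16 * (l / r) * e ^+ 2.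
  move=> hs.
  have b1 : `|sin h / cos h| * M + `|s| <= e.
    by rewrite /e; apply: lerD => //; apply: ler_wpM2r.
  have b2 : `|(0 : R)| * M + `|(0 : R)| <= e by rewrite !normr0 mul0r addr0 ltW.
  have E1 := cap_slab l0 C0 lM bK' (Kin r0 hr) (Kout r0 hr) hM k2 k3 k4 b1.
  have E2 := cap_slab l0 C0 lM bK' (Kin r0 hr) (Kout r0 hr) hM k2 k3 k4 b2.
  have d0 : ar (K' `&` under 0 0) = delta.
    rewrite -(flot_area cK delta0 delta_lt th); have := @cap_under 0 t.
    rewrite addr0 cos0 sin0 mul0r mulr1 mulr0 subr0 subrr mul0r ltr01 => /(_ isT) <- //.
  rewrite d0 in E2.
  move: E1 E2; set a := ar (K' `&` under (sin h / cos h) s).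
  set b := ar (K' `&` under 0 (- e)) => E1 E2.
  have -> : a - delta - 2 * l * s = (a - b - 2 * l * (s + e)) - (delta - b - 2 * l * (0 + e)) by ring.
  apply: le_trans (ler_normB _ _) _.
  have -> : 16 * (l / r) * e ^+ 2 = 8 * (l / r) * e ^+ 2 + 8 * (l / r) * e ^+ 2 by ring.
  exact: lerD.
set T0 := t * cos h - dm * sin h.
(* The trial positions correspond to the shifts [A * h ^+ 2] and, below, [- (A * h ^+ 2)], whose
   gain in area exceeds the error by the choice of [A]. *)
have up : t_ (th + h) < T0 + cos h * (A * h ^+ 2).
  apply: (flot_lt cK delta0 delta_lt); rewrite cap_under // -/T0 addrAC subrr add0r mulrAC divff ?gt_eqF // mul1r.
  have := @area (A * h ^+ 2); rewrite ger0_norm // => /(_ (lexx _)).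
  rewrite ler_norml => /andP[+ _]; move: (ar _) => a; lra.
have dn : T0 - cos h * (A * h ^+ 2) < t_ (th + h).
  apply: (flot_gt cK delta0 delta_lt); rewrite cap_under // -/T0 addrAC subrr add0r mulNr mulrAC divff ?gt_eqF // mul1r.
  have := @area (- (A * h ^+ 2)); rewrite normrN ger0_norm // => /(_ (lexx _)).
  rewrite ler_norml => /andP[_]; move: (ar _) => a; lra.
have le1 : cos h * (A * h ^+ 2) <= A * h ^+ 2 by rewrite ler_piMl.
rewrite ler_distl; apply/andP; split.
  by apply: le_trans (ltW dn); rewrite lerD2l lerN2.
by apply: le_trans (ltW up) _; rewrite lerD2l.
Qed.

(** To first order [t_] agrees with the support function of the single point [m]. *)
Lemma flot_derive : is_derive th 1 t_ (- dm).
Proof.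
have [A A0 [h0 h00 H]] := flot_expansion.
have D0 : is_derive (0 : R) 1 (fun h => t * cos h + (- dm) * sin h + 0) (t * (- sin 0) + (- dm) * cos 0).
  exact: is_derive_lin.
rewrite sin0 cos0 oppr0 mulr0 add0r mulr1 in D0.
apply/is_deriveP => e e0.
have e2 : 0 < e / 2 by lra.
have [r r0 hr] := (is_deriveP _ _ _).1 D0 _ e2.
exists (Num.min (Num.min h0 r) (e / (2 * A))).
  by rewrite !lt_min h00 r0 /= divr_gt0 // mulr_gt0.
move=> h; rewrite !lt_min => /andP[/andP[/H h1 /hr h2] h3].
have {}h3 : A * h ^+ 2 <= e / 2 * `|h|.
  rewrite -[h ^+ 2]real_normK ?num_real // expr2 mulrA ler_wpM2r //.
  rewrite mulrC -ler_pdivlMr //; apply: le_trans (ltW h3) _.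
  by rewrite invfM mulrA.
rewrite add0r cos0 sin0 !mulr1 mulr0 !addr0 in h2.
have -> : t_ (th + h) - t_ th - h * - dm =
  (t_ (th + h) - (t * cos h - dm * sin h)) + (t * cos h + - dm * sin h - t - h * - dm).
  by rewrite -/t; ring.
apply: le_trans (ler_normD _ _) _.
have -> : e * `|h| = e / 2 * `|h| + e / 2 * `|h| by field.
by apply: lerD => //; apply: le_trans h1 _.
Qed.

End Dupin.

Section SetDifferences.
Variable R : realType.
Local Notation mR := (measurableTypeR R).

Lemma aint_setD_sub (A B H H' : set (R * R)) p q r : bmset A -> bmset B ->
  measurable (H : set (mR * mR)) -> measurable (H' : set (mR * mR)) ->
  A `&` H = B `&` H' ->
  aint A p q r - aint B p q r = aint (A `\` H) p q r - aint (B `\` H') p q r.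
Proof.
move=> bA bB mH mH' e.
by rewrite (aint_split p q r bA mH) (aint_split p q r bB mH') e; ring.
Qed.

Lemma ar_setD_sub (A B H H' : set (R * R)) : bmset A -> bmset B ->
  measurable (H : set (mR * mR)) -> measurable (H' : set (mR * mR)) ->
  A `&` H = B `&` H' -> ar A - ar B = ar (A `\` H) - ar (B `\` H').
Proof.
by move=> bA bB mH mH' e; rewrite (ar_split bA mH) (ar_split bB mH') e; ring.
Qed.

End SetDifferences.

(** * The centroids of the caps as a continuous, strictly supported curve *)

Section Centroids.
Variables (R : realType) (K : set (R * R)) (delta : R).
Hypothesis cK : convex_body K.
Hypothesis delta0 : 0 < delta.
Hypothesis delta_lt : delta < ar K.
Local Notation t_ := (flot K delta).

Definition fcap th := cap K th (t_ th).
Definition fcen th := centroid (fcap th).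

Lemma bmset_fcap th : bmset (fcap th). Proof. exact: bmset_cap. Qed.
Lemma ar_fcap th : ar (fcap th) = delta. Proof. exact: flot_area. Qed.

Lemma dot_fcen th (v : R * R) : delta * dot (fcen th) v = aint (fcap th) v.1 v.2 0.
Proof.
rewrite aint_lin; last exact: bmset_fcap.
by rewrite /fcen centroidE ar_fcap /dot /=; field; rewrite gt_eqF.
Qed.

Lemma flot_periodic th : t_ (th + pi *+ 2) = t_ th.
Proof.
apply/esym/(flot_uniq cK delta0 delta_lt); rewrite -[RHS](flot_area cK delta0 delta_lt th).
by congr ar; rewrite /cap /halfplane /uvec cosD2pi sinD2pi.
Qed.

Lemma fcen_periodic th : fcen (th + pi *+ 2) = fcen th.
Proof. by rewrite /fcen /fcap /cap flot_periodic /halfplane /uvec cosD2pi sinD2pi. Qed.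

Definition fdiff th th' := fcap th' `\` halfplane th (t_ th).
Local Notation fD := fdiff.

Let bfD th th' : bmset (fD th th').
Proof. by apply: bmsetD; [exact: bmset_fcap|exact: measurable_halfplane]. Qed.

Let fI th th' : fcap th' `&` halfplane th (t_ th) = fcap th `&` halfplane th' (t_ th').
Proof. by apply/seteqP; split => z [[h1 h2] h3]. Qed.

Let fD_sym th th' : ar (fD th th') = ar (fD th' th).
Proof.
have e := ar_setD_sub (bmset_fcap th') (bmset_fcap th)
  (measurable_halfplane th (t_ th)) (measurable_halfplane th' (t_ th')) (fI th th').
have z := etrans (congr2 (fun a b => a - b) (ar_fcap th') (ar_fcap th)) (subrr delta).
exact: (subr0_eq (etrans (esym e) z)).
Qed.

Let aint_diff th th' p q r : aint (fcap th') p q r - aint (fcap th) p q r =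
  aint (fD th th') p q r - aint (fD th' th) p q r.
Proof.
exact: (aint_setD_sub p q r (bmset_fcap th') (bmset_fcap th)
  (measurable_halfplane th (t_ th)) (measurable_halfplane th' (t_ th')) (fI th th')).
Qed.

Let fDP th th' x : fD th th' x ->
  [/\ K x, dot x (uvec th') <= t_ th' & t_ th < dot x (uvec th)].
Proof.
move=> [[Kx h1]]; rewrite /halfplane /= => /negP; rewrite -ltNge => h2.
by split.
Qed.

Let fDI th th' x : K x -> dot x (uvec th') <= t_ th' -> t_ th < dot x (uvec th) -> fD th th' x.
Proof.
move=> Kx h1 h2; split; first by split.
by rewrite /halfplane /=; apply/negP; rewrite -ltNge.
Qed.

Opaque fdiff fcap.

(** Caps that agree up to null sets split the interior of [K] alike. Moving from an inner point [z]
    of the first line along [uvec th - uvec th'] raises one height and lowers the other by the same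
    amount [c * k], which is contradictory in both directions at once unless [k = 0]. *)
Lemma fcap_separate th th' : ar (fD th th') = 0 -> uvec th = uvec th'.
Proof.
move=> a0; have a1 : ar (fD th' th) = 0 by rewrite -fD_sym.
have [z iz dz] := flot_inner cK delta0 delta_lt th.
have op (v : R * R) (s : R) : open [set x : R * R | dot x v < s].
  rewrite (_ : [set _ | _] = (fun x => dot x v) @^-1` `]-oo, s[%classic); last first.
    by apply/seteqP; split => x /=; rewrite in_itv.
  by apply: open_comp; [move=> x _; exact: dot_continuous|exact: interval_open].
have op' (v : R * R) (s : R) : open [set x : R * R | s < dot x v].
  rewrite (_ : [set _ | _] = (fun x => dot x v) @^-1` `]s, +oo[%classic); last first.
    by apply/seteqP; split => x /=; rewrite in_itv /= andbT.
  by apply: open_comp; [move=> x _; exact: dot_continuous|exact: interval_open].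
have up x : interior K x -> t_ th < dot x (uvec th) -> t_ th' <= dot x (uvec th').
  move=> ix h; rewrite leNgt; apply/negP => h'.
  suff : 0 < ar (fD th th') by rewrite a0 ltxx.
  apply: (@ar_open _ _ (interior K `&` ([set x | t_ th < dot x (uvec th)] `&` [set x | dot x (uvec th') < t_ th']))) => //.
  - by apply: openI; [exact: open_interior|exact: openI].
  - by exists x.
  - by move=> y [iy [y1 y2]]; apply: fDI => //; [exact: interior_sub|exact: ltW].
have dn x : interior K x -> dot x (uvec th) < t_ th -> dot x (uvec th') <= t_ th'.
  move=> ix h; rewrite leNgt; apply/negP => h'.
  suff : 0 < ar (fD th' th) by rewrite a1 ltxx.
  apply: (@ar_open _ _ (interior K `&` ([set x | dot x (uvec th) < t_ th] `&` [set x | t_ th' < dot x (uvec th')]))) => //.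
  - by apply: openI; [exact: open_interior|exact: openI].
  - by exists x.
  - by move=> y [iy [y1 y2]]; apply: fDI => //; [exact: interior_sub|exact: ltW].
clear a0 a1.
pose v1 := cos th - cos th'; pose v2 := sin th - sin th'.
have e1 := sin2Dcos2 th; have e2 := sin2Dcos2 th'.
pose k := 1 - (cos th * cos th' + sin th * sin th').
have vk : v1 ^+ 2 + v2 ^+ 2 = 2 * k.
  have -> : 2 * k = (sin th ^+ 2 + cos th ^+ 2) + (sin th' ^+ 2 + cos th' ^+ 2)
    - 2 * (cos th * cos th' + sin th * sin th') by rewrite e1 e2 /k; ring.
  by rewrite /v1 /v2; ring.
have [k0|k0] := eqVneq k 0.
  move: vk; rewrite k0 mulr0 => /eqP; rewrite paddr_eq0 ?sqr_ge0 // !sqrf_eq0 /v1 /v2 !subr_eq0.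
  by rewrite /uvec => /andP[/eqP -> /eqP ->].
have kp : 0 < k.
  have := sqr_ge0 v1; have := sqr_ge0 v2; rewrite lt_neqAle eq_sym k0 /=; lra.
have /interiorP [e ep he] := iz.
(* The entries of [v] are at most 2, so the displacement is at most [e / 3] and half of the radius
   [e] still fits. *)
pose s := e / 6.
have s0 : 0 < s by rewrite /s; lra.
have n1 : `|v1| <= 2.
  have := cos_max th; have := cos_max th'; rewrite /v1 => ? ?; apply: le_trans (ler_normB _ _) _; lra.
have n2 : `|v2| <= 2.
  have := sin_max th; have := sin_max th'; rewrite /v2 => ? ?; apply: le_trans (ler_normB _ _) _; lra.
have near (c : R) : `|c| = s -> interior K (z.1 + c * v1, z.2 + c * v2).
  move=> cs; apply/interiorP; exists (e / 2); first by lra.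
  have b1 : `|c * v1| <= s * 2 by rewrite normrM cs ler_wpM2l // ltW.
  have b2 : `|c * v2| <= s * 2 by rewrite normrM cs ler_wpM2l // ltW.
  move=> w /= w1 w2; apply: he.
    have -> : z.1 - w.1 = (z.1 + c * v1 - w.1) - c * v1 by ring.
    by apply: le_lt_trans (ler_normB _ _) _; rewrite /s in b1; lra.
  have -> : z.2 - w.2 = (z.2 + c * v2 - w.2) - c * v2 by ring.
  by apply: le_lt_trans (ler_normB _ _) _; rewrite /s in b2; lra.
have D1 c : dot (z.1 + c * v1, z.2 + c * v2) (uvec th) = t_ th + c * k.
  have -> : t_ th + c * k = dot z (uvec th) + c * (sin th ^+ 2 + cos th ^+ 2 - (cos th * cos th' + sin th * sin th')).
    by rewrite dz e1.
  by rewrite /dot /uvec /v1 /v2 /=; ring.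
have D2 c : dot (z.1 + c * v1, z.2 + c * v2) (uvec th') = dot z (uvec th') - c * k.
  have -> : c * k = c * (sin th' ^+ 2 + cos th' ^+ 2 - (cos th * cos th' + sin th * sin th')) by rewrite e2.
  by rewrite /dot /uvec /v1 /v2 /=; ring.
have sk : 0 < s * k by exact: mulr_gt0.
have := up _ (near s ltac:(by rewrite gtr0_norm)); rewrite D1 D2 ltrDl sk => /(_ isT) h1.
have := dn _ (near (- s) ltac:(by rewrite normrN gtr0_norm)); rewrite D1 D2 mulNr gtrBl sk opprK => /(_ isT) h2.
exfalso; move: h1 h2 sk; move: (dot z _) (t_ th') (s * k) => a b d; lra.
Qed.

(* Bathtub principle. *)
Lemma fcen_min th th' : dot (fcen th) (uvec th) <= dot (fcen th') (uvec th) /\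
  (dot (fcen th) (uvec th) = dot (fcen th') (uvec th) -> uvec th = uvec th').
Proof.
(* Subtracting [t_ th] makes the affine function vanish on the line; as all caps have area [delta],
   the comparison is unaffected. *)
pose p := cos th; pose q := sin th; pose r := - t_ th.
have E s : aint (fcap s) p q r = delta * (dot (fcen s) (uvec th) - t_ th).
  rewrite mulrBr dot_fcen [in LHS]aint_lin; last exact: bmset_fcap.
  rewrite [in RHS]aint_lin; last exact: bmset_fcap.
  by rewrite ar_fcap /p /q /r /uvec /=; ring.
have H : delta * (dot (fcen th') (uvec th) - t_ th) - delta * (dot (fcen th) (uvec th) - t_ th)
    = aint (fD th th') p q r - aint (fD th' th) p q r.
  exact: etrans (congr2 (fun a b => a - b) (esym (E th')) (esym (E th))) (aint_diff th th' p q r).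
have {}H : delta * (dot (fcen th') (uvec th) - dot (fcen th) (uvec th))
    = aint (fD th th') p q r - aint (fD th' th) p q r.
  apply: etrans H; rewrite -mulrBr; congr (delta * _).
  by rewrite opprB addrA subrK.
clear E.
have neg : aint (fD th' th) p q r <= 0.
  rewrite -[X in _ <= X](mul0r (ar (fD th' th))); apply: aint_le => // x /fDP [_ h _].
  move: h; rewrite /dot /uvec /= /p /q /r [cos th * _]mulrC [sin th * _]mulrC.
  by rewrite subr_le0.
have posf x : fD th th' x -> 0 < p * x.1 + q * x.2 + r.
  move=> /fDP [_ _]; rewrite /dot /uvec /= /p /q /r [cos th * _]mulrC [sin th * _]mulrC.
  by rewrite subr_gt0.
have pos : 0 <= aint (fD th th') p q r.
  by rewrite -[X in X <= _](mul0r (ar (fD th th'))); apply: aint_ge => // x /posf /ltW.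
have gen (a b u v : R) : delta * (v - u) = a - b -> b <= 0 -> 0 <= a ->
    u <= v /\ (u = v -> a <= 0).
  move=> e b0 a0; split; first by rewrite -subr_ge0 -(pmulr_rge0 _ delta0) e subr_ge0 (le_trans b0).
  by move=> uv; move: e; rewrite uv subrr mulr0 => /esym/eqP; rewrite subr_eq0 => /eqP ->.
have [g1 g2] := gen _ _ _ _ H neg pos; split; first exact: g1.
move=> e; have g3 := g2 e; clear gen H neg pos g1 g2 e.
apply: fcap_separate; apply/eqP; rewrite eq_le ar_ge0 andbT leNgt; apply/negP => a0.
have := aint_gt0 (bfD th th') a0 posf.
by apply/negP; rewrite -leNgt; exact: g3.
Qed.

(** The moments of two caps differ only by integrals over their set differences, whose area
    [cap_diff] controls. *)
Lemma fcen_dot_continuous (v : R * R) : continuous (fun th => dot (fcen th) v).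
Proof.
move=> th; have [C C0 hC] := cap_diff cK; have [D D0 hD] := body_bounded cK.
pose N := (`|v.1| + `|v.2|) * D + 1.
have N0 : 0 < N by rewrite /N ltr_wpDl // mulr_ge0 ?addr_ge0 // ltW.
have bnd a b : `|aint (fD a b) v.1 v.2 0| <= N * ar (fD a b).
  have hf x : fD a b x -> `|v.1 * x.1 + v.2 * x.2 + 0| <= N.
    move=> /fDP [/hD [h1 h2] _ _]; rewrite addr0 (le_trans (ler_normD _ _)) // !normrM.
    rewrite /N mulrDl -addrA; apply: lerD; first by rewrite ler_wpM2l.
    by rewrite (@le_trans _ _ (`|v.2| * D)) ?ler_wpM2l // lerDl.
  rewrite ler_norml -mulNr; apply/andP; split.
    by apply: aint_ge => // x /hf; rewrite ler_norml => /andP[].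
  by apply: aint_le => // x /hf; rewrite ler_norml => /andP[].
have key th' : `|dot (fcen th) v - dot (fcen th') v| <=
    2 * N * C / delta * (`|th - th'| + `|t_ th - t_ th'|).
  rewrite -(ler_pM2l delta0) -{1}(gtr0_norm delta0) -normrM mulrBr.
  have e : delta * dot (fcen th) v - delta * dot (fcen th') v =
      aint (fD th' th) v.1 v.2 0 - aint (fD th th') v.1 v.2 0.
    exact: etrans (congr2 (fun a b => a - b) (dot_fcen th v) (dot_fcen th' v)) (aint_diff th' th v.1 v.2 0).
  rewrite {}e; apply: le_trans (ler_normB _ _) _.
  have -> : delta * (2 * N * C / delta * (`|th - th'| + `|t_ th - t_ th'|)) =
    N * (C * (`|th - th'| + `|t_ th - t_ th'|)) + N * (C * (`|th - th'| + `|t_ th - t_ th'|)).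
    by field; rewrite gt_eqF.
  apply: lerD; apply: le_trans (bnd _ _) _; rewrite ler_pM2l //.
    by rewrite [`|th - _|]distrC [`|t_ th - _|]distrC; exact: hC.
  exact: hC.
pose B := 2 * N * C / delta.
have B0 : 0 < B by rewrite /B !divr_gt0 // !mulr_gt0.
apply/cvgrPdist_le => e e0.
have e2 : 0 < e / (2 * B) by rewrite divr_gt0 // mulr_gt0.
near=> th'.
apply: le_trans (key th') _; rewrite -/B -ler_pdivlMl // mulrC.
have -> : e / B = e / (2 * B) + e / (2 * B) by field; rewrite gt_eqF.
apply: lerD.
  by near: th'; apply: cvgr_dist_le; [exact: cvg_id|].
near: th'; apply: cvgr_dist_le => //; exact: flot_continuous.
Unshelve. all: by end_near.
Qed.

End Centroids.

(** * A Clairaut argument: an envelope whose points all lie on a strictly supported curve *)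

Section Clairaut.
Variable R : realType.

(** On a window with [M * h <= 2^-1] the mean value theorem bounds the maximum of [|D|] by half of
    itself. *)
Lemma gronwall0 (D dD : R -> R) (x0 eta M : R) : (forall x : R, is_derive x 1 D (dD x)) ->
  D x0 = 0 -> 0 < eta -> 0 < M ->
  (forall x, `|x - x0| < eta -> `|dD x| <= M * `|D x|) ->
  exists2 h, 0 < h & forall x, `|x - x0| < h -> D x = 0.
Proof.
move=> DD D0 eta0 M0 H; pose h := Num.min eta (2 * M)^-1 / 2.
have M2 : 0 < (2 * M)^-1 by rewrite invr_gt0 mulr_gt0.
have h0 : 0 < h by rewrite /h divr_gt0 // lt_min eta0 M2.
have he : h < eta.
  rewrite /h ltr_pdivrMr //; apply: (@le_lt_trans _ _ eta); last by lra.
  by rewrite ge_min lexx.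
have hM : M * h <= 2^-1.
  rewrite /h mulrA ler_pdivrMr //; apply: (@le_trans _ _ (M * (2 * M)^-1)).
    by rewrite ler_pM2l // ge_min lexx orbT.
  by rewrite invfM mulrCA divff ?gt_eqF //; lra.
have Dc : continuous D by move=> x; exact: is_derive_continuous (DD x).
have nc : {within `[x0 - h, x0 + h], continuous (fun x => `|D x|)}.
  apply: continuous_subspaceT => x; apply: (@continuous_comp _ _ _ D (fun y : R => `|y|)).
    exact: Dc.
  exact: norm_continuous.
have [|c ci cmax] := EVT_max _ nc; first by lra.
have win x : x \in `[x0 - h, x0 + h] -> `|x - x0| <= h.
  by rewrite in_itv /= => /andP[? ?]; rewrite ler_norml; apply/andP; split; lra.
have bound x : x \in `[x0 - h, x0 + h] -> `|D x| <= 2^-1 * `|D c|.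
  move=> xi; have xh := win _ xi.
  have [y yi ->] : exists2 y, y \in `[x0 - h, x0 + h] & `|D x| = `|dD y| * `|x - x0|.
    have [lt|gt|->] := ltgtP x x0.
    - have [y /andP[y1 y2] e] := mvt DD lt; exists y.
        by move: xi; rewrite !in_itv /= => /andP[? ?]; apply/andP; split; lra.
      by move: e; rewrite D0 sub0r => e; rewrite -normrN e normrM [`|x0 - x|]distrC.
    - have [y /andP[y1 y2] e] := mvt DD gt; exists y.
        by move: xi; rewrite !in_itv /= => /andP[? ?]; apply/andP; split; lra.
      by move: e; rewrite D0 subr0 => ->; rewrite normrM.
    - by exists x0; [rewrite in_itv /=; apply/andP; split; lra|rewrite D0 subrr !normr0 mulr0].
  have yh : `|y - x0| < eta by apply: le_lt_trans he; exact: win.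
  apply: (@le_trans _ _ (M * `|D c| * h)).
    apply: ler_pM => //; apply: le_trans (H _ yh) _.
    by rewrite ler_pM2l //; exact: cmax.
  by rewrite mulrAC ler_wpM2r.
have c0 : `|D c| = 0.
  by apply/eqP; rewrite eq_le normr_ge0 andbT; have := bound _ ci; lra.
exists h => // x; rewrite ltr_norml => /andP[x1 x2].
apply/eqP; rewrite -normr_eq0 eq_le normr_ge0 andbT -[X in _ <= X]c0; apply: cmax.
by rewrite in_itv /=; apply/andP; split; lra.
Qed.

Lemma cos_lt1_window (a : R) : 0 < a < pi *+ 2 -> cos a < 1.
Proof.
move=> /andP[a0 a1]; have := cos_max a; rewrite ler_norml => /andP[_ h].
rewrite lt_neqAle h andbT; apply/eqP => c.
have : sin (a / 2) = 0.
  have := cosD (a / 2) (a / 2); rewrite -splitr c -!expr2 cos2sin2 => e.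
  by apply/eqP; rewrite -sqrf_eq0; apply/eqP; lra.
have : 0 < sin (a / 2).
  by apply: sin_gt0_pi; apply/andP; split; move: a1; rewrite -mulr_natl; lra.
by move=> h0 e; move: h0; rewrite e ltxx.
Qed.

Lemma uvec_eq_cos (a b : R) : uvec a = uvec b -> cos (b - a) = 1.
Proof.
move=> [c s]; rewrite cosB -c -s -[RHS](sin2Dcos2 a); ring.
Qed.

Lemma detD (v : R * R) (a w : R) : det v (uvec (a + w)) =
  cos w * det v (uvec a) + sin w * dot v (uvec a).
Proof. by rewrite uvec_shift /det /dot /uvec /=; ring. Qed.

Variables (t : R -> R) (x y : R -> R * R).
Hypothesis xdot : forall th, dot (x th) (uvec th) = t th.
Hypothesis tD : forall th : R, is_derive th 1 t (- det (x th) (uvec th)).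
Hypothesis xc : forall v, continuous (fun th => dot (x th) v).
Hypothesis yc : forall v, continuous (fun th => dot (y th) v).
Hypothesis yper : forall th, y (th + pi *+ 2) = y th.
Hypothesis ymin : forall a b, dot (y a) (uvec a) <= dot (y b) (uvec a) /\
  (dot (y a) (uvec a) = dot (y b) (uvec a) -> uvec a = uvec b).
Hypothesis xy : forall th, exists ph, x th = y ph.
Hypothesis tneg : forall th, t th + t (th + pi) < 0.

Let p2 : (0 : R) < pi *+ 2.
Proof. by rewrite pmulrn_lgt0 // pi_gt0. Qed.

Lemma window (a : R) : exists k : int, 0 <= a + k%:~R * (pi *+ 2) < pi *+ 2.
Proof.
exists (- Num.floor (a / (pi *+ 2))); rewrite mulrNz mulNr.
have /andP[h1 h2] := floor_itv (a / (pi *+ 2)).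
rewrite subr_ge0 -ler_pdivlMr // h1 /= ltrBlDr -[X in X + _]mul1r -mulrDl.
by rewrite -ltr_pdivrMr // addrC; move: h2; rewrite intrD.
Qed.

Lemma yperz (k : int) a : y (a + k%:~R * (pi *+ 2)) = y a.
Proof.
have H (n : nat) v : y (v + n%:R * (pi *+ 2)) = y v.
  elim: n v => [|n IH] v; first by rewrite mul0r addr0.
  by rewrite -natr1 mulrDl mul1r addrA yper.
case: k => n; first exact: H.
rewrite NegzE mulrNz mulNr -[in RHS](subrK (n.+1%:R * (pi *+ 2)) a) H.
by rewrite pmulrn.
Qed.

Let dist a b := (dot (y a) (1, 0) - dot (y b) (1, 0)) ^+ 2 +
  (dot (y a) (0, 1) - dot (y b) (0, 1)) ^+ 2.

Let dist_ge0 a b : 0 <= dist a b.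
Proof. by rewrite addr_ge0 ?sqr_ge0. Qed.

Let dist_eq0 a b : dist a b = 0 -> y a = y b.
Proof.
move=> /eqP; rewrite paddr_eq0 ?sqr_ge0 // !sqrf_eq0 !subr_eq0 /dot /= !mulr0 !mulr1 !addr0 !add0r.
by move=> /andP[/eqP e1 /eqP e2]; rewrite [y a]surjective_pairing e1 e2 -surjective_pairing.
Qed.

Let dist_cont b : continuous (fun s => dist (b + s) b).
Proof.
have sh : continuous (fun s : R => b + s).
  by move=> s; apply: cvgD; [exact: cvg_cst|exact: cvg_id].
have c1 v : continuous (fun s => dot (y (b + s)) v - dot (y b) v).
  move=> s; apply: cvgB; last exact: cvg_cst.
  apply: (@cvg_comp _ _ _ (fun s : R => b + s) (fun a => dot (y a) v) _ _ _ (sh s)); exact: yc.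
pose f1 s := dot (y (b + s)) (1, 0) - dot (y b) (1, 0).
pose f2 s := dot (y (b + s)) (0, 1) - dot (y b) (0, 1).
have -> : (fun s => dist (b + s) b) = (fun s => f1 s * f1 s + f2 s * f2 s).
  by apply/funext => s; rewrite /dist !expr2.
by move=> s; apply: cvgD; apply: cvgM; exact: c1.
Qed.

(* Continuity of the inverse of [y] at [y b], from injectivity and compactness. *)
Let yinv b e : 0 < e -> exists2 eta, 0 < eta & forall a, dist a b < eta ->
  exists2 s, `|s| < e & y a = y (b + s).
Proof.
have pi0 := pi_gt0 R.
wlog : e / e <= pi => [W|epi] e0.
  have [le|gt] := leP e pi; first exact: W.
  have [eta eta0 H] := W pi (lexx _) pi0; exists eta => // a /H [s s1 s2].
  by exists s => //; apply: lt_trans gt.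
have pp : pi *+ 2 = pi + pi :> R by rewrite mulr2n.
have [|c] := @EVT_min R (fun s => dist (b + s) b) e (pi *+ 2 - e) _ (continuous_subspaceT (@dist_cont b)).
  by rewrite pp; lra.
rewrite in_itv /= => /andP[c1 c2] cmin.
have d0 : 0 < dist (b + c) b.
  rewrite lt_neqAle dist_ge0 andbT; apply/eqP => /esym/dist_eq0 ye.
  have := (ymin b (b + c)).2; rewrite ye => /(_ erefl)/uvec_eq_cos.
  rewrite addrAC subrr add0r => cc.
  by have := @cos_lt1_window c; rewrite cc ltxx pp => H; suff : false by []; apply: H; rewrite pp in c2; apply/andP; split; lra.
exists (dist (b + c) b) => // a da.
have [k /andP[h1 h2]] := window (a - b).
pose s := a - b + k%:~R * (pi *+ 2).
have ya : y a = y (b + s) by rewrite /s addrA [b + _]addrC subrK yperz.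
have [se|se] := ltP s e; first by exists s => //; rewrite ger0_norm.
have [sf|sf] := ltP (pi *+ 2 - e) s.
  exists (s - pi *+ 2); first by rewrite ltr_norml -/s in h1 h2 *; apply/andP; split; lra.
  by rewrite ya -[RHS]yper; congr y; rewrite -addrA subrK.
have : s \in `[e, pi *+ 2 - e] by rewrite in_itv /= se sf.
move=> /cmin; have -> : dist (b + s) b = dist a b by rewrite /dist ya.
by rewrite leNgt da.
Qed.

Let t_ge th : dot (y th) (uvec th) <= t th.
Proof. by have [ph e] := xy th; rewrite -xdot e; exact: (ymin th ph).1. Qed.

Let opp_dot (v : R * R) (th : R) : dot v (uvec (th + pi)) = - dot v (uvec th).
Proof. by rewrite uvecDpi /dot /uvec /=; ring. Qed.

(** The gap between the line at angle [th] and the fixed point [y ph]. It vanishes together with its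
    derivative [dD] exactly when [x th = y ph]. *)
Let D ph th := t th - dot (y ph) (uvec th).
Let dD ph th := - det (x th) (uvec th) + det (y ph) (uvec th).

Let DD ph (th : R) : is_derive th 1 (D ph) (dD ph th).
Proof.
have d1 : is_derive th 1 (fun w : R => (y ph).1 * cos w + (y ph).2 * sin w + 0)
    ((y ph).1 * (- sin th) + (y ph).2 * cos th) by exact: is_derive_lin.
have := is_derive_lin 1 (-1) 0 (tD th) d1.
have -> : (fun w => 1 * t w + -1 * ((y ph).1 * cos w + (y ph).2 * sin w + 0) + 0) = D ph.
  by apply/funext => w; rewrite /D /dot /uvec /=; ring.
suff -> : 1 * - det (x th) (uvec th) + -1 * ((y ph).1 * - sin th + (y ph).2 * cos th) = dD ph th by [].
by rewrite /dD /det /uvec /=; ring.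
Qed.

Let dD_cont ph : continuous (dD ph).
Proof.
have E th : dD ph th = (dot (y ph) (1, 0) - dot (x th) (1, 0)) * sin th
   - (dot (y ph) (0, 1) - dot (x th) (0, 1)) * cos th.
  by rewrite /dD /det /dot /uvec /=; ring.
have -> : dD ph = (fun th => (dot (y ph) (1, 0) - dot (x th) (1, 0)) * sin th
   - (dot (y ph) (0, 1) - dot (x th) (0, 1)) * cos th) by apply/funext.
move=> th; apply: cvgB; apply: cvgM.
- by apply: cvgB; [exact: cvg_cst|exact: xc].
- exact: continuous_sin.
- by apply: cvgB; [exact: cvg_cst|exact: xc].
- exact: continuous_cos.
Qed.

(* Near a transversal intersection the chords of [y] at [y ph] are almost
   parallel to the support line there, so [|D'| <= M |D|]. *)
Let D_local (ph th : R) : sin (th - ph) != 0 -> D ph th = 0 -> dD ph th = 0 ->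
  exists2 h, 0 < h & forall s, `|s - th| < h -> D ph s = 0.
Proof.
move=> sn D0 dD0; pose kap := `|sin (th - ph)| / 2.
have k0 : 0 < kap by rewrite divr_gt0 // normr_gt0.
have xth : x th = y ph.
  apply: (@uvec_inj _ th); first by rewrite xdot; move: D0; rewrite /D => /eqP; rewrite subr_eq0 => /eqP.
  by move: dD0; rewrite /dD addrC => /eqP; rewrite subr_eq0 => /eqP.
(* The bound [kap / 4] keeps the chord of [y] flat compared with the sine, which is at least [kap];
   the bound [2^-1] keeps [cos w] above one half. *)
pose e := Num.min (kap / 4) 2^-1.
have e0 : 0 < e by rewrite lt_min divr_gt0 // invr_gt0 ltr0n.
have [eta eta0 H] := yinv ph e0.
have m0 : 0 < Num.min 1 (eta / 2) by rewrite lt_min ltr01 divr_gt0.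
have xcn v : nbhs th [set s | `|dot (x th) v - dot (x s) v| < Num.min 1 (eta / 2)].
  by have /cvgrPdist_lt /(_ _ m0) := @xc v th.
have [r r0 hr] : exists2 r, 0 < r & forall s, `|s - th| < r ->
   `|dot (x th) (1, 0) - dot (x s) (1, 0)| < Num.min 1 (eta / 2) /\
   `|dot (x th) (0, 1) - dot (x s) (0, 1)| < Num.min 1 (eta / 2).
  have /nbhs_ballP [r1 /= r10 h1] : nbhs th [set s | `|dot (x th) (1, 0) - dot (x s) (1, 0)| < Num.min 1 (eta / 2)] by exact: xcn.
  have /nbhs_ballP [r2 /= r20 h2] : nbhs th [set s | `|dot (x th) (0, 1) - dot (x s) (0, 1)| < Num.min 1 (eta / 2)] by exact: xcn.
  exists (Num.min r1 r2); first by rewrite lt_min r10.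
  move=> s; rewrite lt_min => /andP[s1 s2].
  by split; [apply: h1|apply: h2]; rewrite /ball /= distrC.
have sq (a : R) : `|a| < Num.min 1 (eta / 2) -> a ^+ 2 < eta / 2.
  rewrite lt_min => /andP[a1 a2]; rewrite -real_normK ?num_real //.
  by apply: le_lt_trans a2; rewrite expr2 ler_piMl // ltW.
apply: (@gronwall0 (D ph) (dD ph) th (Num.min r kap) (4 / kap)) => //.
- by rewrite lt_min r0.
- by rewrite divr_gt0.
move=> s; rewrite lt_min => /andP[/hr [q1 q2] sk].
have [ps xs] := xy s.
have dst : dist ps ph < eta.
  rewrite /dist -xs -xth [_ - dot (x th) _](_ : _ = - (dot (x th) (1, 0) - dot (x s) (1, 0))); last by ring.
  rewrite [X in _ + X](_ : _ = (dot (x th) (0, 1) - dot (x s) (0, 1)) ^+ 2); last by ring.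
  by rewrite sqrrN; have := sq _ q1; have := sq _ q2; lra.
have [w we yw] := H _ dst.
have we1 : `|w| <= kap / 4 by apply: ltW; apply: lt_le_trans we _; rewrite ge_min lexx.
have we2 : `|w| <= 2^-1 by apply: ltW; apply: lt_le_trans we _; rewrite ge_min lexx orbT.
pose v : R * R := ((y (ph + w)).1 - (y ph).1, (y (ph + w)).2 - (y ph).2).
pose a := dot v (uvec ph); pose b := det v (uvec ph).
have a0 : 0 <= a.
  have := (ymin ph (ph + w)).1.
  have -> : a = dot (y (ph + w)) (uvec ph) - dot (y ph) (uvec ph) by rewrite /a /v /dot /=; ring.
  by rewrite subr_ge0.
have cw : 2^-1 <= cos w.
  by have := cos_lip w 0; rewrite cos0 subr0 ler_norml => /andP[]; lra.
(* Minimality at [ph] gives [0 <= a], minimality at [ph + w] gives [cos w * a <= sin w * b]: the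
   chord [v] is almost orthogonal to [uvec ph]. *)
have ab : a <= 2 * `|w| * `|b|.
  have := (ymin (ph + w) ph).1; rewrite -subr_ge0.
  have -> : dot (y ph) (uvec (ph + w)) - dot (y (ph + w)) (uvec (ph + w)) = sin w * b - cos w * a.
    by rewrite -[LHS]opprK opprB -[X in - X](_ : dot v (uvec (ph + w)) = _);
      [rewrite dot_uvecD -/a -/b; ring|rewrite /v /dot /=; ring].
  have h1 : sin w * b <= `|w| * `|b|.
    rewrite (le_trans (ler_norm _)) // normrM ler_wpM2r //.
    by have := sin_lip w 0; rewrite sin0 !subr0.
  have h2 : 2^-1 * a <= cos w * a by rewrite ler_wpM2r.
  by move=> h3; rewrite -mulrA; lra.
have E1 : D ph s = cos (s - ph) * a - sin (s - ph) * b.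
  have -> : D ph s = dot v (uvec (ph + (s - ph))).
    by rewrite [ph + _]addrC subrK /D -xdot xs yw /v /dot /=; ring.
  by rewrite dot_uvecD.
have E2 : dD ph s = - (cos (s - ph) * b + sin (s - ph) * a).
  have -> : dD ph s = - det v (uvec (ph + (s - ph))).
    by rewrite [ph + _]addrC subrK /dD xs yw /v /det /=; ring.
  by rewrite detD.
have b0 := normr_ge0 b.
have wb : 2 * `|w| * `|b| <= kap / 2 * `|b| by rewrite ler_wpM2r //; lra.
have ka : kap <= 2^-1 by rewrite /kap; have := sin_max (th - ph); lra.
have kb : kap / 2 * `|b| <= `|b| by rewrite ler_piMl //; lra.
have ssn : kap <= `|sin (s - ph)|.
  have h1 := sin_lip (th - ph) (s - ph).
  have h2 : `|th - ph - (s - ph)| = `|s - th| by rewrite -normrN; congr `| _ |; ring.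
  have h3 := ler_normB (sin (th - ph)) (sin (s - ph)).
  have h4 : `|sin (th - ph)| - `|sin (s - ph)| <= `|sin (th - ph) - sin (s - ph)|.
    exact: lerB_dist.
  have h5 : `|sin (th - ph)| = kap + kap by rewrite /kap; field.
  by rewrite h2 in h1; lra.
have up : `|dD ph s| <= 2 * `|b|.
  rewrite E2 normrN (le_trans (ler_normD _ _)) // !normrM (ger0_norm a0).
  have h1 : `|cos (s - ph)| * `|b| <= `|b| by rewrite ler_piMl // cos_max.
  have h2 : `|sin (s - ph)| * a <= a by rewrite ler_piMl // sin_max.
  by lra.
have lo : kap / 2 * `|b| <= `|D ph s|.
  have h1 := lerB_dist (sin (s - ph) * b) (cos (s - ph) * a).
  have h2 : `|D ph s| = `|sin (s - ph) * b - cos (s - ph) * a| by rewrite E1 distrC.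
  have h3 : `|cos (s - ph) * a| <= a by rewrite normrM (ger0_norm a0) ler_piMl // cos_max.
  have h4 : kap * `|b| <= `|sin (s - ph) * b| by rewrite normrM ler_wpM2r.
  have h5 : kap * `|b| = kap / 2 * `|b| + kap / 2 * `|b| by field.
  by rewrite h2; lra.
apply: le_trans up _.
(* The constant [4 / kap] is the quotient of the upper bound [2 * |b|] for [dD] and the lower bound
   [kap / 2 * |b|] for [D]. *)
have -> : 2 * `|b| = 4 / kap * (kap / 2 * `|b|) by field; rewrite gt_eqF.
by rewrite ler_wpM2l // divr_ge0 // ltW.
Qed.

(** The common zeros of [D ph] and [dD ph] form a closed set, which [D_local] makes open where the
    sine does not vanish; connectedness spreads them over the interval, and continuity reaches its
    ends. *)
Let D_itv (ph a b th : R) : a < th < b -> (forall s, a < s < b -> sin (s - ph) != 0) ->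
  D ph th = 0 -> dD ph th = 0 -> D ph a = 0 /\ D ph b = 0.
Proof.
move=> /andP[ath thb] sn D0 dD0.
pose Z := [set s | D ph s = 0 /\ dD ph s = 0].
have DC : continuous (D ph) by move=> s; exact: is_derive_continuous (DD ph s).
have cZ : closed Z.
  have c0 : closed [set s : R | s = 0] by exact: closed_eq.
  have c1 : closed [set s | D ph s = 0] by move/continuous_closedP: (DC) => /(_ _ c0).
  have c2 : closed [set s | dD ph s = 0] by move/continuous_closedP: (@dD_cont ph) => /(_ _ c0).
  exact: closedI c1 c2.
have oZ s : `]a, b[%classic s -> Z s -> interior Z s.
  rewrite /= in_itv /= => hs [z1 z2].
  have [h h0 H] := D_local (sn _ hs) z1 z2.
  apply/nbhs_ballP; exists h => //= w; rewrite /ball /= distrC => hw.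
  split; first exact: H.
  have w1 : is_derive w 1 (D ph) 0.
    apply/is_deriveP => e e0; exists (h - `|w - s|); first by rewrite subr_gt0.
    move=> d hd; rewrite (H w) // H; last first.
      have -> : w + d - s = (w - s) + d by ring.
      by apply: le_lt_trans (ler_normD _ _) _; rewrite -ltrBrDl.
    by rewrite subrr mulr0 subrr normr0 mulr_ge0 // ltW.
  by have [_ <-] := DD ph w; have [_ ->] := w1.
have conn : connected (`]a, b[%classic : set R) by apply/connected_intervalP; exact: interval_is_interval.
have ZA : `]a, b[%classic `&` Z = `]a, b[%classic.
  apply: conn.
  - by exists th; split; [rewrite /= in_itv /= ath|].
  - exists (interior Z); first exact: open_interior.
    apply/seteqP; split => s [s1 s2]; split => //; first exact: oZ.
    exact: interior_subset s2.
  - by exists Z.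
have inZ s : a < s < b -> D ph s = 0.
  by move=> hs; have : `]a, b[%classic s; [rewrite /= in_itv|rewrite -ZA => -[_ []]].
have lim c : a <= c <= b -> D ph c = 0.
  move=> /andP[ac cb]; apply: contrapT => /eqP nz.
  have /nbhs_ballP [r /= r0 hr] : nbhs c [set s | D ph s != 0].
    have n0 : 0 < `|D ph c| by rewrite normr_gt0.
    have /cvgrPdist_lt /(_ _ n0) := DC c; apply: filterS => s h; apply/eqP => e.
    by move: h; rewrite e subr0 ltxx.
  pose m := (a + b) / 2.
  pose q := Num.min 1 (r / (`|m - c| + 1)).
  (* A point of the open interval, moved from [c] towards the middle by less than [r]. *)
  pose s := c + (m - c) * (q / 2).
  have q0 : 0 < q by rewrite lt_min ltr01 divr_gt0 // ltr_wpDl.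
  have q1 : q <= 1 by rewrite ge_min lexx.
  have q2 : q <= r / (`|m - c| + 1) by rewrite ge_min lexx orbT.
  have sab : a < s < b.
    have -> : s = c * (1 - q / 2) + m * (q / 2) by rewrite /s; ring.
    have e1 : 0 < (c - a) * (1 - q / 2) + (m - a) * (q / 2).
      by rewrite ltr_wpDl // ?mulr_ge0 ?mulr_gt0 //; rewrite /m; lra.
    have e2 : 0 < (b - c) * (1 - q / 2) + (b - m) * (q / 2).
      by rewrite ltr_wpDl // ?mulr_ge0 ?mulr_gt0 //; rewrite /m; lra.
    by apply/andP; split; lra.
  suff bs : ball c r s by have := hr s bs; rewrite /= inZ // eqxx.
  have q20 : 0 < q / 2 by rewrite divr_gt0.
  rewrite /ball /= /s opprD addNKr normrN normrM (gtr0_norm q20).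
  have n0 := normr_ge0 (m - c).
  apply: (@le_lt_trans _ _ (`|m - c| * (r / (`|m - c| + 1) / 2))).
    by rewrite ler_wpM2l // ler_pM2r // invr_gt0 ltr0n.
  rewrite mulrA mulrA ltr_pdivrMr // ltr_pdivrMr; last by rewrite ltr_wpDl.
  have := mulr_ge0 n0 (ltW r0); lra.
by split; apply: lim; rewrite ?lexx //= ltW // (lt_trans ath).
Qed.

(** If the parameter [ph] with [x th = y ph] were not [th] modulo a full turn, then all lines over
    an open half-turn bounded by [ph - pi] would pass through [y ph], or [th] would itself be
    opposite to [ph]. In either case the line opposite to [ph] contains [y ph]. *)
Lemma envelope_is_min th : x th = y th.
Proof.
have pi0 := pi_gt0 R; have pp : pi *+ 2 = pi + pi :> R by rewrite mulr2n.
have [ph0 xe] := xy th.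
have [k /andP[h1 h2]] := window (ph0 - th).
pose ph := ph0 + k%:~R * (pi *+ 2).
have {xe} xe : x th = y ph by rewrite xe /ph yperz.
have {}h1 : th <= ph by rewrite /ph; lra.
have {}h2 : ph < th + (pi + pi) by rewrite /ph -pp; lra.
clearbody ph.
have D0 : D ph th = 0 by rewrite /D -xdot xe subrr.
have dD0 : dD ph th = 0 by rewrite /dD xe addNr.
(* If the line opposite to [ph] contained [y ph], then [t_ge] at [ph] would make [t ph] plus the
   opposite value non-negative, against [tneg]. *)
have fin s : s = ph + pi \/ s = ph - pi -> D ph s = 0 -> False.
  move=> hs; rewrite /D => /eqP; rewrite subr_eq0 => /eqP ts.
  have e1 : t s = - dot (y ph) (uvec ph).
    rewrite ts; case: hs => ->; first exact: opp_dot.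
    have e : dot (y ph) (uvec ph) = dot (y ph) (uvec (ph - pi + pi)) by rewrite subrK.
    by rewrite e opp_dot opprK.
  have := t_ge ph; case: hs => hs.
    by have := tneg ph; rewrite -hs e1 subr_lt0 ltNge => /negP.
  have e2 : s + pi = ph by rewrite hs subrK.
  by have := tneg s; rewrite e2 e1 addrC subr_lt0 ltNge => /negP.
have [e|lt] := eqVneq th ph; first by rewrite xe -e.
have {h1} lt1 : th < ph by rewrite lt_neqAle lt.
have [e|ne] := eqVneq ph (th + pi).
  by exfalso; apply: (@fin th) => //; right; rewrite e addrK.
have [c|c] := ltP ph (th + pi).
  exfalso; have [] := @D_itv ph (ph - pi) ph th _ _ D0 dD0.
  - by apply/andP; split; lra.
  - move=> s /andP[s1 s2]; rewrite -[s - ph]opprK sinN oppr_eq0 gt_eqF //.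
    by apply: sin_gt0_pi; apply/andP; split; lra.
  - by move=> + _; apply: fin; right.
have {c ne} c : th + pi < ph by rewrite lt_neqAle eq_sym ne.
exfalso; have [] := @D_itv ph (ph - (pi + pi)) (ph - pi) th _ _ D0 dD0.
- by apply/andP; split; lra.
- move=> s /andP[s1 s2]; rewrite -sinD2pi gt_eqF // pp.
  by apply: sin_gt0_pi; apply/andP; split; lra.
- by move=> _; apply: fin; right.
Qed.

End Clairaut.

(** * Moments of a body split into three caps and a triangle *)

Section Triangles.
Variable R : realType.
Local Notation mR := (measurableTypeR R).
Implicit Types (a b c x : R * R).

(** The pairwise overlaps are null, so no correction terms appear. The half-planes will be those of
    three consecutive chords, and the remainder their triangle. *)
Lemma aint_three (K H1 H2 H3 : set (R * R)) p q r : bmset K ->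
  measurable (H1 : set (mR * mR)) -> measurable (H2 : set (mR * mR)) ->
  measurable (H3 : set (mR * mR)) ->
  ar (K `&` H1 `&` H2) = 0 -> ar (K `&` H1 `&` H3) = 0 -> ar (K `&` H2 `&` H3) = 0 ->
  aint K p q r = aint (K `&` H1) p q r + aint (K `&` H2) p q r + aint (K `&` H3) p q r
    + aint (K `\` H1 `\` H2 `\` H3) p q r.
Proof.
move=> bK m1 m2 m3 n12 n13 n23.
have null (A B : set (R * R)) : bmset A -> bmset B -> A `<=` B -> ar B = 0 -> aint A p q r = 0.
  move=> bA bB AB B0; apply: aint_null => //; apply/eqP.
  by rewrite eq_le ar_ge0 andbT -B0 ar_le.
have bI (H : set (R * R)) : measurable (H : set (mR * mR)) -> bmset (K `&` H) by move=> ?; exact: bmsetI.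
rewrite (aint_split p q r bK m1) (aint_split p q r (bmsetD bK m1) m2).
rewrite (aint_split p q r (bmsetD (bmsetD bK m1) m2) m3).
have e2 : aint (K `&` H2) p q r = aint ((K `\` H1) `&` H2) p q r.
  rewrite (aint_split p q r (bI _ m2) m1) (_ : K `&` H2 `\` H1 = (K `\` H1) `&` H2); last first.
    by apply/seteqP; split => x [[? ?] ?].
  rewrite (null _ (K `&` H1 `&` H2)) ?add0r //; [exact: bmsetI (bI _ m2) m1|exact: bmsetI (bI _ m1) m2|].
  by move=> x [[? ?] ?].
have e3 : aint (K `&` H3) p q r = aint ((K `\` H1 `\` H2) `&` H3) p q r.
  rewrite (aint_split p q r (bI _ m3) m1) (null _ (K `&` H1 `&` H3)) ?add0r //;
    [|exact: bmsetI (bI _ m3) m1|exact: bmsetI (bI _ m1) m3|by move=> x [[? ?] ?]].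
  rewrite (aint_split p q r (bmsetD (bI _ m3) m1) m2) (null _ (K `&` H2 `&` H3)) ?add0r //;
    [|exact: bmsetI (bmsetD (bI _ m3) m1) m2|exact: bmsetI (bI _ m2) m3|by move=> x [[[? ?] ?] ?]].
  by congr aint; apply/seteqP; split => x [[[? ?] ?] ?].
by rewrite e2 e3; ring.
Qed.

(* The affine map permuting the vertices cyclically preserves area and the
   triangle, so the first moment is its fixed point. *)
Lemma triangle_moment a b c (Tri : set (R * R)) :
  let T := (b.1 - a.1) * (c.2 - a.2) - (b.2 - a.2) * (c.1 - a.1) in
  let la x := ((c.1 - b.1) * (x.2 - b.2) - (c.2 - b.2) * (x.1 - b.1)) / T in
  let lb x := ((a.1 - c.1) * (x.2 - c.2) - (a.2 - c.2) * (x.1 - c.1)) / T in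
  let lc x := ((b.1 - a.1) * (x.2 - a.2) - (b.2 - a.2) * (x.1 - a.1)) / T in
  T != 0 -> bmset Tri -> (forall x, Tri x <-> [/\ 0 < la x, 0 < lb x & 0 < lc x]) ->
  aint Tri 1 0 0 = ar Tri * ((a.1 + b.1 + c.1) / 3) /\
  aint Tri 0 1 0 = ar Tri * ((a.2 + b.2 + c.2) / 3).
Proof.
case: a => a1 a2; case: b => b1 b2; case: c => c1 c2 /=.
set T := (b1 - a1) * (c2 - a2) - (b2 - a2) * (c1 - a1) => T0 bT hT.
have T1 : (b1 - a1) * (c2 - a2) - (b2 - a2) * (c1 - a1) != 0 by exact: T0.
pose A := - ((c2 - b2) * b1 + (a2 - c2) * c1 + (b2 - a2) * a1) / T.
pose B := ((c1 - b1) * b1 + (a1 - c1) * c1 + (b1 - a1) * a1) / T.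
pose C := - ((c2 - b2) * b2 + (a2 - c2) * c2 + (b2 - a2) * a2) / T.
pose D := ((c1 - b1) * b2 + (a1 - c1) * c2 + (b1 - a1) * a2) / T.
pose E := b1 - A * a1 - B * a2.
pose F := b2 - C * a1 - D * a2.
have det1 : A * D - B * C = 1 by rewrite /A /B /C /D /T; field.
(* The linear part has trace -1 and determinant 1, as a rotation of order three; hence the identity
   minus it has determinant 3, and the fixed point is unique. *)
have tr : A + D = -1 by rewrite /A /D /T; field.
have fix1 : A * ((a1 + b1 + c1) / 3) + B * ((a2 + b2 + c2) / 3) + E = (a1 + b1 + c1) / 3.
  by rewrite /E /A /B /T; field.
have fix2 : C * ((a1 + b1 + c1) / 3) + D * ((a2 + b2 + c2) / 3) + F = (a2 + b2 + c2) / 3.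
  by rewrite /F /C /D /T; field.
pose phi := affmap A B E C D F.
have pre : phi @^-1` Tri = Tri.
  have eb (x1 x2 : R) : ((a1 - c1) * ((phi (x1, x2)).2 - c2) - (a2 - c2) * ((phi (x1, x2)).1 - c1)) / T =
    ((c1 - b1) * (x2 - b2) - (c2 - b2) * (x1 - b1)) / T.
    by rewrite /phi /affmap /= /E /F /A /B /C /D /T; field.
  have ec (x1 x2 : R) : ((b1 - a1) * ((phi (x1, x2)).2 - a2) - (b2 - a2) * ((phi (x1, x2)).1 - a1)) / T =
    ((a1 - c1) * (x2 - c2) - (a2 - c2) * (x1 - c1)) / T.
    by rewrite /phi /affmap /= /E /F /A /B /C /D /T; field.
  have ea (x1 x2 : R) : ((c1 - b1) * ((phi (x1, x2)).2 - b2) - (c2 - b2) * ((phi (x1, x2)).1 - b1)) / T =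
    ((b1 - a1) * (x2 - a2) - (b2 - a2) * (x1 - a1)) / T.
    by rewrite /phi /affmap /= /E /F /A /B /C /D /T; field.
  apply/seteqP; split => -[x1 x2].
    by move=> /hT []; rewrite ea eb ec => h1 h2 h3; apply/hT.
  by move=> /hT [/= h1 h2 h3]; apply/hT; rewrite ea eb ec.
have bp : bmset (phi @^-1` Tri) by rewrite pre.
have i1 := @affmap_aint R A B E C D F Tri 1 0 0 det1 bT bp.
have i2 := @affmap_aint R A B E C D F Tri 0 1 0 det1 bT bp.
rewrite -/phi pre in i1 i2.
have j1 := etrans (esym (aint_lin _ _ _ bT)) i1.
have j2 := etrans (esym (aint_lin _ _ _ bT)) i2.
move: j1 j2; set m1 := aint Tri 1 0 0; set m2 := aint Tri 0 1 0; set s := ar Tri.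
clear i1 i2 bp pre bT hT; clearbody A B C D E F m1 m2 s => j1 j2.
move: fix1 fix2; set G1 := (a1 + b1 + c1) / 3; set G2 := (a2 + b2 + c2) / 3.
clearbody G1 G2 => fix1 fix2.
have h1 : s * (A * G1 + B * G2 + E) = s * G1 by rewrite fix1.
have h2 : s * (C * G1 + D * G2 + F) = s * G2 by rewrite fix2.
have w1 : (1 - A) * (m1 - s * G1) = B * (m2 - s * G2) by lra.
have w2 : (1 - D) * (m2 - s * G2) = C * (m1 - s * G1) by lra.
have k3 : (1 - A) * (1 - D) - B * C = 3.
  have -> : (1 - A) * (1 - D) - B * C = 1 - (A + D) + (A * D - B * C) by ring.
  by rewrite tr det1; lra.
have z1 : 3 * (m1 - s * G1) = 0.
  rewrite -k3; have -> : ((1 - A) * (1 - D) - B * C) * (m1 - s * G1) =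
    (1 - D) * ((1 - A) * (m1 - s * G1)) - B * (C * (m1 - s * G1)) by ring.
  by rewrite w1 -w2; ring.
have z2 : 3 * (m2 - s * G2) = 0.
  rewrite -k3; have -> : ((1 - A) * (1 - D) - B * C) * (m2 - s * G2) =
    (1 - A) * ((1 - D) * (m2 - s * G2)) - C * (B * (m2 - s * G2)) by ring.
  by rewrite w2 -w1; ring.
by split; lra.
Qed.

(** The upper bound is twice the true area, since a bounding box is enough: it serves only to keep
    [|T|] away from zero uniformly. The chart [psi] preserves area and has coordinates [T * lb] and
    [lc]. *)
Lemma triangle_area_bounds a b c (sigma : R) (Tri : set (R * R)) :
  let T := (b.1 - a.1) * (c.2 - a.2) - (b.2 - a.2) * (c.1 - a.1) in
  let la x := ((c.1 - b.1) * (x.2 - b.2) - (c.2 - b.2) * (x.1 - b.1)) / T in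
  let lb x := ((a.1 - c.1) * (x.2 - c.2) - (a.2 - c.2) * (x.1 - c.1)) / T in
  let lc x := ((b.1 - a.1) * (x.2 - a.2) - (b.2 - a.2) * (x.1 - a.1)) / T in
  sigma ^+ 2 = 1 -> 0 < sigma * T -> bmset Tri ->
  (forall x, Tri x <-> [/\ 0 < la x, 0 < lb x & 0 < lc x]) ->
  0 < ar Tri <= sigma * T.
Proof.
case: a => a1 a2; case: b => b1 b2; case: c => c1 c2 /=.
set T := (b1 - a1) * (c2 - a2) - (b2 - a2) * (c1 - a1) => s2 T0 bT hT.
have Tn : T != 0 by apply: contraTneq T0 => ->; rewrite mulr0 ltxx.
have T1 : (b1 - a1) * (c2 - a2) - (b2 - a2) * (c1 - a1) != 0 by exact: Tn.
pose e1 := b1 - a1; pose e2 := b2 - a2; pose f1 := c1 - a1; pose f2 := c2 - a2.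
pose psi := affmap f2 (- f1) (f1 * a2 - f2 * a1) (- e2 / T) (e1 / T) ((e2 * a1 - e1 * a2) / T).
have det1 : f2 * (e1 / T) - (- f1) * (- e2 / T) = 1 by rewrite /f1 /f2 /e1 /e2 /T; field.
have lbE (x1 x2 : R) : ((a1 - c1) * (x2 - c2) - (a2 - c2) * (x1 - c1)) / T = (psi (x1, x2)).1 / T.
  by rewrite /psi /affmap /= /f1 /f2 /e1 /e2 /T; field.
have lcE (x1 x2 : R) : ((b1 - a1) * (x2 - a2) - (b2 - a2) * (x1 - a1)) / T = (psi (x1, x2)).2.
  by rewrite /psi /affmap /= /f1 /f2 /e1 /e2 /T; field.
have laE (x1 x2 : R) : ((c1 - b1) * (x2 - b2) - (c2 - b2) * (x1 - b1)) / T =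
    1 - (psi (x1, x2)).1 / T - (psi (x1, x2)).2.
  by rewrite /psi /affmap /= /f1 /f2 /e1 /e2 /T; field.
have inv1 (x1 x2 : R) : x1 = a1 + (psi (x1, x2)).1 / T * e1 + (psi (x1, x2)).2 * f1.
  by rewrite /psi /affmap /= /f1 /f2 /e1 /e2 /T; field.
have inv2 (x1 x2 : R) : x2 = a2 + (psi (x1, x2)).1 / T * e2 + (psi (x1, x2)).2 * f2.
  by rewrite /psi /affmap /= /f1 /f2 /e1 /e2 /T; field.
pose tau := sigma * T.
have quo (x : R) : x / T = (sigma * x) / tau.
  rewrite /tau invfM mulrACA divff ?mul1r //.
  by apply: contraTneq T0 => ->; rewrite mul0r ltxx.
have t0 : 0 < tau by exact: T0.
have sT : sigma * tau = T by rewrite /tau mulrA -expr2 s2 mul1r.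
have sg : sigma = 1 \/ sigma = -1.
  by move/eqP: s2; rewrite sqrf_eq1 => /orP[] /eqP ->; [left|right].
have itvP (x m k : R) : sigma * m - k <= x <= sigma * m + k <-> m - k <= sigma * x <= m + k.
  by case: sg => ->; split => /andP[h1 h2]; apply/andP; split; lra.
pose box (m1 k1 m2 k2 : R) : set (R * R) :=
  `[sigma * m1 - k1, sigma * m1 + k1]%classic `*` `[m2 - k2, m2 + k2]%classic.
have boxP m1 k1 m2 k2 (x1 x2 : R) : (psi @^-1` box m1 k1 m2 k2) (x1, x2) <->
   (m1 - k1 <= sigma * (psi (x1, x2)).1 <= m1 + k1) /\ (m2 - k2 <= (psi (x1, x2)).2 <= m2 + k2).
  by rewrite /box /= !in_itv /=; split => -[h1 h2]; split => //; apply/itvP.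
have mbox m1 k1 m2 k2 : measurable (box m1 k1 m2 k2 : set (mR * mR)).
  by apply: measurableX; exact: measurable_itv.
have mpre m1 k1 m2 k2 : measurable (psi @^-1` box m1 k1 m2 k2 : set (mR * mR)).
  exact: measurable_pre (measurable_affmap _ _ _ _ _ _) (mbox _ _ _ _).
have area m1 k1 m2 k2 : 0 <= k1 -> 0 <= k2 -> ar (psi @^-1` box m1 k1 m2 k2) = (k1 *+ 2) * (k2 *+ 2).
  move=> h1 h2; rewrite affmap_ar // /box ar_box; [|lra|lra].
  by rewrite !mulr2n; congr (_ * _); ring.
apply/andP; split.
  apply: (@lt_le_trans _ _ (tau / 16)); first by lra.
  (* In this box [lb] and [lc] lie between 1/8 and 3/8, so [la] is at least 1/4. *)
  rewrite -(_ : ar (psi @^-1` box (tau / 4) (tau / 8) (1 / 4) (1 / 8)) = tau / 16); last first.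
    by rewrite area ?mulr2n; [field|lra|lra].
  have sub : psi @^-1` box (tau / 4) (tau / 8) (1 / 4) (1 / 8) `<=` Tri.
    move=> [x1 x2] /boxP [/andP[h1 h2] /andP[h3 h4]]; apply/hT => /=; rewrite laE lbE lcE quo.
    have k1 : 1 / 8 <= sigma * (psi (x1, x2)).1 / tau by rewrite ler_pdivlMr //; lra.
    have k2 : sigma * (psi (x1, x2)).1 / tau <= 3 / 8 by rewrite ler_pdivrMr //; lra.
    by split; lra.
  by apply: ar_le => //; exact: bmset_sub bT (mpre _ _ _ _) sub.
pose B := psi @^-1` box (tau / 2) (tau / 2) (1 / 2) (1 / 2).
have bB : bmset B.
  split; first exact: mpre.
  exists (`|a1| + `|a2| + (`|e1| + `|e2|) + (`|f1| + `|f2|)) => -[x1 x2] /boxP [/andP[h1 h2] /andP[h3 h4]] /=.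
  have k1 : 0 <= sigma * (psi (x1, x2)).1 / tau by rewrite ler_pdivlMr //; lra.
  have k2 : sigma * (psi (x1, x2)).1 / tau <= 1 by rewrite ler_pdivrMr //; lra.
  rewrite -quo in k1 k2.
  have bnd (a s e r f : R) : 0 <= s -> s <= 1 -> 0 <= r -> r <= 1 -> `|a + s * e + r * f| <= `|a| + `|e| + `|f|.
    move=> s0 s1 r0 r1; apply: le_trans (ler_normD _ _) _; apply: lerD.
      by apply: le_trans (ler_normD _ _) _; rewrite lerD2l normrM ger0_norm // ler_piMl.
    by rewrite normrM ger0_norm // ler_piMl.
  have r0 : 0 <= (psi (x1, x2)).2 by lra.
  have r1 : (psi (x1, x2)).2 <= 1 by lra.
  have H1 := bnd a1 _ e1 _ f1 k1 k2 r0 r1; have H2 := bnd a2 _ e2 _ f2 k1 k2 r0 r1.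
  rewrite -(inv1 x1 x2) in H1; rewrite -(inv2 x1 x2) in H2.
  have n1 := normr_ge0 a1; have n2 := normr_ge0 a2; have n3 := normr_ge0 e1.
  have n4 := normr_ge0 e2; have n5 := normr_ge0 f1; have n6 := normr_ge0 f2.
  by split; [apply: le_trans H1 _|apply: le_trans H2 _]; lra.
have sub : Tri `<=` B.
  move=> [x1 x2] /hT /= []; rewrite laE lbE lcE quo => l1 l2 l3; apply/boxP.
  have k1 : 0 < sigma * (psi (x1, x2)).1 by move: l2; rewrite pmulr_lgt0 ?invr_gt0.
  have k2 : sigma * (psi (x1, x2)).1 / tau < 1 by lra.
  rewrite ltr_pdivrMr // mul1r in k2.
  have k3 : 0 < sigma * (psi (x1, x2)).1 / tau by exact: l2.
  by split; apply/andP; split; lra.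
apply: le_trans (ar_le bT bB sub) _.
rewrite /B area; [|by rewrite divr_ge0 // ltW|by rewrite divr_ge0].
by rewrite !mulr2n -/tau; have -> : (tau / 2 + tau / 2) * (1 / 2 + 1 / 2) = tau by field.
Qed.

End Triangles.

(** * Algebra of triangles that move with fixed centroid *)

Section Algebra.
Variable R : realType.

(* [z1], [z2], [z3] are the first order defects of the three tangency conditions. *)
Lemma steiner_variation (a1 a2 b1 b2 c1 c2 x1 x2 y1 y2 : R) :
  let T := (b1 - a1) * (c2 - a2) - (b2 - a2) * (c1 - a1) in
  let z1 := (c1 - b1) * x2 - (c2 - b2) * x1 in
  let z2 := (a1 - c1) * y2 - (a2 - c2) * y1 in
  let z3 := (b1 - a1) * (- x2 - y2) - (b2 - a2) * (- x1 - y1) in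
  [/\ T * (a1 * x1 + b1 * y1 + c1 * (- x1 - y1)) =
      z1 * (b1 - a1) * (c1 - a1) + z2 * (c1 - b1) * (a1 - b1) + z3 * (a1 - c1) * (b1 - c1),
     T * (a2 * x2 + b2 * y2 + c2 * (- x2 - y2)) =
      z1 * (b2 - a2) * (c2 - a2) + z2 * (c2 - b2) * (a2 - b2) + z3 * (a2 - c2) * (b2 - c2) &
     2 * T * (a1 * x2 + a2 * x1 + b1 * y2 + b2 * y1 + c1 * (- x2 - y2) + c2 * (- x1 - y1)) =
      2 * (z1 * ((b1 - a1) * (c2 - a2) + (b2 - a2) * (c1 - a1))
       + z2 * ((c1 - b1) * (a2 - b2) + (c2 - b2) * (a1 - b1))
       + z3 * ((a1 - c1) * (b2 - c2) + (a2 - c2) * (b1 - c1)))].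
Proof. by move=> T z1 z2 z3; rewrite /T /z1 /z2 /z3; split; ring. Qed.

(** The displacements add up to zero and are parallel to the opposite sides, which makes them the
    same multiple [k / T] of these sides. The last hypothesis, parallelism to the opposite side of
    the displaced triangle, then leaves only [2 * T * k ^+ 2 = 0]. *)
Lemma no_jump (a1 a2 b1 b2 c1 c2 x1 x2 y1 y2 : R) :
  (b1 - a1) * (c2 - a2) - (b2 - a2) * (c1 - a1) != 0 ->
  (c1 - b1) * x2 - (c2 - b2) * x1 = 0 ->
  (a1 - c1) * y2 - (a2 - c2) * y1 = 0 ->
  (b1 - a1) * (- x2 - y2) - (b2 - a2) * (- x1 - y1) = 0 ->
  (c1 + (- x1 - y1) - (b1 + y1)) * x2 - (c2 + (- x2 - y2) - (b2 + y2)) * x1 = 0 ->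
  x1 = 0 /\ x2 = 0.
Proof.
set T := (b1 - a1) * _ - _ => T0 z1 z2 z3 z4.
pose k := (b1 - a1) * x2 - (b2 - a2) * x1.
have e1 : T * x1 = k * (c1 - b1) - ((c1 - b1) * x2 - (c2 - b2) * x1) * (b1 - a1) by rewrite /T /k; ring.
have e2 : T * x2 = k * (c2 - b2) - ((c1 - b1) * x2 - (c2 - b2) * x1) * (b2 - a2) by rewrite /T /k; ring.
rewrite z1 mul0r subr0 in e1 e2.
pose n := (c1 - b1) * y2 - (c2 - b2) * y1.
have f1 : T * y1 = n * (a1 - c1) - ((a1 - c1) * y2 - (a2 - c2) * y1) * (c1 - b1) by rewrite /T /n; ring.
have f2 : T * y2 = n * (a2 - c2) - ((a1 - c1) * y2 - (a2 - c2) * y1) * (c2 - b2) by rewrite /T /n; ring.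
rewrite z2 mul0r subr0 in f1 f2.
have kn : k = n.
  apply: (mulfI T0).
  have H : T * ((b1 - a1) * (- x2 - y2) - (b2 - a2) * (- x1 - y1)) =
     (b1 - a1) * (- (T * x2) - T * y2) - (b2 - a2) * (- (T * x1) - T * y1) by ring.
  rewrite z3 mulr0 e1 e2 f1 f2 in H.
  have H2 : (b1 - a1) * (- (k * (c2 - b2)) - n * (a2 - c2)) - (b2 - a2) * (- (k * (c1 - b1)) - n * (a1 - c1))
     = T * n - T * k by rewrite /T; ring.
  have H3 : T * n - T * k = 0 by rewrite -H2 H; ring.
  by apply/esym/eqP; rewrite -subr_eq0 H3.
have : T ^+ 2 * ((c1 + (- x1 - y1) - (b1 + y1)) * x2 - (c2 + (- x2 - y2) - (b2 + y2)) * x1) =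
   T * ((c1 - b1) * (T * x2) - (c2 - b2) * (T * x1)) - (T * x1 + 2 * (T * y1)) * (T * x2) + (T * x2 + 2 * (T * y2)) * (T * x1) by ring.
rewrite z4 mulr0 e1 e2 f1 f2 -kn => H.
have kk : (2 * T) * (k * k) = 0 by rewrite [RHS]H /T; ring.
have k2 : k * k = 0.
  by move/eqP: kk; rewrite mulf_eq0 => /orP[|/eqP//]; rewrite mulf_eq0 (negPf T0) orbF pnatr_eq0.
have k0 : k = 0 by move/eqP: k2; rewrite mulf_eq0 orbb => /eqP.
have d1 : T * x1 = 0 by rewrite e1 k0; ring.
have d2 : T * x2 = 0 by rewrite e2 k0; ring.
have x10 : x1 = T^-1 * (T * x1) by field.
have x20 : x2 = T^-1 * (T * x2) by field.
rewrite d1 mulr0 in x10; rewrite d2 mulr0 in x20.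
by split; [exact: x10|exact: x20].
Qed.

(** Cutting an interval where [s] takes the mean of its end values halves the constant [C], and
    iteration leaves zero. This replaces a vanishing derivative for an [f] not known to be
    differentiable. *)
Lemma quadratic_increment_const (f s : R -> R) (C : R) : continuous s ->
  (forall x y, x <= y -> `|f x - f y| <= C * (s y - s x) ^+ 2) -> forall x y, f x = f y.
Proof.
move=> sc H.
have half (B : R) : (forall x y, x <= y -> `|f x - f y| <= B * (s y - s x) ^+ 2) ->
    forall x y, x <= y -> `|f x - f y| <= B / 2 * (s y - s x) ^+ 2.
  move=> HB x y xy.
  have [|z] := @IVT R s x y ((s x + s y) / 2) xy (continuous_subspaceT sc).
    by rewrite ge_min le_max; have [h|h] := leP (s x) (s y); apply/andP; split; apply/orP;
      ((left; lra) || (right; lra)).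
  rewrite in_itv /= => /andP[xz zy] sz.
  have -> : f x - f y = (f x - f z) + (f z - f y) by ring.
  apply: le_trans (ler_normD _ _) _; apply: le_trans (lerD (HB _ _ xz) (HB _ _ zy)) _.
  by rewrite sz le_eqVlt; apply/orP; left; apply/eqP; field.
have pow n : forall x y, x <= y -> `|f x - f y| <= C / 2 ^+ n * (s y - s x) ^+ 2.
  elim: n => [|n IH]; first by rewrite expr0 divr1.
  move=> x y xy; have -> : C / 2 ^+ n.+1 = C / 2 ^+ n / 2 by rewrite exprSr invfM mulrA.
  exact: (half _ IH _ _ xy).
suff E x y : x <= y -> f x = f y.
  by move=> x y; have [/E//|/ltW/E ->] := leP x y.
move=> xy; apply/eqP; rewrite -subr_eq0 -normr_eq0 eq_le normr_ge0 andbT.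
apply/ler_addgt0Pl => e e0; rewrite addr0.
pose M := `|C| * (s y - s x) ^+ 2.
have M0 : 0 <= M by rewrite mulr_ge0 ?sqr_ge0.
have [n hn] : exists n : nat, M / e < n%:R.
  by exists (Num.bound (M / e)); rewrite archi_boundP // divr_ge0 // ltW.
apply: le_trans (pow n _ _ xy) _.
have n2 : n%:R <= 2 ^+ n :> R by rewrite -natrX ler_nat ltnW // ltn_expl.
have p0 : 0 < 2 ^+ n :> R by rewrite exprn_gt0.
have -> : C / 2 ^+ n * (s y - s x) ^+ 2 = C * (s y - s x) ^+ 2 / 2 ^+ n by rewrite mulrAC.
rewrite ler_pdivrMr //; apply: (@le_trans _ _ M).
  by rewrite /M ler_wpM2r ?sqr_ge0 // ler_norm.
rewrite mulrC -ler_pdivrMr //; apply: le_trans (ltW hn) n2.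
Qed.

End Algebra.

(** * One-sided derivatives, level sets, and the equation of the Steiner ellipse *)

Section OneSided.
Variable R : realType.

Lemma is_derive_opp (f : R -> R) (u l : R) : is_derive u 1 f l ->
  is_derive (- u) 1 (fun x => f (- x)) (- l).
Proof.
move=> h; apply/is_deriveP => e e0; have [r r0 hr] := (is_deriveP f u l).1 h e e0.
exists r => // k hk; have := hr (- k); rewrite normrN => /(_ hk).
by rewrite opprD opprK mulNr mulrN.
Qed.

Lemma sgn_cases (k : R) : k ^+ 2 = 1 -> k = 1 \/ k = -1.
Proof. by move/eqP; rewrite sqrf_eq1 => /orP[] /eqP ->; [left|right]. Qed.

(** The sign [k], which is 1 or -1, selects the side of [u]; it suffices that points where [f] is
    not larger accumulate at [u] from that side. *)
Lemma derive_acc (f : R -> R) (u l k : R) : is_derive u 1 f l -> k ^+ 2 = 1 ->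
  (forall e, 0 < e -> exists2 w, 0 < k * (w - u) < e & f w <= f u) -> k * l <= 0.
Proof.
move=> h k2 acc; rewrite leNgt; apply/negP => kl.
have kl2 : 0 < k * l / 2 by rewrite divr_gt0.
have [r r0 hr] := (is_deriveP f u l).1 h _ kl2.
have [w /andP[w1 w2] fw] := acc _ r0.
have nh : `|w - u| = k * (w - u).
  by move: w1; have [->|->] := sgn_cases k2 => w1; [rewrite gtr0_norm|rewrite ltr0_norm]; lra.
have := hr (w - u); rewrite nh => /(_ w2).
have -> : u + (w - u) = w by ring.
have -> : k * l / 2 * (k * (w - u)) = k ^+ 2 * ((w - u) * l) / 2 by field.
rewrite k2 mul1r ler_norml => /andP[h1 _].
have : 0 < (k * (w - u)) * (k * l) by rewrite mulr_gt0.
have -> : (k * (w - u)) * (k * l) = k ^+ 2 * ((w - u) * l) by ring.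
by rewrite k2 mul1r; move: h1 fw; move: ((w - u) * l) => z; lra.
Qed.

Lemma derive_right_le (f : R -> R) (u l b : R) : is_derive u 1 f l -> u < b ->
  (forall w, u <= w <= b -> f w <= f u) -> l <= 0.
Proof.
move=> h ub hf; rewrite -[l]mul1r; apply: (derive_acc h); first by rewrite expr1n.
move=> e e0; pose m := Num.min e (b - u).
have m0 : 0 < m by rewrite lt_min e0 subr_gt0.
have m1 : m <= e by rewrite ge_min lexx.
have m2 : m <= b - u by rewrite ge_min lexx orbT.
exists (u + m / 2); first by rewrite mul1r; apply/andP; split; lra.
by apply: hf; apply/andP; split; lra.
Qed.

Lemma pos_near (f : R -> R) (x : R) : {for x, continuous f} -> 0 < f x ->
  exists2 r, 0 < r & forall s, `|s - x| < r -> 0 < f s.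
Proof.
move=> fc fx; move/cvgrPdist_lt: fc => /(_ _ fx) /nbhs_ballP [r r0 hr].
exists r => // s hs; have := hr s; rewrite /ball /= distrC => /(_ hs).
by rewrite ltr_norml => /andP[_ ?]; lra.
Qed.

Lemma neg_near (f : R -> R) (x : R) : {for x, continuous f} -> f x < 0 ->
  exists2 r, 0 < r & forall s, `|s - x| < r -> f s < 0.
Proof.
move=> fc fx; have := @pos_near (fun s => - f s) x (continuousN fc); rewrite oppr_gt0 => /(_ fx) [r r0 hr].
by exists r => // s /hr; rewrite oppr_gt0.
Qed.

(** The zero is the last point up to [b] where [f <= 0]; beyond it [f] is positive, so the slope
    there cannot be negative. *)
Lemma cross_up (f df : R -> R) (a b : R) : (forall x : R, is_derive x 1 f (df x)) ->
  a < b -> f a <= 0 -> 0 < f b -> exists2 z, f z = 0 & 0 <= df z.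
Proof.
move=> fD ab fa fb.
have fc x : {for x, continuous f} := is_derive_continuous (fD x).
pose Z := [set s | a <= s <= b /\ f s <= 0].
have Za : Z a by split => //; rewrite lexx ltW.
have hs : has_sup Z by split; [exists a|exists b => s [/andP[]]].
pose z := sup Z.
have za : a <= z by exact: sup_upper_bound.
have zb : z <= b by apply: ge_sup; [exists a|move=> s [/andP[]]].
have above s : z < s -> s <= b -> 0 < f s.
  move=> zs sb; rewrite ltNge; apply/negP => fs.
  suff : s <= z by rewrite leNgt zs.
  by apply: sup_upper_bound => //; split => //; rewrite sb andbT (le_trans za) // ltW.
have fz : f z = 0.
  have [lt|gt|//] := ltgtP (f z) 0.
  - have [r r0 hr] := neg_near (fc z) lt.
    have zb' : z < b by rewrite lt_neqAle zb andbT; apply/eqP => e; move: lt; rewrite e; lra.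
    pose m := Num.min r (b - z).
    have m0 : 0 < m by rewrite lt_min r0 subr_gt0.
    have m1 : m <= r by rewrite ge_min lexx.
    have m2 : m <= b - z by rewrite ge_min lexx orbT.
    have h1 : 0 < f (z + m / 2) by apply: above; lra.
    have h2 : f (z + m / 2) < 0.
      apply: hr; have -> : z + m / 2 - z = m / 2 by ring.
      by rewrite gtr0_norm; lra.
    by lra.
  - have [r r0 hr] := pos_near (fc z) gt.
    have [s Zs zs] := sup_adherent r0 hs.
    have sz : s <= z by exact: sup_upper_bound.
    have fs : 0 < f s by apply: hr; rewrite ler0_norm ?subr_le0 //; rewrite -/z in zs; lra.
    by case: Zs => _; lra.
exists z => //.
have zb' : z < b by rewrite lt_neqAle zb andbT; apply/eqP => e; move: fb; rewrite -e fz ltxx.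
suff : -1 * df z + 0 * df z <= 0 by lra.
apply: (derive_right_le (is_derive_lin (-1) 0 0 (fD z) (fD z)) zb') => w /andP[w1 w2]; rewrite !mul0r !addr0 !mulN1r lerN2 fz.
by have [->|ne] := eqVneq w z; [rewrite fz|rewrite ltW // above // lt_neqAle eq_sym ne].
Qed.

Lemma cross_down (f df : R -> R) (a b : R) : (forall x : R, is_derive x 1 f (df x)) ->
  b < a -> f a <= 0 -> 0 < f b -> exists2 z, f z = 0 & df z <= 0.
Proof.
move=> fD ba fa fb.
have fD' (x : R) : is_derive x 1 (fun s => f (- s)) (- df (- x)).
  by have := is_derive_opp (fD (- x)); rewrite opprK.
have [||| z fz dz] := cross_up (a := - a) (b := - b) fD'; rewrite ?opprK ?ltrN2 //.
by exists (- z) => //; lra.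
Qed.

Lemma level_max (f : R -> R) (s : R) : continuous f -> (forall x y, x <= y -> f x <= f y) ->
  (exists x, f x <= s) -> (exists y, s < f y) ->
  exists al, f al = s /\ forall x, al < x -> s < f x.
Proof.
move=> fc nd [x0 hx0] [y0 hy0].
pose Z := [set x | f x <= s].
have ub x : Z x -> x <= y0.
  move=> Zx; rewrite leNgt; apply/negP => lt; have := nd _ _ (ltW lt); rewrite /Z /= in Zx; lra.
have hs : has_sup Z by split; [exists x0|exists y0].
pose al := sup Z.
have above x : al < x -> s < f x.
  move=> lt; rewrite ltNge; apply/negP => le; suff : x <= al by rewrite leNgt lt.
  exact: sup_upper_bound.
have hc : {for al, continuous (fun x => f x - s)}.
  by apply: cvgB; [exact: fc|exact: cvg_cst].
exists al; split=> //.
have [lt|gt|//] := ltgtP (f al) s; exfalso.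
- have [|r r0 hr] := neg_near hc; first by rewrite subr_lt0.
  have h1 : s < f (al + r / 2) by apply: above; lra.
  have h2 : f (al + r / 2) - s < 0.
    apply: hr; have -> : al + r / 2 - al = r / 2 by ring.
    by rewrite gtr0_norm; lra.
  by lra.
- have [|r r0 hr] := pos_near hc; first by rewrite subr_gt0.
  have [x Zx xa] := sup_adherent r0 hs.
  have xz : x <= al by exact: sup_upper_bound.
  have : 0 < f x - s by apply: hr; rewrite ler0_norm ?subr_le0 //; rewrite -/al in xa; lra.
  by rewrite /Z /= in Zx; lra.
Qed.

Lemma lim_le0 (f : nat -> R) (l : R) : f @ \oo --> l -> (forall n, f n <= 0) -> l <= 0.
Proof.
move=> fl f0; rewrite -(cvg_lim (@Rhausdorff R) fl).
by apply: limr_le; [exact: cvgP fl|exact: nearW].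
Qed.

Lemma sum3_bound (z1 z2 z3 m1 m2 m3 n1 n2 n3 Z M : R) : `|z1| <= Z -> `|z2| <= Z -> `|z3| <= Z ->
  `|m1| <= M -> `|m2| <= M -> `|m3| <= M -> `|n1| <= M -> `|n2| <= M -> `|n3| <= M ->
  `|z1 * m1 * n1 + z2 * m2 * n2 + z3 * m3 * n3| <= 3 * (Z * M * M).
Proof.
move=> h1 h2 h3 k1 k2 k3 l1 l2 l3.
have one (z m n : R) : `|z| <= Z -> `|m| <= M -> `|n| <= M -> `|z * m * n| <= Z * M * M.
  by move=> a b c; rewrite !normrM; apply: ler_pM => //; try exact: mulr_ge0; try by apply: ler_pM.
have H1 := one _ _ _ h1 k1 l1; have H2 := one _ _ _ h2 k2 l2; have H3 := one _ _ _ h3 k3 l3.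
apply: le_trans (ler_normD _ _) _; apply: le_trans (lerD (ler_normD _ _) (lexx _)) _.
by lra.
Qed.

Lemma normB_le (x y M : R) : `|x| <= M -> `|y| <= M -> `|x - y| <= 2 * M.
Proof. by move=> h1 h2; apply: le_trans (ler_normB _ _) _; lra. Qed.

Lemma norm2_le (x y M : R) : `|x| <= M -> `|y| <= M -> `|x * y| <= M * M.
Proof. by move=> h1 h2; rewrite normrM; apply: ler_pM. Qed.

Lemma half_dist (A B A' B' e : R) : `|A - A'| < e -> `|B - B'| < e ->
  `|(A + B) / 2 - (A' + B') / 2| < e.
Proof.
by rewrite !ltr_norml => /andP[? ?] /andP[? ?]; apply/andP; split; lra.
Qed.

Lemma neg_gap (a t t' : R) : a - t <= 0 -> t + t' < 0 -> 0 < - a - t'.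
Proof. by lra. Qed.

Lemma opposite_le (t c a' b' c' : R) : t + t + c = a' + b' + c' -> t <= (a' + b') / 2 -> c' - c <= 0.
Proof. by lra. Qed.

Lemma homothety_min (lam c fa fb ya yb : R) : 0 < lam -> ya = c * (1 - lam) + lam * fa ->
  yb = c * (1 - lam) + lam * fb -> fa <= fb -> ya <= yb /\ (ya = yb -> fa = fb).
Proof.
move=> l0 -> -> h; split; first by rewrite lerD2l ler_pM2l.
by move=> /addrI/(mulfI (lt0r_neq0 l0)).
Qed.

Lemma sum_ge0_opp (x y d : R) : 0 <= x + y -> x <= d -> - d <= y.
Proof. by lra. Qed.

Lemma neg_half (x : R) : 0 < x -> 0 <= - x / 2 -> False.
Proof. by lra. Qed.

(** A common radius [q] for both ends of a chord, small enough for the two windows to stay apart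
    even modulo [L]. *)
Lemma chord_window (u v L r1 r2 : R) : 0 < r1 -> 0 < r2 -> u < v -> v < u + L -> exists q,
  [/\ [/\ u < u + q < v, u < v - q < v, v < u - q + L < u + L & v < v + q < u + L],
    u - q <= u + q, v - q <= v + q,
    (forall x, u - q <= x <= u + q -> `|x - u| < r1) /\
    (forall x, v - q <= x <= v + q -> `|x - v| < r2) &
    forall x y, u - q <= x <= u + q -> v - q <= y <= v + q -> 0 < y - x < L].
Proof.
move=> r10 r20 uv vL.
pose m := Num.min (Num.min r1 r2) (Num.min (v - u) (u + L - v)).
have m0 : 0 < m by rewrite !lt_min r10 r20 !subr_gt0 uv vL.
have m1 : m <= r1 by rewrite !ge_min lexx.
have m2 : m <= r2 by rewrite !ge_min lexx orbT.
have m3 : m <= v - u by rewrite !ge_min lexx !orbT.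
have m4 : m <= u + L - v by rewrite !ge_min lexx !orbT.
exists (m / 3); split; [by split; apply/andP; split; lra|lra|lra| |].
  by split => x /andP[? ?]; rewrite ltr_norml; apply/andP; split; lra.
by move=> x y /andP[? ?] /andP[? ?]; apply/andP; split; lra.
Qed.

(** With [rt] a square root of 3, the vectors [P] and [Q] are conjugate half-diameters of the
    Steiner ellipse of [a], [b], [c]. The sum of their squares and products is two thirds of the
    centred second moments, so every triangle with the same centroid and second moments has its
    vertices on this ellipse. *)
Lemma steiner_ellipse (a b c p q r : R * R) (rt : R) :
  rt ^+ 2 = 3 -> rt != 0 ->
  p.1 + q.1 + r.1 = a.1 + b.1 + c.1 -> p.2 + q.2 + r.2 = a.2 + b.2 + c.2 ->
  p.1 ^+ 2 + q.1 ^+ 2 + r.1 ^+ 2 = a.1 ^+ 2 + b.1 ^+ 2 + c.1 ^+ 2 ->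
  p.1 * p.2 + q.1 * q.2 + r.1 * r.2 = a.1 * a.2 + b.1 * b.2 + c.1 * c.2 ->
  p.2 ^+ 2 + q.2 ^+ 2 + r.2 ^+ 2 = a.2 ^+ 2 + b.2 ^+ 2 + c.2 ^+ 2 ->
  let G1 := (a.1 + b.1 + c.1) / 3 in let G2 := (a.2 + b.2 + c.2) / 3 in
  let P1 := a.1 - G1 in let P2 := a.2 - G2 in
  let Q1 := (b.1 - c.1) / rt in let Q2 := (b.2 - c.2) / rt in
  ((p.1 - G1) * Q2 - (p.2 - G2) * Q1) ^+ 2 + (P1 * (p.2 - G2) - P2 * (p.1 - G1)) ^+ 2 =
  (P1 * Q2 - Q1 * P2) ^+ 2.
Proof.
move=> rt2 rt0 e1 e2 m1 m2 m3 H1 H2 P1 P2 Q1 Q2.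
have r1 : r.1 = 3 * H1 - p.1 - q.1 by rewrite /H1; lra.
have r2 : r.2 = 3 * H2 - p.2 - q.2 by rewrite /H2; lra.
have qq (x y : R) : x / rt * (y / rt) = x * y / 3 by rewrite -rt2; field.
have A : P1 ^+ 2 + Q1 ^+ 2 = 2 / 3 * ((p.1 - H1) ^+ 2 + (q.1 - H1) ^+ 2 + (p.1 - H1 + (q.1 - H1)) ^+ 2).
  rewrite [Q1 ^+ 2]expr2 /Q1 qq.
  transitivity (2 / 3 * (a.1 ^+ 2 + b.1 ^+ 2 + c.1 ^+ 2 - 3 * H1 ^+ 2)); first by rewrite /P1 /H1; field.
  by rewrite -m1 r1; field.
have B : P1 * P2 + Q1 * Q2 = 2 / 3 * ((p.1 - H1) * (p.2 - H2) + (q.1 - H1) * (q.2 - H2) + (p.1 - H1 + (q.1 - H1)) * (p.2 - H2 + (q.2 - H2))).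
  rewrite /Q1 /Q2 qq.
  transitivity (2 / 3 * (a.1 * a.2 + b.1 * b.2 + c.1 * c.2 - 3 * H1 * H2)); first by rewrite /P1 /P2 /H1 /H2; field.
  by rewrite -m2 r1 r2; field.
have C : P2 ^+ 2 + Q2 ^+ 2 = 2 / 3 * ((p.2 - H2) ^+ 2 + (q.2 - H2) ^+ 2 + (p.2 - H2 + (q.2 - H2)) ^+ 2).
  rewrite [Q2 ^+ 2]expr2 /Q2 qq.
  transitivity (2 / 3 * (a.2 ^+ 2 + b.2 ^+ 2 + c.2 ^+ 2 - 3 * H2 ^+ 2)); first by rewrite /P2 /H2; field.
  by rewrite -m3 r2; field.
have L : ((p.1 - H1) * Q2 - (p.2 - H2) * Q1) ^+ 2 + (P1 * (p.2 - H2) - P2 * (p.1 - H1)) ^+ 2 =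
  (P2 ^+ 2 + Q2 ^+ 2) * (p.1 - H1) ^+ 2 - 2 * (P1 * P2 + Q1 * Q2) * (p.1 - H1) * (p.2 - H2) + (P1 ^+ 2 + Q1 ^+ 2) * (p.2 - H2) ^+ 2 by ring.
have -> : (P1 * Q2 - Q1 * P2) ^+ 2 = (P1 ^+ 2 + Q1 ^+ 2) * (P2 ^+ 2 + Q2 ^+ 2) - (P1 * P2 + Q1 * Q2) ^+ 2 by ring.
by rewrite L A B C; field.
Qed.

End OneSided.

(** * From closed triangles to strict growth of the affine length and constant second moments *)

Section Steiner.
Variables (R : realType) (g dg : R -> R * R) (S F : R -> R) (L Lam sigma s0 G1 G2 D N : R).
Variable CT : R -> R -> R -> Prop.
Hypothesis g1D : forall u : R, is_derive u 1 (fun w => (g w).1) (dg u).1.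
Hypothesis g2D : forall u : R, is_derive u 1 (fun w => (g w).2) (dg u).2.
Hypothesis gper : forall u, g (u + L) = g u.
Hypothesis dg0 : forall u, dg u != 0.
Hypothesis gD : forall u, `|(g u).1| <= D /\ `|(g u).2| <= D.
Hypothesis dgN : forall u, `|(dg u).1| <= N /\ `|(dg u).2| <= N.
Hypothesis SD : forall u : R, is_derive u 1 S (F u).
Hypothesis Snd : forall u v, u <= v -> S u <= S v.
Hypothesis Slow : forall s, exists x, S x <= s.
Hypothesis Shigh : forall s, exists x, s < S x.
Hypothesis Sper : forall u, S (u + L) = S u + Lam.
Hypothesis Finj : forall u x, F u != 0 -> S x = S u -> x = u.
Hypothesis s2 : sigma ^+ 2 = 1.
Hypothesis s00 : 0 < s0.
Hypothesis flat : forall al be, al < be -> (forall w, al <= w <= be -> F w = 0) ->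
  exists2 c, 0 < c & [/\ (g be).1 - (g al).1 = c * (dg al).1,
    (g be).2 - (g al).2 = c * (dg al).2 &
    exists2 d, 0 < d & (dg be).1 = d * (dg al).1 /\ (dg be).2 = d * (dg al).2].

(* [dt a b x y] is the determinant of the vectors [b - a] and [y - x]. *)
Definition dt (a b x y : R * R) : R := (b.1 - a.1) * (y.2 - x.2) - (b.2 - a.2) * (y.1 - x.1).

Hypothesis CT_rot : forall u v w, CT u v w -> CT v w (u + L).
Hypothesis CT_S : forall u v w, CT u v w -> S v = S u + Lam / 3 /\ S w = S u + Lam / 3 + Lam / 3.
Hypothesis CT_sum : forall u v w, CT u v w ->
  (g u).1 + (g v).1 + (g w).1 = G1 /\ (g u).2 + (g v).2 + (g w).2 = G2.
Hypothesis CT_opp : forall u v w u' v' w', CT u v w -> CT u' v' w' ->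
  sigma * dt (g u) (g v) (g w) (g w') <= 0.
Hypothesis CT_T : forall u v w, CT u v w -> s0 <= sigma * dt (g u) (g v) (g u) (g w).
Hypothesis CT_ex : forall u, (forall x, S x = S u -> x = u) -> exists v w, CT u v w.

(** Limits of closed triangles. At the ends of a flat piece no closed triangle is available yet, but
    the sum of the vertices and the non-strict inequalities pass to the limit. *)
Definition NT u v w := forall e, 0 < e -> exists u' v' w',
  [/\ CT u' v' w', `|u - u'| < e, `|v - v'| < e & `|w - w'| < e].

Lemma NT_rot u v w : NT u v w -> NT v w (u + L).
Proof.
move=> h e e0; have [u' [v' [w' [ct h1 h2 h3]]]] := h e e0.
exists v', w', (u' + L); split => //; first exact: CT_rot.
by have -> : u + L - (u' + L) = u - u' by ring.
Qed.

Lemma CT_NT u v w : CT u v w -> NT u v w.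
Proof. by move=> h e e0; exists u, v, w; split; rewrite // subrr normr0. Qed.

Lemma NT_seq u v w : NT u v w -> exists U V W : nat -> R, [/\ forall n, CT (U n) (V n) (W n),
  U @ \oo --> u, V @ \oo --> v & W @ \oo --> w].
Proof.
move=> h.
have : forall n : nat, exists p : R * R * R, [/\ CT p.1.1 p.1.2 p.2,
    `|u - p.1.1| < n.+1%:R^-1, `|v - p.1.2| < n.+1%:R^-1 & `|w - p.2| < n.+1%:R^-1].
  move=> n; have [|u' [v' [w' h']]] := h (n.+1%:R^-1); first by rewrite invr_gt0 ltr0n.
  by exists (u', v', w').
move=> /choice [p hp].
have cv (f : nat -> R) (l : R) : (forall n, `|l - f n| < n.+1%:R^-1) -> f @ \oo --> l.
  move=> hf; apply/cvgrPdist_lt => e e0; near=> n; apply: lt_trans (hf n) _; near: n.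
  exact: (near_infty_natSinv_lt (PosNum e0)).
exists (fun n => (p n).1.1), (fun n => (p n).1.2), (fun n => (p n).2).
split; first by move=> n; case: (hp n).
- by apply: cv => n; case: (hp n).
- by apply: cv => n; case: (hp n).
- by apply: cv => n; case: (hp n).
Unshelve. all: by end_near. Qed.

Let gcv (U : nat -> R) (u : R) : U @ \oo --> u ->
  (fun n => (g (U n)).1) @ \oo --> (g u).1 /\ (fun n => (g (U n)).2) @ \oo --> (g u).2.
Proof.
move=> hU; split.
  exact: (cvg_comp _ _ hU (is_derive_continuous (g1D u))).
exact: (cvg_comp _ _ hU (is_derive_continuous (g2D u))).
Qed.

Let dtcv (U V W X : nat -> R) (u v w x : R) : U @ \oo --> u -> V @ \oo --> v -> W @ \oo --> w ->
  X @ \oo --> x -> (fun n => dt (g (U n)) (g (V n)) (g (W n)) (g (X n))) @ \oo --> dt (g u) (g v) (g w) (g x).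
Proof.
move=> /gcv[u1 u2] /gcv[v1 v2] /gcv[w1 w2] /gcv[x1 x2]; rewrite /dt.
by apply: cvgB; apply: cvgM; apply: cvgB.
Qed.

Lemma NT_opp u v w u' v' w' : NT u v w -> NT u' v' w' -> sigma * dt (g u) (g v) (g w) (g w') <= 0.
Proof.
move=> /NT_seq [U [V [W [ct hU hV hW]]]] /NT_seq [U' [V' [W' [ct' _ _ hW']]]].
apply: (@lim_le0 _ (fun n => sigma * dt (g (U n)) (g (V n)) (g (W n)) (g (W' n)))).
  by apply: cvgM; [exact: cvg_cst|exact: dtcv].
by move=> n; exact: CT_opp (ct n) (ct' n).
Qed.

Lemma NT_T u v w : NT u v w -> s0 <= sigma * dt (g u) (g v) (g u) (g w).
Proof.
move=> /NT_seq [U [V [W [ct hU hV hW]]]]; rewrite -subr_le0.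
apply: (@lim_le0 _ (fun n => s0 - sigma * dt (g (U n)) (g (V n)) (g (U n)) (g (W n)))).
  by apply: cvgB; [exact: cvg_cst|apply: cvgM; [exact: cvg_cst|exact: dtcv]].
by move=> n; rewrite subr_le0; exact: CT_T (ct n).
Qed.

Lemma NT_sum u v w : NT u v w -> (g u).1 + (g v).1 + (g w).1 = G1 /\ (g u).2 + (g v).2 + (g w).2 = G2.
Proof.
move=> /NT_seq [U [V [W [ct /gcv[u1 u2] /gcv[v1 v2] /gcv[w1 w2]]]]].
have cst (f : nat -> R) (l c : R) : f @ \oo --> l -> (forall n, f n = c) -> l = c.
  move=> fl fe; rewrite -(cvg_lim (@Rhausdorff R) fl); have -> : f = cst c by apply/funext.
  exact: lim_cst.
split; [apply: (cst _ _ _ (cvgD (cvgD u1 v1) w1))|apply: (cst _ _ _ (cvgD (cvgD u2 v2) w2))] => n /=;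
  by have [e1 e2] := CT_sum (ct n).
Qed.

(** For [k = 1] the last, for [k = -1] the first point of its level set of [S]. *)
Definition level_end (k al : R) := forall x, 0 < k * (x - al) -> 0 < k * (S x - S al).

Let kmono (k x y : R) : k ^+ 2 = 1 -> 0 < k * (S x - S y) -> 0 < k * (x - y).
Proof.
move=> k2 h; rewrite ltNge; apply/negP => le.
have [ke|ke] := sgn_cases k2; move: h le; rewrite ke => h le.
  have xy : S x <= S y by apply: Snd; lra.
  by lra.
have yx : S y <= S x by apply: Snd; lra.
by lra.
Qed.

Lemma level_end_ex (k s : R) : k ^+ 2 = 1 -> exists al, S al = s /\ level_end k al.
Proof.
move=> k2; have Sc : continuous S by move=> x; exact: is_derive_continuous (SD x).
have [ke|ke] := sgn_cases k2; rewrite ke.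
  have [al [e h]] := level_max Sc Snd (Slow s) (Shigh s).
  by exists al; split => // x hx; have := h x; rewrite e; lra.
have [||||al [e h]] := @level_max _ (fun x => - S (- x)) (- s).
- move=> x; apply: cvgN; apply: (@continuous_comp _ _ _ -%R S); [exact: opp_continuous|exact: Sc].
- by move=> x y xy; rewrite lerN2; apply: Snd; rewrite lerN2.
- by have [x hx] := Shigh s; exists (- x); rewrite opprK lerN2 ltW.
- by have [x hx] := Slow (s - 1); exists (- x); rewrite opprK ltrN2; lra.
exists (- al); split; first by apply: oppr_inj.
move=> x hx; have := h (- x); rewrite opprK; lra.
Qed.

(** Just beyond [al] on the side [k] the function [S] is not constant, so there are points with [F]
    non-zero, which start closed triangles. Their other vertices approach [al'] and [al''] because
    the increments of [S] at the three vertices are equal. *)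
Lemma level_approach (k al al' al'' : R) : k ^+ 2 = 1 -> level_end k al -> level_end k al' ->
  level_end k al'' -> S al' = S al + Lam / 3 -> S al'' = S al + Lam / 3 + Lam / 3 ->
  forall e, 0 < e -> exists u v w, [/\ CT u v w, 0 < k * (u - al) < e,
    0 < k * (v - al') < e & 0 < k * (w - al'') < e].
Proof.
move=> k2 h0 h1 h2 e1 e2 e e0.
have kk (x : R) : k * (k * x) = x by rewrite mulrA -expr2 k2 mul1r.
have step x : level_end k x -> 0 < k * (S (x + k * e) - S x).
  by move=> h; apply: h; rewrite addrAC subrr add0r kk.
(* An increment of [S] below [m] keeps all three vertices within distance [e]. *)
pose m := Num.min (k * (S (al + k * e) - S al)) (Num.min (k * (S (al' + k * e) - S al')) (k * (S (al'' + k * e) - S al''))).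
have m0 : 0 < m by rewrite !lt_min !step.
have m1 : m <= k * (S (al + k * e) - S al) by rewrite !ge_min lexx.
have m2 : m <= k * (S (al' + k * e) - S al') by rewrite !ge_min lexx !orbT.
have m3 : m <= k * (S (al'' + k * e) - S al'') by rewrite !ge_min lexx !orbT.
have /cvgrPdist_lt/(_ _ m0)/nbhs_ballP[r r0 hr] : {for al, continuous S} := is_derive_continuous (SD al).
have {}r0 : (0 : R) < r by exact: r0.
have [c c0 Fc] : exists2 c, 0 < k * (c - al) < r & F c != 0.
  have hS : 0 < k * (S (al + k * (r / 2)) - S al).
    by apply: h0; rewrite addrAC subrr add0r kk divr_gt0.
  have [ke|ke] := sgn_cases k2; move: hS; rewrite ke.
    have -> : al + 1 * (r / 2) = al + r / 2 by ring.
    have [|c cc ->] := @mvt _ S F al (al + r / 2) SD; first by rewrite ltrDl divr_gt0.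
    move=> h; exists c; first by case/andP: cc => ? ?; apply/andP; split; lra.
    by apply: contraTneq h => ->; rewrite mul0r mulr0 ltxx.
  have -> : al + -1 * (r / 2) = al - r / 2 by ring.
  have [|c cc e3] := @mvt _ S F (al - r / 2) al SD; first by rewrite ltrBlDr ltrDl divr_gt0.
  move=> h; exists c; first by case/andP: cc => ? ?; apply/andP; split; lra.
  by apply: contraTneq h => F0; move: e3; rewrite F0 mul0r => e3; rewrite -leNgt; lra.
have [v [w ct]] := CT_ex (fun x => @Finj c x Fc).
have [Sv Sw] := CT_S ct; case/andP: c0 => c1 c2.
have lo := h0 _ c1.
have hi : k * (S c - S al) < m.
  have := hr c; rewrite /ball /= => H.
  have : `|S al - S c| < m.
    apply: H; have : `|k * (c - al)| < r by rewrite gtr0_norm.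
    by rewrite normrM distrC; have [->|->] := sgn_cases k2; rewrite ?normrN normr1 mul1r.
  by rewrite ltr_norml => /andP[]; have [->|->] := sgn_cases k2; lra.
have fin x y : S x - S y = S c - S al -> m <= k * (S (y + k * e) - S y) -> 0 < k * (x - y) < e.
  move=> exy my; apply/andP; split; first by apply: kmono => //; rewrite exy.
  have : 0 < k * (y + k * e - x).
    apply: kmono => //; have -> : k * (S (y + k * e) - S x) = k * (S (y + k * e) - S y) - k * (S x - S y) by ring.
    by rewrite exy; lra.
  have -> : k * (y + k * e - x) = k * (k * e) - k * (x - y) by ring.
  by rewrite kk subr_gt0.
by exists c, v, w; split => //; apply: fin => //; rewrite ?Sv ?Sw ?e1 ?e2; ring.
Qed.

Lemma NT_approach (k al al' al'' : R) : k ^+ 2 = 1 -> level_end k al -> level_end k al' ->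
  level_end k al'' -> S al' = S al + Lam / 3 -> S al'' = S al + Lam / 3 + Lam / 3 ->
  NT al al' al''.
Proof.
move=> k2 h0 h1 h2 e1 e2 e e0.
have [u [v [w [ct a1 a2 a3]]]] := level_approach k2 h0 h1 h2 e1 e2 e0.
have nrm (x y : R) : 0 < k * (x - y) < e -> `|y - x| < e.
  case/andP => p1 p2; have : `|k * (x - y)| < e by rewrite gtr0_norm.
  by rewrite normrM distrC; have [->|->] := sgn_cases k2; rewrite ?normrN normr1 mul1r.
by exists u, v, w; split => //; exact: nrm.
Qed.

(** By [NT_opp], an affine function constant along the side through [g u] and [g v] is at third
    vertices of closed triangles at most its value at [g w]; accumulation from the side [k] turns
    this into a sign of its derivative along the curve. *)
Lemma NT_tangent (k u v w : R) : k ^+ 2 = 1 -> NT u v w ->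
  (forall e, 0 < e -> exists u' v' w', CT u' v' w' /\ 0 < k * (w' - w) < e) ->
  k * (sigma * (((g v).1 - (g u).1) * (dg w).2 - ((g v).2 - (g u).2) * (dg w).1)) <= 0.
Proof.
move=> k2 nt acc.
pose A := sigma * ((g v).1 - (g u).1); pose B := - (sigma * ((g v).2 - (g u).2)).
pose C := - (A * (g w).2 + B * (g w).1).
have := derive_acc (is_derive_lin A B C (g2D w) (g1D w)) k2.
have -> : A * (dg w).2 + B * (dg w).1 = sigma * (((g v).1 - (g u).1) * (dg w).2 - ((g v).2 - (g u).2) * (dg w).1).
  by rewrite /A /B; ring.
apply => e e0; have [u' [v' [w' [ct hw]]]] := acc e e0.
exists w' => //; have := NT_opp nt (CT_NT ct); rewrite /dt /C /A /B => h.
by rewrite addrN; apply: le_trans h; rewrite le_eqVlt; apply/orP; left; apply/eqP; ring.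
Qed.

Let flat_level p q : p < q -> S p = S q -> forall w, p <= w <= q -> F w = 0.
Proof.
move=> pq e w /andP[w1 w2]; apply/eqP; rewrite -[_ == _]negbK; apply/negP => Fw.
have h1 := Snd w1; have h2 := Snd w2.
have pw : p = w by apply: Finj Fw _; lra.
have qw : q = w by apply: Finj Fw _; lra.
by move: pq; rewrite pw qw ltxx.
Qed.

(** Between [w] and [w'] the curve is straight with constant tangent direction, so each defect is a
    positive multiple of a tangential derivative. [NT_opp] and [NT_tangent] give it opposite
    signs. *)
Lemma jump_zero u v w u' v' w' : NT u v w -> NT u' v' w' -> w <= w' -> S w = S w' ->
  (forall e, 0 < e -> exists x y z, CT x y z /\ 0 < -1 * (z - w) < e) ->
  (forall e, 0 < e -> exists x y z, CT x y z /\ 0 < 1 * (z - w') < e) ->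
  dt (g u) (g v) (g w) (g w') = 0 /\ dt (g u') (g v') (g w) (g w') = 0.
Proof.
move=> n n' ww eS accl accr.
have [e|ne] := eqVneq w w'; first by rewrite e /dt !subrr !mulr0 subrr.
have lt : w < w' by rewrite lt_neqAle ne.
have [c c0 [e1 e2 [d d0 [d1 d2]]]] := flat lt (flat_level lt eS).
have sn : sigma != 0 by apply: contraPneq s2 => ->; rewrite expr0n /= => /eqP; rewrite eq_sym oner_eq0.
have o1 := NT_opp n n'; have o2 := NT_opp n' n.
have t1 := NT_tangent (k := -1) (etrans (sqrrN 1) (expr1n _ _)) n accl; rewrite mulN1r oppr_le0 in t1.
have t2 := NT_tangent (k := 1) (expr1n _ _) n' accr; rewrite mul1r in t2.
pose Y := ((g v').1 - (g u').1) * (dg w').2 - ((g v').2 - (g u').2) * (dg w').1.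
have f1 : dt (g u) (g v) (g w) (g w') = c * (((g v).1 - (g u).1) * (dg w).2 - ((g v).2 - (g u).2) * (dg w).1).
  by rewrite /dt e1 e2; ring.
have f2 : d * dt (g u') (g v') (g w) (g w') = c * Y.
  by rewrite /dt e1 e2 /Y d1 d2; ring.
have f3 : dt (g u') (g v') (g w') (g w) = - dt (g u') (g v') (g w) (g w') by rewrite /dt; ring.
split; apply: (mulfI sn); rewrite mulr0; apply/eqP; rewrite eq_le.
  by rewrite o1 /= f1 mulrCA; apply: mulr_ge0; [exact: ltW|exact: t1].
rewrite f3 mulrN oppr_le0 in o2; rewrite o2 andbT.
have : d * (sigma * dt (g u') (g v') (g w) (g w')) <= 0.
  by rewrite mulrCA f2 mulrCA; apply: mulr_ge0_le0; [exact: ltW|exact: t2].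
by rewrite pmulr_rle0.
Qed.

(** Compare the limit triangles at the two ends of the level set of [S x]. [jump_zero] at the three
    vertices provides the hypotheses of [no_jump], so the first vertex does not move; yet along a
    flat piece of positive length it moves by a positive multiple of [dg al]. *)
Lemma S_strict x y : x < y -> S x < S y.
Proof.
move=> xy; rewrite ltNge; apply/negP => le.
have eS : S x = S y by apply/eqP; rewrite eq_le le Snd // ltW.
have m2 : (-1) ^+ 2 = 1 :> R by rewrite sqrrN expr1n.
have p2 : 1 ^+ 2 = 1 :> R by rewrite expr1n.
have [al [Sa ea]] := level_end_ex (S x) m2; have [be [Sb eb]] := level_end_ex (S x) p2.
have [al' [Sa' ea']] := level_end_ex (S x + Lam / 3) m2; have [be' [Sb' eb']] := level_end_ex (S x + Lam / 3) p2.
have [al'' [Sa'' ea'']] := level_end_ex (S x + Lam / 3 + Lam / 3) m2.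
have [be'' [Sb'' eb'']] := level_end_ex (S x + Lam / 3 + Lam / 3) p2.
have lo a z : level_end (-1) a -> S z = S a -> a <= z.
  by move=> h e; rewrite leNgt; apply/negP => lt; have := h z; rewrite e; lra.
have hi b z : level_end 1 b -> S z = S b -> z <= b.
  by move=> h e; rewrite leNgt; apply/negP => lt; have := h z; rewrite e; lra.
have al_be : al < be.
  have h1 : al <= x by apply: lo ea _; rewrite Sa.
  have h2 : y <= be by apply: hi eb _; rewrite Sb.
  by lra.
have le' : al' <= be' by apply: lo ea' _; rewrite Sa' Sb'.
have le'' : al'' <= be'' by apply: lo ea'' _; rewrite Sa'' Sb''.
have A1 : S al' = S al + Lam / 3 by rewrite Sa Sa'.
have A2 : S al'' = S al + Lam / 3 + Lam / 3 by rewrite Sa Sa''.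
have B1 : S be' = S be + Lam / 3 by rewrite Sb Sb'.
have B2 : S be'' = S be + Lam / 3 + Lam / 3 by rewrite Sb Sb''.
have na := NT_approach m2 ea ea' ea'' A1 A2; have nb := NT_approach p2 eb eb' eb'' B1 B2.
have apa := level_approach m2 ea ea' ea'' A1 A2; have apb := level_approach p2 eb eb' eb'' B1 B2.
have [z3 _] : dt (g al) (g al') (g al'') (g be'') = 0 /\ dt (g be) (g be') (g al'') (g be'') = 0.
  apply: jump_zero => //; first by rewrite Sa'' Sb''.
    by move=> e /apa [u [v [w [ct _ _ h]]]]; exists u, v, w.
  by move=> e /apb [u [v [w [ct _ _ h]]]]; exists u, v, w.
(* [z4] concerns the opposite side of the triangle at the far end; it is the additional condition
   that [no_jump] requires. *)
have [z1 z4] : dt (g al') (g al'') (g (al + L)) (g (be + L)) = 0 /\ dt (g be') (g be'') (g (al + L)) (g (be + L)) = 0.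
  apply: jump_zero; [exact: NT_rot|exact: NT_rot|by rewrite lerD2r ltW|by rewrite !Sper Sa Sb| |].
    move=> e /apa [u [v [w [ct h _ _]]]]; exists v, w, (u + L); split; first exact: CT_rot.
    by have -> : u + L - (al + L) = u - al by ring.
  move=> e /apb [u [v [w [ct h _ _]]]]; exists v, w, (u + L); split; first exact: CT_rot.
  by have -> : u + L - (be + L) = u - be by ring.
have [z2 _] : dt (g al'') (g (al + L)) (g (al' + L)) (g (be' + L)) = 0 /\ dt (g be'') (g (be + L)) (g (al' + L)) (g (be' + L)) = 0.
  apply: jump_zero; [exact: NT_rot (NT_rot na)|exact: NT_rot (NT_rot nb)|by rewrite lerD2r|by rewrite !Sper Sa' Sb'| |].
    move=> e /apa [u [v [w [ct _ h _]]]]; exists w, (u + L), (v + L); split; first exact: CT_rot (CT_rot ct).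
    by have -> : v + L - (al' + L) = v - al' by ring.
  move=> e /apb [u [v [w [ct _ h _]]]]; exists w, (u + L), (v + L); split; first exact: CT_rot (CT_rot ct).
  by have -> : v + L - (be' + L) = v - be' by ring.
rewrite !gper in z1 z2 z4.
have T0 : dt (g al) (g al') (g al) (g al'') != 0.
  by apply: contraTneq (NT_T na) => ->; rewrite mulr0 -ltNge.
have [sa1 sa2] := NT_sum na; have [sb1 sb2] := NT_sum nb.
have c1 : (g be'').1 - (g al'').1 = - ((g be).1 - (g al).1) - ((g be').1 - (g al').1) by lra.
have c2 : (g be'').2 - (g al'').2 = - ((g be).2 - (g al).2) - ((g be').2 - (g al').2) by lra.
have [|||||x0 y0] := @no_jump R (g al).1 (g al).2 (g al').1 (g al').2 (g al'').1 (g al'').2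
   ((g be).1 - (g al).1) ((g be).2 - (g al).2) ((g be').1 - (g al').1) ((g be').2 - (g al').2).
- exact: T0.
- exact: z1.
- exact: z2.
- by rewrite -c1 -c2.
- rewrite -c1 -c2 -z4 /dt; ring.
have SE : S al = S be by rewrite Sa Sb.
have [c c0 [e1 e2 _]] := flat al_be (flat_level al_be SE).
have := dg0 al; rewrite x0 in e1; rewrite y0 in e2.
have d1 : (dg al).1 = 0 by apply: (mulfI (lt0r_neq0 c0)); rewrite mulr0 -e1.
have d2 : (dg al).2 = 0 by apply: (mulfI (lt0r_neq0 c0)); rewrite mulr0 -e2.
by rewrite [dg al]surjective_pairing d1 d2 eqxx.
Qed.

Let S_inj u x : S x = S u -> x = u.
Proof. by move=> e; have [/S_strict|/S_strict|//] := ltgtP x u; rewrite e ltxx. Qed.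

Let S_ltr x y : S x < S y -> x < y.
Proof. by move=> h; rewrite ltNge; apply/negP => /Snd; rewrite leNgt h. Qed.

(** Strict growth of [S] separates the values at [f u - e], [f u] and [f u + e], and continuity of
    [S] at [u] keeps [S (f s)] between the outer two. *)
Let lift_cont (f : R -> R) (c : R) : (forall u, S (f u) = S u + c) -> continuous f.
Proof.
move=> h u; apply/cvgrPdist_lt => e e0.
have Sc : {for u, continuous S} := is_derive_continuous (SD u).
have lo : S (f u - e) < S (f u) by apply: S_strict; lra.
have hi : S (f u) < S (f u + e) by apply: S_strict; lra.
have [||r1 r10 h1] := @pos_near _ (fun s => S s - (S (f u - e) - c)) u.
- by apply: cvgB; [exact: Sc|exact: cvg_cst].
- by rewrite h in lo; lra.
have [||r2 r20 h2] := @neg_near _ (fun s => S s - (S (f u + e) - c)) u.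
- by apply: cvgB; [exact: Sc|exact: cvg_cst].
- by rewrite h in hi; lra.
apply/nbhs_ballP; exists (Num.min r1 r2); first by rewrite /= lt_min r10 r20.
move=> s; rewrite /ball /= distrC lt_min => /andP[/h1 k1 /h2 k2].
have l1 : f u - e < f s by apply: S_ltr; rewrite h; lra.
have l2 : f s < f u + e by apply: S_ltr; rewrite h; lra.
by rewrite ltr_norml; apply/andP; split; lra.
Qed.

Let g_lip x y : x <= y -> `|(g y).1 - (g x).1| <= N * (y - x) /\ `|(g y).2 - (g x).2| <= N * (y - x).
Proof.
move=> xy; have [->|ne] := eqVneq x y; first by rewrite !subrr normr0 mulr0.
have lt : x < y by rewrite lt_neqAle ne.
have yx : 0 <= y - x by rewrite subr_ge0.
have [c _ ->] := mvt g1D lt; have [c' _ ->] := mvt g2D lt.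
have [h1 _] := dgN c; have [_ h2] := dgN c'.
by rewrite !normrM (ger0_norm yx) !ler_wpM2r.
Qed.

(** The two triangles bound each other, one from each side. Their sides differ by at most [2 * h]
    per coordinate and the jump of the third vertex is at most [h], so the two bounds are
    [4 * h ^+ 2] apart. *)
Let defect (a b c a' b' c' : R * R) (h : R) : `|a'.1 - a.1| <= h -> `|a'.2 - a.2| <= h ->
  `|b'.1 - b.1| <= h -> `|b'.2 - b.2| <= h -> `|c'.1 - c.1| <= h -> `|c'.2 - c.2| <= h ->
  sigma * dt a b c c' <= 0 -> sigma * dt a' b' c' c <= 0 -> `|dt a b c c'| <= 4 * h ^+ 2.
Proof.
move=> a1 a2 b1 b2 c1 c2 o1 o2.
have sn : `|sigma| = 1 by have [->|->] := sgn_cases s2; rewrite ?normrN normr1.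
have E : dt a b c c' = - dt a' b' c' c - (((b'.1 - b.1) - (a'.1 - a.1)) * (c'.2 - c.2) - ((b'.2 - b.2) - (a'.2 - a.2)) * (c'.1 - c.1)).
  by rewrite /dt; ring.
set Q := (X in _ - X) in E.
have hQ : `|Q| <= 4 * h ^+ 2.
  apply: le_trans (ler_normB _ _) _.
  have k (x y z : R) : `|x| <= h -> `|y| <= h -> `|z| <= h -> `|(x - y) * z| <= 2 * h ^+ 2.
    move=> hx hy hz; rewrite normrM; apply: (@le_trans _ _ (2 * h * h)); last by rewrite expr2 mulrA.
    by apply: ler_pM => //; exact: normB_le.
  have := k _ _ _ b1 a1 c2; have := k _ _ _ b2 a2 c1; lra.
have -> : `|dt a b c c'| = `|sigma * dt a b c c'| by rewrite normrM sn mul1r.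
rewrite ler0_norm //.
have hs : sigma * Q <= 4 * h ^+ 2 by apply: le_trans (ler_norm _) _; rewrite normrM sn mul1r.
have E2 : sigma * dt a b c c' = - (sigma * dt a' b' c' c) - sigma * Q by rewrite E; ring.
by rewrite E2; move: o2 hs; move: (sigma * dt _ _ _ _) (sigma * Q) => A B o2 hs; lra.
Qed.

(** The increment of a second moment is twice a first-order term plus three squares or products. By
    [steiner_variation] the first-order term times the determinant is at most
    [3 * 4 * (2 * D) ^+ 2 * h ^+ 2], that is [48 * D ^+ 2 * h ^+ 2]; doubling gives 96, and the
    remaining terms give 3. *)
Let moment_step (a b c a' b' c' : R * R) (h : R) :
  (`|a.1| <= D /\ `|a.2| <= D) -> (`|b.1| <= D /\ `|b.2| <= D) -> (`|c.1| <= D /\ `|c.2| <= D) ->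
  (`|a'.1 - a.1| <= h /\ `|a'.2 - a.2| <= h) -> (`|b'.1 - b.1| <= h /\ `|b'.2 - b.2| <= h) ->
  (`|c'.1 - c.1| <= h /\ `|c'.2 - c.2| <= h) ->
  a'.1 + b'.1 + c'.1 = a.1 + b.1 + c.1 -> a'.2 + b'.2 + c'.2 = a.2 + b.2 + c.2 ->
  s0 <= sigma * dt a b a c ->
  `|dt b c a a'| <= 4 * h ^+ 2 -> `|dt c a b b'| <= 4 * h ^+ 2 -> `|dt a b c c'| <= 4 * h ^+ 2 ->
  let C := 96 * D ^+ 2 / s0 + 3 in
  [/\ `|(a.1 ^+ 2 + b.1 ^+ 2 + c.1 ^+ 2) - (a'.1 ^+ 2 + b'.1 ^+ 2 + c'.1 ^+ 2)| <= C * h ^+ 2,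
   `|(a.1 * a.2 + b.1 * b.2 + c.1 * c.2) - (a'.1 * a'.2 + b'.1 * b'.2 + c'.1 * c'.2)| <= C * h ^+ 2 &
   `|(a.2 ^+ 2 + b.2 ^+ 2 + c.2 ^+ 2) - (a'.2 ^+ 2 + b'.2 ^+ 2 + c'.2 ^+ 2)| <= C * h ^+ 2].
Proof.
move=> [a1 a2] [b1 b2] [c1 c2] [x1 x2] [y1 y2] [w1 w2] S1 S2 T0 z1 z2 z3 C.
have ec1 : c'.1 - c.1 = - (a'.1 - a.1) - (b'.1 - b.1) by lra.
have ec2 : c'.2 - c.2 = - (a'.2 - a.2) - (b'.2 - b.2) by lra.
have [I1 I2 I3] := steiner_variation a.1 a.2 b.1 b.2 c.1 c.2 (a'.1 - a.1) (a'.2 - a.2) (b'.1 - b.1) (b'.2 - b.2).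
rewrite -ec1 -ec2 in I1 I2 I3.
rewrite -/(dt a b a c) -/(dt b c a a') -/(dt c a b b') -/(dt a b c c') in I1 I2 I3.
have Tn : s0 <= `|dt a b a c|.
  apply: le_trans T0 _; apply: le_trans (ler_norm _) _; rewrite normrM.
  by have [->|->] := sgn_cases s2; rewrite ?normrN normr1 mul1r.
have quo (X B : R) : `|dt a b a c * X| <= B -> 0 <= B -> `|X| <= B / s0.
  move=> hX B0; rewrite ler_pdivlMr //; apply: le_trans hX; rewrite normrM mulrC ler_wpM2r //.
have h2 : 0 <= h ^+ 2 by exact: sqr_ge0.
have D2 : 0 <= D ^+ 2 by exact: sqr_ge0.
have B0 : 0 <= 48 * D ^+ 2 * h ^+ 2 by apply: mulr_ge0 => //; apply: mulr_ge0.
have fin (X Y1 Y2 Y3 W : R) : `|X| <= 48 * D ^+ 2 * h ^+ 2 / s0 -> `|Y1| <= h * h -> `|Y2| <= h * h ->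
    `|Y3| <= h * h -> W = - (2 * X) - Y1 - Y2 - Y3 -> `|W| <= C * h ^+ 2.
  move=> hX k1 k2 k3 ->.
  have -> : C * h ^+ 2 = 2 * (48 * D ^+ 2 * h ^+ 2 / s0) + h * h + h * h + h * h by rewrite /C; field; exact: lt0r_neq0.
  move: hX k1 k2 k3; rewrite !ler_norml => /andP[? ?] /andP[? ?] /andP[? ?] /andP[? ?].
  by apply/andP; split; lra.
have eB : 3 * (4 * h ^+ 2 * (2 * D) * (2 * D)) = 48 * D ^+ 2 * h ^+ 2 by ring.
split.
- apply: (fin (a.1 * (a'.1 - a.1) + b.1 * (b'.1 - b.1) + c.1 * (c'.1 - c.1)) _ _ _ _ _ (norm2_le x1 x1) (norm2_le y1 y1) (norm2_le w1 w1)); last by ring.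
  apply: quo => //; rewrite I1 -eB.
  by apply: sum3_bound => //; apply: normB_le.
- apply: (fin ((a.1 * (a'.2 - a.2) + a.2 * (a'.1 - a.1) + b.1 * (b'.2 - b.2) + b.2 * (b'.1 - b.1) + c.1 * (c'.2 - c.2) + c.2 * (c'.1 - c.1)) / 2) _ _ _ _ _ (norm2_le x1 x2) (norm2_le y1 y2) (norm2_le w1 w2)); last by field.
  apply: quo => //.
  set Y := _ + c.2 * _ in I3 *.
  have -> : dt a b a c * (Y / 2) = (2 * dt a b a c * Y) / 4 by field.
  rewrite I3.
  set P1 := dt b c a a' * (b.1 - a.1) * (c.2 - a.2) + dt c a b b' * (c.1 - b.1) * (a.2 - b.2) + dt a b c c' * (a.1 - c.1) * (b.2 - c.2).
  set P2 := dt b c a a' * (b.2 - a.2) * (c.1 - a.1) + dt c a b b' * (c.2 - b.2) * (a.1 - b.1) + dt a b c c' * (a.2 - c.2) * (b.1 - c.1).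
  have hP1 : `|P1| <= 48 * D ^+ 2 * h ^+ 2 by rewrite -eB; apply: sum3_bound => //; apply: normB_le.
  have hP2 : `|P2| <= 48 * D ^+ 2 * h ^+ 2 by rewrite -eB; apply: sum3_bound => //; apply: normB_le.
  have -> : 2 * (dt b c a a' * ((b.1 - a.1) * (c.2 - a.2) + (b.2 - a.2) * (c.1 - a.1)) +
     dt c a b b' * ((c.1 - b.1) * (a.2 - b.2) + (c.2 - b.2) * (a.1 - b.1)) +
     dt a b c c' * ((a.1 - c.1) * (b.2 - c.2) + (a.2 - c.2) * (b.1 - c.1))) / 4 = (P1 + P2) / 2.
    by rewrite /P1 /P2; field.
  move: hP1 hP2; rewrite !ler_norml => /andP[? ?] /andP[? ?]; apply/andP; split; lra.
- apply: (fin (a.2 * (a'.2 - a.2) + b.2 * (b'.2 - b.2) + c.2 * (c'.2 - c.2)) _ _ _ _ _ (norm2_le x2 x2) (norm2_le y2 y2) (norm2_le w2 w2)); last by ring.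
  apply: quo => //; rewrite I2 -eB.
  by apply: sum3_bound => //; apply: normB_le.
Qed.

Lemma CT_moments u v w u' v' w' : CT u v w -> CT u' v' w' ->
  [/\ (g u).1 ^+ 2 + (g v).1 ^+ 2 + (g w).1 ^+ 2 = (g u').1 ^+ 2 + (g v').1 ^+ 2 + (g w').1 ^+ 2,
   (g u).1 * (g u).2 + (g v).1 * (g v).2 + (g w).1 * (g w).2 =
   (g u').1 * (g u').2 + (g v').1 * (g v').2 + (g w').1 * (g w').2 &
   (g u).2 ^+ 2 + (g v).2 ^+ 2 + (g w).2 ^+ 2 = (g u').2 ^+ 2 + (g v').2 ^+ 2 + (g w').2 ^+ 2].
Proof.
have : forall x, exists p : R * R, CT x p.1 p.2.
  by move=> x; have [y [z h]] := CT_ex (S_inj (u := x)); exists (y, z).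
move=> /choice [p hp].
pose V x := (p x).1; pose W x := (p x).2.
have SV x : S (V x) = S x + Lam / 3 by have [] := CT_S (hp x).
have SW x : S (W x) = S x + (Lam / 3 + Lam / 3) by rewrite addrA; have [] := CT_S (hp x).
have Vc := lift_cont SV; have Wc := lift_cont SW.
have Vnd x y : x <= y -> V x <= V y.
  move=> xy; rewrite leNgt; apply/negP => /S_strict; rewrite !SV ltrD2r; have := Snd xy; lra.
have Wnd x y : x <= y -> W x <= W y.
  move=> xy; rewrite leNgt; apply/negP => /S_strict; rewrite !SW ltrD2r; have := Snd xy; lra.
(* All three summands are non-decreasing, so the increment of [s] dominates that of each vertex
   parameter. *)
pose s x := x + V x + W x.
have sc : continuous s.
  by move=> x; apply: cvgD; [apply: cvgD; [exact: cvg_id|exact: Vc]|exact: Wc].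
have N0 : 0 <= N by have [h _] := dgN 0; exact: le_trans (normr_ge0 _) h.
pose C := 96 * D ^+ 2 / s0 + 3.
have key x y : x <= y -> let h := N * (s y - s x) in
  [/\ `|((g x).1 ^+ 2 + (g (V x)).1 ^+ 2 + (g (W x)).1 ^+ 2) - ((g y).1 ^+ 2 + (g (V y)).1 ^+ 2 + (g (W y)).1 ^+ 2)| <= C * h ^+ 2,
   `|((g x).1 * (g x).2 + (g (V x)).1 * (g (V x)).2 + (g (W x)).1 * (g (W x)).2) -
     ((g y).1 * (g y).2 + (g (V y)).1 * (g (V y)).2 + (g (W y)).1 * (g (W y)).2)| <= C * h ^+ 2 &
   `|((g x).2 ^+ 2 + (g (V x)).2 ^+ 2 + (g (W x)).2 ^+ 2) - ((g y).2 ^+ 2 + (g (V y)).2 ^+ 2 + (g (W y)).2 ^+ 2)| <= C * h ^+ 2].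
  move=> xy h; have Vxy := Vnd _ _ xy; have Wxy := Wnd _ _ xy.
  have lip a b : a <= b -> b - a <= s y - s x -> `|(g b).1 - (g a).1| <= h /\ `|(g b).2 - (g a).2| <= h.
    move=> ab le; have [h1 h2] := g_lip ab.
    by split; [apply: le_trans h1 _|apply: le_trans h2 _]; rewrite /h ler_wpM2l.
  have da : `|(g y).1 - (g x).1| <= h /\ `|(g y).2 - (g x).2| <= h by apply: lip; rewrite /s; lra.
  have db : `|(g (V y)).1 - (g (V x)).1| <= h /\ `|(g (V y)).2 - (g (V x)).2| <= h by apply: lip; rewrite /s; lra.
  have dc : `|(g (W y)).1 - (g (W x)).1| <= h /\ `|(g (W y)).2 - (g (W x)).2| <= h by apply: lip; rewrite /s; lra.
  have ctx := hp x; have cty := hp y; rewrite -/(V x) -/(W x) in ctx; rewrite -/(V y) -/(W y) in cty.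
  have [sx1 sx2] := CT_sum ctx; have [sy1 sy2] := CT_sum cty.
  have [da1 da2] := da; have [db1 db2] := db; have [dc1 dc2] := dc.
  apply: moment_step => //.
  - by rewrite sx1 sy1.
  - by rewrite sx2 sy2.
  - exact: CT_T ctx.
  - have := CT_opp (CT_rot ctx) (CT_rot cty); have := CT_opp (CT_rot cty) (CT_rot ctx); rewrite !gper => o2 o1.
    exact: (defect db1 db2 dc1 dc2 da1 da2 o1 o2).
  - have := CT_opp (CT_rot (CT_rot ctx)) (CT_rot (CT_rot cty)); have := CT_opp (CT_rot (CT_rot cty)) (CT_rot (CT_rot ctx)); rewrite !gper => o2 o1.
    exact: (defect dc1 dc2 da1 da2 db1 db2 o1 o2).
  - exact: (defect da1 da2 db1 db2 dc1 dc2 (CT_opp ctx cty) (CT_opp cty ctx)).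
have hE x y : C * (N * (s y - s x)) ^+ 2 = (C * N ^+ 2) * (s y - s x) ^+ 2 by rewrite exprMn mulrA.
have q1 := @quadratic_increment_const R (fun x => (g x).1 ^+ 2 + (g (V x)).1 ^+ 2 + (g (W x)).1 ^+ 2) s (C * N ^+ 2) sc.
have q2 := @quadratic_increment_const R (fun x => (g x).1 * (g x).2 + (g (V x)).1 * (g (V x)).2 + (g (W x)).1 * (g (W x)).2) s (C * N ^+ 2) sc.
have q3 := @quadratic_increment_const R (fun x => (g x).2 ^+ 2 + (g (V x)).2 ^+ 2 + (g (W x)).2 ^+ 2) s (C * N ^+ 2) sc.
have VW x y z : CT x y z -> y = V x /\ z = W x.
  by move=> /CT_S [e1 e2]; split; apply: S_inj; rewrite ?SV ?SW ?e1 ?e2 ?addrA.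
move=> /VW[-> ->] /VW[-> ->]; split; [apply: q1|apply: q2|apply: q3] => x y xy; rewrite -hE; by have [] := key x y xy.
Qed.

End Steiner.

(** * The chords of flotation of [K] and the triangles they form *)

Section Chords.
Variables (R : realType) (K : set (R * R)) (delta : R).
Hypothesis cK : convex_body K.
Hypothesis delta0 : 0 < delta.
Hypothesis delta_lt : delta < ar K.
Local Notation t_ := (flot K delta).
Variables (g dg ddg : R -> R * R) (L : R).
Hypothesis L0 : 0 < L.
Hypothesis gper : forall u, g (u + L) = g u.
Hypothesis ginj : forall u v, 0 <= u < L -> 0 <= v < L -> g u = g v -> u = v.
Hypothesis gsurj : g @` setT = boundary K.
Hypothesis g1D : forall u : R, is_derive u 1 (fun w => (g w).1) (dg u).1.
Hypothesis g2D : forall u : R, is_derive u 1 (fun w => (g w).2) (dg u).2.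
Hypothesis dg1D : forall u : R, is_derive u 1 (fun w => (dg w).1) (ddg u).1.
Hypothesis dg2D : forall u : R, is_derive u 1 (fun w => (dg w).2) (ddg u).2.
Hypothesis dg0 : forall u, dg u != 0.
Variable sigma : R.
Hypothesis s2 : sigma ^+ 2 = 1.
Hypothesis tgi : forall u x, interior K x -> 0 < sigma * tg g dg u x.
Hypothesis tgK : forall u x, K x -> 0 <= sigma * tg g dg u x.
Variables (S F : R -> R) (Lam : R).
Hypothesis SD : forall u : R, is_derive u 1 S (F u).
Hypothesis F0 : forall u, 0 <= F u.
Hypothesis Lam0 : 0 < Lam.
Hypothesis Sper : forall u, S (u + L) = S u + Lam.
Hypothesis arcs : forall th, exists a b,
  [/\ a <= b <= a + L, g @` `[a, b] = boundary K `&` halfplane th (t_ th) & S b = S a + Lam / 3].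

Let gbd := gboundary gsurj.
Let gdot v : continuous (fun u => dot (g u) v) := gdot_continuous g1D g2D (v := v).
Let gz := gperz gper.
Let giz := ginjz L0 gper ginj.
Let iz0 := int_small L0.

Lemma S_nd u v : u <= v -> S u <= S v.
Proof. exact: ndecr_of_derive SD F0 u v. Qed.

Lemma Sz (k : int) u : S (u + k%:~R * L) = S u + k%:~R * Lam.
Proof.
have H (n : nat) v : S (v + n%:R * L) = S v + n%:R * Lam.
  elim: n v => [|n IH] v; first by rewrite !mul0r !addr0.
  by rewrite -natr1 !mulrDl !mul1r !addrA Sper IH.
case: k => n; first exact: H.
rewrite NegzE mulrNz !mulNr; apply/eqP; rewrite -subr_eq opprK -H.
by rewrite subrK.
Qed.

(** Only the ends and the affine length are recorded; the length, a third and not two thirds,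
    already fixes the order of the ends, as [FCP] shows. *)
Definition FC u v th := [/\ S v = S u + Lam / 3, dot (g u) (uvec th) = t_ th
  & dot (g v) (uvec th) = t_ th].

Lemma chordP th : exists a b, [/\ FC a b th, a < b < a + L, g a <> g b,
  (forall p, boundary K p -> dot p (uvec th) = t_ th -> p = g a \/ p = g b) &
  (forall w, a <= w <= b -> dot (g w) (uvec th) <= t_ th) /\
  (forall w, b < w < a + L -> t_ th < dot (g w) (uvec th))].
Proof.
have [a [b [ab arc Sab]]] := arcs th.
have h1 := arc_left cK delta0 delta_lt L0 gper ginj gsurj gdot ab arc.
have h2 := arc_right cK delta0 delta_lt L0 gper ginj gsurj gdot ab arc.
have h3 := arc_nontrivial cK delta0 delta_lt gsurj gdot ab arc.
have h4 := arc_lt_period cK delta0 delta_lt L0 gper gsurj ab arc.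
exists a, b; split => //.
- by rewrite h3.
- exact: (arc_endpoints_neq cK delta0 delta_lt L0 gper ginj gsurj gdot ab arc).
- exact: (arc_line cK delta0 delta_lt L0 gper ginj gsurj gdot ab arc).
- split; first by move=> w; exact: (arc_in arc).
  by move=> w; exact: (arc_outside L0 gper ginj gsurj arc).
Qed.

Lemma third_int (j : int) : j%:~R * Lam = Lam / 3 -> False.
Proof.
move=> e; have : (j%:~R * 3 : R) = 1%:~R.
  by apply: (@mulIf _ Lam); [rewrite gt_eqF|rewrite mul1r mulrAC e; field].
rewrite -[3 : R]/(3%:~R) -intrM => /intr_inj; case: j {e} => [[|n]|n] //.
Qed.

Lemma third_int2 (j : int) : j%:~R * Lam = Lam / 3 + Lam / 3 -> False.
Proof.
move=> e; have : (j%:~R * 3 : R) = 2%:~R.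
  by apply: (@mulIf _ Lam); [rewrite gt_eqF|rewrite mulrAC e; field].
rewrite -[3 : R]/(3%:~R) -intrM => /intr_inj; case: j {e} => [[|n]|n] //.
Qed.

(** Modulo [L] the ends are those of the arc supplied by the hypothesis: any other matching would
    make [Lam / 3] or twice that an integral multiple of [Lam]. *)
Lemma FCP u v th : FC u v th -> [/\ u < v < u + L, g u <> g v,
  (forall p, boundary K p -> dot p (uvec th) = t_ th -> p = g u \/ p = g v) &
  (forall w, u <= w <= v -> dot (g w) (uvec th) <= t_ th) /\
  (forall w, v < w < u + L -> t_ th < dot (g w) (uvec th))].
Proof.
move=> [Suv du dv]; have [a [b [[Sab _ _] ab nab line [hin hout]]]] := chordP th.
have [k [eu ev]] : exists k : int, u = a + k%:~R * L /\ v = b + k%:~R * L.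
  case: (line _ (gbd u) du) => /esym/giz [k ek]; case: (line _ (gbd v) dv) => /esym/giz [j ej].
  - exfalso; apply: (@third_int (j - k)); move: Suv; rewrite ek ej !Sz intrB; lra.
  - exists k; split => //; rewrite ej; congr (_ + _ * L); apply/eqP; rewrite -subr_eq0 -intrB intr_eq0.
    apply/eqP; suff : (j - k)%:~R * Lam = 0.
      by move=> /eqP; rewrite mulf_eq0 (gt_eqF Lam0) orbF intr_eq0 => /eqP.
    by move: Suv; rewrite ek ej !Sz Sab intrB; lra.
  - exfalso; apply: (@third_int2 (j - k)); move: Suv; rewrite ek ej !Sz Sab intrB; lra.
  - exfalso; apply: (@third_int (j - k)); move: Suv; rewrite ek ej !Sz intrB; lra.
move: ab => /andP[ab1 ab2].
split.
- by rewrite eu ev; apply/andP; split; lra.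
- by rewrite eu ev !gz.
- by rewrite eu ev !gz.
- split => w; rewrite eu ev => /andP[w1 w2].
    have := hin (w + (- k)%:~R * L); rewrite gz; apply.
    by rewrite mulrNz; apply/andP; split; lra.
  have := hout (w + (- k)%:~R * L); rewrite gz; apply.
  by rewrite mulrNz; apply/andP; split; lra.
Qed.

Lemma FC_shift u v th : FC u v th -> FC (u + L) (v + L) th.
Proof. by move=> [h1 h2 h3]; split; rewrite ?gper // !Sper h1; ring. Qed.

Definition mid (p q : R * R) : R * R := ((p.1 + q.1) / 2, (p.2 + q.2) / 2).

Lemma midC p q : mid p q = mid q p.
Proof. by rewrite /mid addrC [p.2 + _]addrC. Qed.

Lemma chord_unique u v u' v' th : FC u v th ->
  dot (g u') (uvec th) = t_ th -> dot (g v') (uvec th) = t_ th -> g u' <> g v' ->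
  mid (g u) (g v) = mid (g u') (g v').
Proof.
move=> /FCP [_ _ line _] d1 d2 n.
case: (line _ (gbd u') d1) => e1; case: (line _ (gbd v') d2) => e2; move: n; rewrite e1 e2 //.
by rewrite midC.
Qed.

Lemma mid_inner u v th : FC u v th -> interior K (mid (g u) (g v)).
Proof.
move=> h; have [_ n _ _] := FCP h; have [_ d1 d2] := h.
have [lt|gt|e] := ltgtP (det (g u) (uvec th)) (det (g v) (uvec th)).
- rewrite midC; exact: (midpoint_inner cK delta0 delta_lt (gbd v) (gbd u) d2 d1 lt).
- exact: (midpoint_inner cK delta0 delta_lt (gbd u) (gbd v) d1 d2 gt).
- by case: n; apply: (@uvec_inj _ th) => //; rewrite d1 d2.
Qed.

Lemma mid_derive u v th : FC u v th ->
  is_derive th 1 t_ (- det (mid (g u) (g v)) (uvec th)).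
Proof.
move=> h; have [_ n _ _] := FCP h; have [_ d1 d2] := h.
have [lt|gt|e] := ltgtP (det (g u) (uvec th)) (det (g v) (uvec th)).
- rewrite midC; exact: (flot_derive cK delta0 delta_lt (gbd v) (gbd u) d2 d1 lt).
- exact: (flot_derive cK delta0 delta_lt (gbd u) (gbd v) d1 d2 gt).
- by case: n; apply: (@uvec_inj _ th) => //; rewrite d1 d2.
Qed.

Lemma FC_tg u v th : FC u v th ->
  0 < sigma * tg g dg u (g v) /\ 0 < sigma * tg g dg v (g u).
Proof.
move=> /mid_inner im; have tu := tgi u im; have tv := tgi v im.
have e1 : tg g dg v (mid (g u) (g v)) = tg g dg v (g u) / 2 by rewrite /tg /mid /=; field.
have e2 : tg g dg u (mid (g u) (g v)) = tg g dg u (g v) / 2 by rewrite /tg /mid /=; field.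
rewrite e2 mulrA pmulr_lgt0 ?invr_gt0 ?ltr0n // in tu.
by rewrite e1 mulrA pmulr_lgt0 ?invr_gt0 ?ltr0n // in tv.
Qed.

Lemma FC_interior u v th w : FC u v th -> u < w < v -> dot (g w) (uvec th) < t_ th.
Proof.
move=> h /andP[w1 w2]; have [/andP[uv vL] n line [hin _]] := FCP h.
have le : dot (g w) (uvec th) <= t_ th by apply: hin; rewrite (ltW w1) (ltW w2).
rewrite lt_neqAle le andbT; apply/eqP => e.
case: (line _ (gbd w) e) => /esym/giz [k ek].
  have k0 : k = 0 by apply: iz0; lra.
  by move: ek w1; rewrite k0 mul0r addr0 => ->; rewrite ltxx.
have k0 : k = 0 by apply: iz0; lra.
by move: ek w2; rewrite k0 mul0r addr0 => ->; rewrite ltxx.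
Qed.

(** If opposite caps covered [K], the complement of the first arc, of affine length two thirds,
    would be contained in the second arc, of length one third. *)
Lemma FC_below_zero th : t_ th + t_ (th + pi) < 0.
Proof.
have [a [b [[Sab da db] /andP[ab1 ab2] _ _ [_ hout]]]] := chordP th.
have [a' [b' [[Sab' _ _] /andP[ab1' ab2'] _ _ [hin' hout']]]] := chordP (th + pi).
rewrite ltNge; apply/negP => ge.
have opp x : dot x (uvec (th + pi)) = - dot x (uvec th) by rewrite uvecDpi /dot /uvec /=; ring.
have inH w : b <= w <= a + L -> dot (g w) (uvec (th + pi)) <= t_ (th + pi).
  move=> /andP[w1 w2]; rewrite opp; apply: sum_ge0_opp ge _.
  have [e|ne] := eqVneq w b; first by rewrite e db.
  have [e|ne'] := eqVneq w (a + L); first by rewrite e gper da.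
  by apply/ltW/hout; rewrite !lt_neqAle w1 w2 eq_sym ne ne'.
have [k /andP[k1 k2]] := shift_window L0 (b - a').
pose c := b + k%:~R * L.
have Sc : S c = S b + k%:~R * Lam by rewrite /c Sz.
have c1 : a' <= c by rewrite /c; lra.
have c2 : c < a' + L by rewrite /c; lra.
have cb : c <= b'.
  rewrite leNgt; apply/negP => bc.
  have := hout' c; rewrite bc c2 => /(_ isT); rewrite ltNge => /negP; apply.
  by rewrite /c gz; apply: inH; rewrite lexx ltW.
(* [g] on [c, c + (a + L - b)] stays in the half-plane of [th + pi] *)
have top : c + (a + L - b) <= b'.
  rewrite leNgt; apply/negP => lt.
  pose w := Num.min (c + (a + L - b)) ((b' + (a' + L)) / 2).
  have w1 : b' < w by rewrite lt_min lt /=; lra.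
  have w2 : w < a' + L by rewrite gt_min; apply/orP; right; lra.
  have w3 : w <= c + (a + L - b) by rewrite ge_min lexx.
  have := hout' w; rewrite w1 w2 => /(_ isT); rewrite ltNge => /negP; apply.
  have -> : g w = g (w + (- k)%:~R * L) by rewrite gz.
  by apply: inH; rewrite mulrNz; rewrite /c in w3 cb; apply/andP; split; lra.
have e1 := S_nd c1; have e2 := S_nd top.
have e3 : S (c + (a + L - b)) = S a + Lam + k%:~R * Lam.
  have -> : c + (a + L - b) = (a + L) + k%:~R * L by rewrite /c; ring.
  by rewrite Sz Sper.
by move: Lam0; lra.
Qed.

Lemma FC_exists th : exists u v, FC u v th.
Proof. by have [a [b [h _ _ _ _]]] := chordP th; exists a, b. Qed.

Definition xm th : R * R :=
  xget (0, 0) [set p | exists u v, FC u v th /\ p = mid (g u) (g v)].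

Lemma xmE u v th : FC u v th -> xm th = mid (g u) (g v).
Proof.
move=> h; have : [set p | exists u v, FC u v th /\ p = mid (g u) (g v)] (xm th).
  by apply: xgetPex; exists (mid (g u) (g v)), u, v.
move=> [u' [v' [h' ->]]]; have [_ d1 d2] := h; have [_ n _ _] := FCP h.
exact: chord_unique h' d1 d2 n.
Qed.

Lemma dot_mid p q (v : R * R) : dot (mid p q) v = (dot p v + dot q v) / 2.
Proof. by rewrite /dot /mid /=; field. Qed.

Lemma flot_gap_continuous p : continuous (fun s => dot p (uvec s) - t_ s).
Proof.
move=> s; apply: cvgB; last exact: (flot_continuous cK delta0 delta_lt).
rewrite /dot /=; apply: cvgD; apply: cvgM; [exact: cvg_cst|exact: continuous_cos|exact: cvg_cst|exact: continuous_sin].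
Qed.

(** The curve crosses the line strictly near each chord end. It still does for nearby angles, so the
    intermediate value theorem finds both ends of the new chord in small windows around the old
    ones. *)
Lemma xm_cont v0 : continuous (fun th => dot (xm th) v0).
Proof.
move=> th; have [u [v h]] := FC_exists th.
have [/andP[uv vL] nuv line [hin hout]] := FCP h.
apply/cvgrPdist_lt => e e0; rewrite (xmE h).
have gc (w : R) : exists2 r, 0 < r & forall w', `|w' - w| < r -> `|dot (g w) v0 - dot (g w') v0| < e.
  have /cvgrPdist_lt/(_ _ e0)/nbhs_ballP[r r0 hr] := @gdot v0 w.
  by exists r => // w' hw; apply: hr; rewrite /ball /= distrC.
have [r1 r10 h1] := gc u; have [r2 r20 h2] := gc v.
have [q' [[w1 w2 w3 w4] le1 le2 [nu nv] nn]] := chord_window r10 r20 uv vL.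
have i1 : dot (g (u + q')) (uvec th) - t_ th < 0 by rewrite subr_lt0; exact: (FC_interior h).
have i2 : dot (g (v - q')) (uvec th) - t_ th < 0 by rewrite subr_lt0; exact: (FC_interior h).
have o1 : 0 < dot (g (u - q')) (uvec th) - t_ th by rewrite subr_gt0 -gper; exact: hout.
have o2 : 0 < dot (g (v + q')) (uvec th) - t_ th by rewrite subr_gt0; exact: hout.
have [s1 s10 k1] := neg_near (@flot_gap_continuous _ th) i1.
have [s2' s20 k2] := neg_near (@flot_gap_continuous _ th) i2.
have [s3 s30 k3] := pos_near (@flot_gap_continuous _ th) o1.
have [s4 s40 k4] := pos_near (@flot_gap_continuous _ th) o2.
apply/nbhs_ballP; exists (Num.min (Num.min s1 s2') (Num.min s3 s4)); first by rewrite /= !lt_min s10 s20 s30 s40.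
move=> s; rewrite /ball /= distrC !lt_min => /andP[/andP[/k1 j1 /k2 j2] /andP[/k3 j3 /k4 j4]].
rewrite subr_lt0 in j1; rewrite subr_lt0 in j2; rewrite subr_gt0 in j3; rewrite subr_gt0 in j4.
have [|u' uI du'] := @IVT R (fun w => dot (g w) (uvec s)) (u - q') (u + q') (t_ s) le1 (continuous_subspaceT (@gdot (uvec s))).
  by rewrite ge_min le_max (ltW j1) (ltW j3) !orbT.
have [|v' vI dv'] := @IVT R (fun w => dot (g w) (uvec s)) (v - q') (v + q') (t_ s) le2 (continuous_subspaceT (@gdot (uvec s))).
  by rewrite ge_min le_max (ltW j2) (ltW j4) !orbT.
rewrite in_itv /= in uI; rewrite in_itv /= in vI.
have n : g u' <> g v'.
  move=> /giz [k ek]; have := nn _ _ uI vI.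
  rewrite ek addrAC subrr add0r => /andP[kl kh].
  have k0 : k = 0 by apply: iz0 => //; apply: lt_trans kl; rewrite oppr_lt0.
  by move: kl; rewrite k0 mul0r ltxx.
have [a [b hs]] := FC_exists s.
rewrite (xmE hs) (chord_unique hs du' dv' n) !dot_mid.
by apply: half_dist; [apply: h1; exact: nu|apply: h2; exact: nv].
Qed.

Lemma gdotD (v : R * R) (u : R) : is_derive u 1 (fun w => dot (g w) v) (dot (dg u) v).
Proof.
have := is_derive_lin v.1 v.2 0 (g1D u) (g2D u).
have -> : (fun w => v.1 * (g w).1 + v.2 * (g w).2 + 0) = (fun w => dot (g w) v).
  by apply/funext => w; rewrite /dot; ring.
by have -> : v.1 * (dg u).1 + v.2 * (dg u).2 = dot (dg u) v by rewrite /dot; ring.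
Qed.

(** The curve enters the half-plane at [u], so [dg u] has non-positive component along [uvec th];
    comparison with the side of the tangent at [u] on which [g v] lies fixes the sign of [k]. *)
Lemma FC_sign u v th : FC u v th -> exists k, [/\ 0 < sigma * k,
  (g v).1 - (g u).1 = k * sin th & (g v).2 - (g u).2 = - (k * cos th)].
Proof.
move=> h; have [/andP[uv _] _ _ [hin _]] := FCP h; have [_ du dv] := h.
have le0 : dot (dg u) (uvec th) <= 0.
  by apply: (derive_right_le (gdotD (uvec th) u) uv) => w hw; rewrite du; exact: hin.
have [tg1 _] := FC_tg h.
pose e1 := (g v).1 - (g u).1; pose e2 := (g v).2 - (g u).2.
have eo : e1 * cos th + e2 * sin th = 0.
  have -> : e1 * cos th + e2 * sin th = dot (g v) (uvec th) - dot (g u) (uvec th).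
    by rewrite /e1 /e2 /dot /uvec /=; ring.
  by rewrite du dv subrr.
pose k := e1 * sin th - e2 * cos th.
have cs := sin2Dcos2 th.
have k1 : e1 = k * sin th.
  have -> : k * sin th = e1 * (sin th ^+ 2 + cos th ^+ 2) - cos th * (e1 * cos th + e2 * sin th) by rewrite /k; ring.
  by rewrite cs eo; ring.
have k2 : e2 = - (k * cos th).
  have -> : - (k * cos th) = e2 * (sin th ^+ 2 + cos th ^+ 2) - sin th * (e1 * cos th + e2 * sin th) by rewrite /k; ring.
  by rewrite cs eo; ring.
exists k; split => //.
have tgE : sigma * tg g dg u (g v) = (sigma * k) * - dot (dg u) (uvec th).
  by rewrite /tg -/e1 -/e2 k1 k2 /dot /uvec /=; ring.
rewrite tgE in tg1.
rewrite ltNge; apply/negP => sk; have : (sigma * k) * - dot (dg u) (uvec th) <= 0.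
  by apply: mulr_le0_ge0 => //; rewrite oppr_ge0.
by rewrite leNgt tg1.
Qed.

Lemma FC_side u v th : FC u v th -> exists2 k, 0 < sigma * k & forall x : R * R,
  ((g v).1 - (g u).1) * (x.2 - (g u).2) - ((g v).2 - (g u).2) * (x.1 - (g u).1) =
  k * (dot x (uvec th) - t_ th).
Proof.
move=> h; have [_ du _] := h; have [k [k0 e1 e2]] := FC_sign h.
by exists k => // x; rewrite e1 e2 -du /dot /uvec /=; ring.
Qed.

Lemma dot_uvec_derive p (s : R) : is_derive s 1 (fun s => dot p (uvec s)) (- det p (uvec s)).
Proof.
have := is_derive_lin p.1 p.2 0 (is_derive_cos s) (is_derive_sin s).
have -> : (fun w => p.1 * cos w + p.2 * sin w + 0) = (fun s => dot p (uvec s)).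
  by apply/funext => w; rewrite /dot /=; ring.
by have -> : p.1 * - sin s + p.2 * cos s = - det p (uvec s) by rewrite /det /=; ring.
Qed.

Lemma gap_derive p (s : R) : is_derive s 1 (fun s => dot p (uvec s) - t_ s)
  (det (xm s) (uvec s) - det p (uvec s)).
Proof.
have [u [v h]] := FC_exists s; have tD := mid_derive h; rewrite -(xmE h) in tD.
have := is_derive_lin 1 (-1) 0 (dot_uvec_derive p s) tD.
have -> : (fun w => 1 * dot p (uvec w) + -1 * t_ w + 0) = (fun s => dot p (uvec s) - t_ s).
  by apply/funext => w; ring.
by have -> : 1 * - det p (uvec s) + -1 * - det (xm s) (uvec s) = det (xm s) (uvec s) - det p (uvec s) by ring.
Qed.

(** One of the two normal directions at [g u] has [K] on its upper side, and the flotation line in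
    that direction passes through a point of [K]. *)
Lemma support_angle u : exists th, dot (g u) (uvec th) - t_ th <= 0.
Proof.
pose f s := dot (dg u) (uvec s).
have fc : continuous f by move=> s; exact: is_derive_continuous (dot_uvec_derive (dg u) s).
have fpi (s : R) : uvec (s + pi) = (- cos s, - sin s) by rewrite uvecDpi.
have p0 : (0 : R) <= 0 + pi by rewrite add0r; exact: pi_ge0.
have [|z _ fz] := @IVT R f 0 (0 + pi) 0 p0 (continuous_subspaceT fc).
  have -> : f (0 + pi) = - f 0 by rewrite /f fpi /dot /uvec /=; ring.
  by rewrite ge_min le_max oppr_le0 oppr_ge0; case: (leP 0 (f 0)) => h; rewrite ?h ?orbT ?(ltW h) ?orbT.
have dn := dg_norm dg0 u; set N := _ + _ in dn.
pose k := ((dg u).1 * sin z - (dg u).2 * cos z) / N.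
have kE : k * N = (dg u).1 * sin z - (dg u).2 * cos z by rewrite /k divfK // gt_eqF.
have side x : dot x (uvec z) - dot (g u) (uvec z) = k * tg g dg u x.
  apply: (mulIf (lt0r_neq0 dn)); rewrite mulrAC kE.
  have fz' : (dg u).1 * cos z + (dg u).2 * sin z = 0 by rewrite -fz /f /dot /uvec /=.
  have -> : ((dg u).1 * sin z - (dg u).2 * cos z) * tg g dg u x =
    (dot x (uvec z) - dot (g u) (uvec z)) * N - ((dg u).1 * (x.1 - (g u).1) + (dg u).2 * (x.2 - (g u).2)) * ((dg u).1 * cos z + (dg u).2 * sin z).
    by rewrite /tg /N /dot /uvec /=; ring.
  by rewrite fz' mulr0 subr0.
have sk x : K x -> (0 <= k * sigma -> 0 <= k * tg g dg u x) /\ (k * sigma <= 0 -> k * tg g dg u x <= 0).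
  move=> Kx; have := tgK u Kx.
  have -> : k * tg g dg u x = (k * sigma) * (sigma * tg g dg u x).
    by transitivity (sigma ^+ 2 * (k * tg g dg u x)); [rewrite s2 mul1r|ring].
  by move=> h; split => h'; [exact: mulr_ge0|exact: mulr_le0_ge0].
have [h|h] := leP 0 (k * sigma).
- exists z; have [x ix dx] := flot_inner cK delta0 delta_lt z.
  have [+ _] := sk x (interior_subset ix) => /(_ h); rewrite -side dx subr_ge0 => le.
  by rewrite subr_le0.
- exists (z + pi); have [x ix dx] := flot_inner cK delta0 delta_lt (z + pi).
  have [_ +] := sk x (interior_subset ix) => /(_ (ltW h)); rewrite -side -dx fpi => le.
  have -> : dot (g u) (- cos z, - sin z) - dot x (- cos z, - sin z) =
    dot x (uvec z) - dot (g u) (uvec z) by rewrite /dot /uvec /=; ring.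
  exact: le.
Qed.

(** The gap of [g u] to the line at angle [s] is non-positive at the support angle and positive half
    a turn away. At a zero crossed in the direction given by [sigma], the point is the first end of
    its chord; were it the second, the slope would have the other sign. *)
Lemma chord_from u : exists v th, FC u v th.
Proof.
have [th0 le0] := support_angle u.
have opp (x : R * R) (s : R) : dot x (uvec (s + pi)) = - dot x (uvec s).
  by rewrite uvecDpi /dot /uvec /=; ring.
have pp : (0 : R) < pi := pi_gt0 R.
have lt1 : th0 < th0 + pi by rewrite ltrDl.
have lt2 : th0 - pi < th0 by rewrite ltrBlDr ltrDl.
have up : 0 < dot (g u) (uvec (th0 + pi)) - t_ (th0 + pi).
  by rewrite opp; exact: neg_gap le0 (FC_below_zero th0).
have dn : 0 < dot (g u) (uvec (th0 - pi)) - t_ (th0 - pi).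
  have e : dot (g u) (uvec (th0 - pi)) = - dot (g u) (uvec th0).
    by have := opp (g u) (th0 - pi); rewrite subrK => ->; rewrite opprK.
  rewrite e; apply: neg_gap le0 _.
  by have := FC_below_zero (th0 - pi); rewrite subrK addrC.
have [z fz dz] : exists2 z, dot (g u) (uvec z) - t_ z = 0 &
    0 <= sigma * (det (xm z) (uvec z) - det (g u) (uvec z)).
  have [->|->] := sgn_cases s2.
  - have [z fz dz] := cross_up (gap_derive (g u)) lt1 le0 up.
    by exists z => //; rewrite mul1r.
  - have [z fz dz] := cross_down (gap_derive (g u)) lt2 le0 dn.
    by exists z => //; rewrite mulN1r oppr_ge0.
have [a [b h]] := FC_exists z; have [_ _ line _] := FCP h; have [Sab da db] := h.
have du : dot (g u) (uvec z) = t_ z by apply/eqP; rewrite -subr_eq0 fz.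
have [k [k0 e1 e2]] := FC_sign h.
case: (line _ (gbd u) du) => e.
  move/esym/giz: e => [j ej]; exists (b + j%:~R * L), z.
  by split; rewrite ?ej ?gz // !Sz Sab; ring.
exfalso; move: dz; rewrite (xmE h) e.
have -> : det (mid (g a) (g b)) (uvec z) - det (g b) (uvec z) =
   - (((g b).1 - (g a).1) * sin z - ((g b).2 - (g a).2) * cos z) / 2.
  by rewrite /det /mid /uvec /=; field.
rewrite e1 e2.
have -> : k * sin z * sin z - - (k * cos z) * cos z = k * (sin z ^+ 2 + cos z ^+ 2) by ring.
rewrite sin2Dcos2 mulr1; move: k0.
have -> : sigma * (- k / 2) = - (sigma * k) / 2 by field.
exact: neg_half.
Qed.

Variables (q : R * R) (lam : R).
Hypothesis lam0 : 0 < lam.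
Hypothesis hom : Pi_delta K delta =
  (fun x : R * R => (q.1 + lam * (x.1 - q.1), q.2 + lam * (x.2 - q.2))) @` Gamma_delta K delta.

Definition yh th : R * R := (q.1 + lam * ((fcen K delta th).1 - q.1),
  q.2 + lam * ((fcen K delta th).2 - q.2)).

Lemma dot_yh th (v : R * R) : dot (yh th) v = dot q v * (1 - lam) + lam * dot (fcen K delta th) v.
Proof. by rewrite /yh /dot /=; ring. Qed.

Lemma xm_dot th : dot (xm th) (uvec th) = t_ th.
Proof.
have [u [v h]] := FC_exists th; rewrite (xmE h) dot_mid; have [_ -> ->] := h.
by field.
Qed.

(** For the point [xm th] the gap to the lines vanishes to first order at [th], which is the
    envelope condition. *)
Lemma xm_in_hom th : exists ph, xm th = yh ph.
Proof.
have : Pi_delta K delta (xm th).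
  have dD := gap_derive (xm th) th; rewrite subrr in dD.
  exists th; split; first by rewrite xm_dot subrr.
    exact: ex_derive.
  by rewrite derive1E; exact: derive_val.
by rewrite hom => -[c [ph ->] e]; exists ph; rewrite -e.
Qed.

Local Opaque fcen.

Lemma yh_min a b : dot (yh a) (uvec a) <= dot (yh b) (uvec a) /\
  (dot (yh a) (uvec a) = dot (yh b) (uvec a) -> uvec a = uvec b).
Proof.
have [h1 h2] := fcen_min cK delta0 delta_lt a b.
have [k1 k2] := homothety_min lam0 (dot_yh a (uvec a)) (dot_yh b (uvec a)) h1.
by split; [exact: k1|move=> e; exact: h2 (k2 e)].
Qed.

Lemma xm_eq th : xm th = yh th.
Proof.
apply: (@envelope_is_min R t_ xm yh).
- exact: xm_dot.
- by move=> s; have [u [v h]] := FC_exists s; rewrite (xmE h); exact: mid_derive h.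
- exact: xm_cont.
- move=> v; have -> : (fun s => dot (yh s) v) = (fun s => dot q v * (1 - lam) + lam * dot (fcen K delta s) v).
    by apply/funext => s; exact: dot_yh.
  move=> s; apply: cvgD; first exact: cvg_cst.
  by apply: cvgM; [exact: cvg_cst|exact: (fcen_dot_continuous cK delta0 delta_lt)].
- by move=> s; rewrite /yh fcen_periodic.
- exact: yh_min.
- exact: xm_in_hom.
- exact: FC_below_zero.
Qed.

(** Midpoints inherit the support property of the centroids through [xm_eq]. *)
Lemma flot_le_xm th th' : t_ th <= dot (xm th') (uvec th).
Proof. by rewrite -xm_dot (xm_eq th) (xm_eq th'); have [] := yh_min th th'. Qed.

Lemma S_inj_at u x : F u != 0 -> S x = S u -> x = u.
Proof.
move=> Fu e; have Fp : 0 < F u by rewrite lt_neqAle eq_sym Fu F0.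
have [lt|gt|//] := ltgtP x u; exfalso.
- suff : -1 * (-1 * F u + 0 * F u) <= 0 by lra.
  apply: (derive_acc (is_derive_lin (-1) 0 0 (SD u) (SD u))); first by rewrite sqrrN expr1n.
  move=> r r0; pose m := Num.min r (u - x).
  have m0 : 0 < m by rewrite lt_min r0 subr_gt0.
  have m1 : m <= r by rewrite ge_min lexx.
  have m2 : m <= u - x by rewrite ge_min lexx orbT.
  exists (u - m / 2); first by apply/andP; split; lra.
  have : S x <= S (u - m / 2) by apply: S_nd; lra.
  by lra.
- suff : F u <= 0 by lra.
  apply: (derive_right_le (SD u) gt) => w /andP[_ wx]; rewrite -e; exact: S_nd.
Qed.

(** The third chord ends at [u + L] instead of [u], so that increments of [S] along the triangle add
    up on the real line. *)
Definition CT u v w := exists th1 th2 th3, [/\ FC u v th1, FC v w th2 & FC w (u + L) th3].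

Lemma CT_rot u v w : CT u v w -> CT v w (u + L).
Proof. by move=> [t1 [t2 [t3 [h1 h2 h3]]]]; exists t2, t3, t1; split; [exact: h2|exact: h3|exact: FC_shift]. Qed.

Lemma CT_S u v w : CT u v w -> S v = S u + Lam / 3 /\ S w = S u + Lam / 3 + Lam / 3.
Proof. by move=> [t1 [t2 [t3 [[h1 _ _] [h2 _ _] _]]]]; rewrite h2 h1. Qed.

(** After three chords [S] has grown by exactly [Lam], so the end point lies on the level of
    [u + L]; injectivity of [S] at [u] identifies the two. *)
Lemma CT_exists u : (forall x, S x = S u -> x = u) -> exists v w, CT u v w.
Proof.
move=> inj; have [v [t1 h1]] := chord_from u; have [w [t2 h2]] := chord_from v.
have [x [t3 h3]] := chord_from w.
have xL : x = u + L.
  suff : x - L = u by move=> <-; ring.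
  apply: inj; have := Sper (x - L); rewrite subrK.
  by case: h1 => e1 _ _; case: h2 => e2 _ _; case: h3 => e3 _ _; rewrite e3 e2 e1; lra.
by exists v, w, t1, t2, t3; split; [exact: h1|exact: h2|rewrite -xL].
Qed.

Lemma CT_above u v w th th' th'' : FC u v th -> FC v w th' -> FC w (u + L) th'' ->
  t_ th < dot (g w) (uvec th).
Proof.
move=> h1 h2 h3; have [_ _ _ [_ hout]] := FCP h1.
have [/andP[vw _] _ _ _] := FCP h2; have [/andP[wu _] _ _ _] := FCP h3.
by apply: hout; rewrite vw.
Qed.

Lemma nonpos_comb (P Q X Y Z : R) : 0 < P -> 0 < Q -> X <= 0 -> Y <= 0 -> 0 <= Z ->
  Z = X * P + Y * Q -> X = 0 /\ Y = 0.
Proof.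
move=> P0 Q0 X0 Y0 Z0 e.
have h1 : X * P <= 0 by rewrite mulr_le0_ge0 // ltW.
have h2 : Y * Q <= 0 by rewrite mulr_le0_ge0 // ltW.
have e1 : X * P = 0 by lra.
have e2 : Y * Q = 0 by lra.
move/eqP: e1; rewrite mulf_eq0 (gt_eqF P0) orbF => /eqP ->.
by move/eqP: e2; rewrite mulf_eq0 (gt_eqF Q0) orbF => /eqP ->.
Qed.

Lemma cap_sum (x a b c d x' a' b' c' d' e : R) : x = a + b + c + d -> x = x' -> a = a' ->
  b = b' -> c = c' -> d = d' -> a' = e -> b' = e -> c' = e -> x' = e + e + e + d'.
Proof. by move=> -> <- -> -> -> -> -> -> ->. Qed.

Lemma moment_sum (l dl s r A B C D x x1 x2 x3 a b c : R) : l != 0 -> x = A + B + C + D ->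
  A = dl * (r + (x1 - r) / l) -> B = dl * (r + (x2 - r) / l) -> C = dl * (r + (x3 - r) / l) ->
  D = s * ((a + b + c) / 3) -> x1 = (a + b) / 2 -> x2 = (b + c) / 2 -> x3 = (c + a) / 2 ->
  (3 * dl / l + s) * (a + b + c) = 3 * (x - 3 * dl * (r - r / l)).
Proof. by move=> ln -> -> -> -> -> -> -> ->; field. Qed.

Lemma cap_vertex u v w th1 th2 x : FC u v th1 -> FC v w th2 ->
  t_ th1 < dot (g w) (uvec th1) -> K x ->
  dot x (uvec th1) <= t_ th1 -> dot x (uvec th2) <= t_ th2 -> x = g v.
Proof.
move=> h1 h2 c1 Kx x1 x2.
have [k1 k10 sd1] := FC_side h1; have [k2 k20 sd2] := FC_side h2.
have [_ tga] := FC_tg h1; have [tgc _] := FC_tg h2; have tgx := tgK v Kx.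
pose d1 := ((g v).1 - (g u).1) * (x.2 - (g u).2) - ((g v).2 - (g u).2) * (x.1 - (g u).1).
pose d2 := ((g w).1 - (g v).1) * (x.2 - (g v).2) - ((g w).2 - (g v).2) * (x.1 - (g v).1).
pose T := ((g v).1 - (g u).1) * ((g w).2 - (g u).2) - ((g v).2 - (g u).2) * ((g w).1 - (g u).1).
have e1 : d1 = k1 * (dot x (uvec th1) - t_ th1) := sd1 x.
have e2 : d2 = k2 * (dot x (uvec th2) - t_ th2) := sd2 x.
have eT : T = k1 * (dot (g w) (uvec th1) - t_ th1) := sd1 (g w).
have sT : 0 < sigma * T by rewrite eT mulrA mulr_gt0 // subr_gt0.
have sd1' : sigma * d1 <= 0 by rewrite e1 mulrA; apply: mulr_ge0_le0; [exact: ltW|rewrite subr_le0; exact: x1].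
have sd2' : sigma * d2 <= 0 by rewrite e2 mulrA; apply: mulr_ge0_le0; [exact: ltW|rewrite subr_le0; exact: x2].
have [||z2 z1] := @nonpos_comb _ _ (sigma * d2) (sigma * d1) ((sigma * tg g dg v x) * (sigma * T)) tga tgc sd2' sd1'.
- by rewrite mulr_ge0 // ltW.
- rewrite /d1 /d2 /T /tg.
  by ring.
have s0 : sigma != 0 by apply: contraTneq sT => ->; rewrite mul0r ltxx.
have T0 : T != 0 by apply: contraTneq sT => ->; rewrite mulr0 ltxx.
have d10 : d1 = 0 by apply: (mulfI s0); rewrite mulr0.
have d20 : d2 = 0 by apply: (mulfI s0); rewrite mulr0.
have i1 : T * (x.1 - (g v).1) = d2 * ((g u).1 - (g v).1) + d1 * ((g w).1 - (g v).1) by rewrite /d1 /d2 /T; ring.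
have i2 : T * (x.2 - (g v).2) = d2 * ((g u).2 - (g v).2) + d1 * ((g w).2 - (g v).2) by rewrite /d1 /d2 /T; ring.
rewrite d10 d20 !mul0r addr0 in i1 i2.
rewrite [x]surjective_pairing [g v]surjective_pairing; congr (_, _); apply/eqP; rewrite -subr_eq0.
  by apply/eqP/(mulfI T0); rewrite mulr0.
by apply/eqP/(mulfI T0); rewrite mulr0.
Qed.

Lemma caps_overlap u v w th1 th2 : FC u v th1 -> FC v w th2 ->
  t_ th1 < dot (g w) (uvec th1) ->
  ar (K `&` halfplane th1 (t_ th1) `&` halfplane th2 (t_ th2)) = 0.
Proof.
move=> h1 h2 c1; have [m _] := bmsetI (bmsetI (bmset_body cK) (measurable_halfplane th1 (t_ th1)))
  (measurable_halfplane th2 (t_ th2)).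
apply: (ar_line_body cK (th := th1) (t := t_ th1) m); first by move=> x [[]].
by move=> x [[Kx x1] x2]; rewrite (cap_vertex h1 h2 c1 Kx x1 x2); case: h1.
Qed.

Transparent fcap.

(** The homothety read backwards: the centroid of the cap is [q] plus the vector from [q] to the
    midpoint divided by [lam]. *)
Lemma cap_moment th : aint (K `&` halfplane th (t_ th)) 1 0 0 = delta * (q.1 + ((xm th).1 - q.1) / lam) /\
  aint (K `&` halfplane th (t_ th)) 0 1 0 = delta * (q.2 + ((xm th).2 - q.2) / lam).
Proof.
have ln : lam != 0 by exact: lt0r_neq0.
have h1 := dot_fcen cK delta0 delta_lt th (1, 0); have h2 := dot_fcen cK delta0 delta_lt th (0, 1).
rewrite xm_eq /yh /=; split.
  have -> : q.1 + (q.1 + lam * ((fcen K delta th).1 - q.1) - q.1) / lam = dot (fcen K delta th) (1, 0).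
    by rewrite [q.1 + lam * _]addrC addrK [lam * _]mulrC mulfK // /dot /=; ring.
  by rewrite h1.
have -> : q.2 + (q.2 + lam * ((fcen K delta th).2 - q.2) - q.2) / lam = dot (fcen K delta th) (0, 1).
  by rewrite [q.2 + lam * _]addrC addrK [lam * _]mulrC mulfK // /dot /=; ring.
by rewrite h2.
Qed.

Lemma CT_sign u v w : CT u v w -> 0 < sigma *
  (((g v).1 - (g u).1) * ((g w).2 - (g u).2) - ((g v).2 - (g u).2) * ((g w).1 - (g u).1)).
Proof.
move=> [t1 [t2 [t3 [h1 h2 h3]]]]; have c := CT_above h1 h2 h3.
by have [k k0 ->] := FC_side h1; rewrite mulrA mulr_gt0 // subr_gt0.
Qed.

Lemma convex3 (a b c : R * R) (x y z : R) : K a -> K b -> K c -> 0 < x -> 0 < y -> 0 < z ->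
  x + y + z = 1 -> K (x * a.1 + y * b.1 + z * c.1, x * a.2 + y * b.2 + z * c.2).
Proof.
move=> Ka Kb Kc x0 y0 z0 e.
have yz : 0 < y + z by rewrite addr_gt0.
have h : K ((y / (y + z)) * b.1 + (1 - y / (y + z)) * c.1, (y / (y + z)) * b.2 + (1 - y / (y + z)) * c.2).
  apply: (body_convex cK) => //; apply/andP; split; first by rewrite divr_ge0 // ltW.
  by rewrite ler_pdivrMr //; lra.
have x01 : 0 <= x <= 1 by apply/andP; split; lra.
have e1 : 1 - x = y + z by lra.
have := body_convex cK Ka h x01; rewrite e1 /=.
by congr (K (_, _)); field; exact: lt0r_neq0.
Qed.

(** [K] consists of three caps and the triangle. The cap moments depend on the sum of the three
    chord midpoints, which is the sum of the vertices, and so does the moment of the triangle; the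
    moment of [K] thus prescribes that sum. *)
Lemma CT_centroid u v w : CT u v w -> [/\ 0 < ar K - 3 * delta,
   ar K - 3 * delta <= sigma *
    (((g v).1 - (g u).1) * ((g w).2 - (g u).2) - ((g v).2 - (g u).2) * ((g w).1 - (g u).1)),
   (3 * delta / lam + (ar K - 3 * delta)) * ((g u).1 + (g v).1 + (g w).1) =
     3 * (aint K 1 0 0 - 3 * delta * (q.1 - q.1 / lam)) &
   (3 * delta / lam + (ar K - 3 * delta)) * ((g u).2 + (g v).2 + (g w).2) =
     3 * (aint K 0 1 0 - 3 * delta * (q.2 - q.2 / lam))].
Proof.
move=> ct; have sT := CT_sign ct; move: ct => [t1 [t2 [t3 [h1 h2 h3]]]].
have h1' := FC_shift h1; have h2' := FC_shift h2.
have c1 := CT_above h1 h2 h3; have c2 := CT_above h2 h3 h1'; have c3 := CT_above h3 h1' h2'.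
have o12 := caps_overlap h1 h2 c1; have o23 := caps_overlap h2 h3 c2.
have o13 := caps_overlap h3 h1' c3; rewrite setIAC in o13.
have [k1 k10 sd1] := FC_side h1; have [k2 k20 sd2] := FC_side h2.
move: (FC_side h3); rewrite gper => -[k3 k30 sd3].
set a := g u in sT sd1 sd2 sd3 *; set b := g v in sT sd1 sd2 sd3 *; set c := g w in sT sd1 sd2 sd3 *.
set T := ((b.1 - a.1) * (c.2 - a.2) - (b.2 - a.2) * (c.1 - a.1)) in sT *.
have s0 : sigma != 0 by apply: contraTneq sT => ->; rewrite mul0r ltxx.
have T0 : T != 0 by apply: contraTneq sT => ->; rewrite mulr0 ltxx.
pose H th := halfplane th (t_ th).
pose Tri := K `\` H t1 `\` H t2 `\` H t3.
have bK := bmset_body cK; have mH th : measurable (H th : set (measurableTypeR R * measurableTypeR R)).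
  exact: measurable_halfplane.
have bT : bmset Tri by apply: bmsetD => //; apply: bmsetD => //; apply: bmsetD.
have quo (k X : R) : 0 < sigma * k -> 0 < k * X / T <-> 0 < X.
  move=> k0; have -> : k * X / T = (sigma * k) * X / (sigma * T) by field; rewrite s0 T0.
  by rewrite pmulr_lgt0 ?invr_gt0 // pmulr_rgt0.
have pos th (y : R * R) : ~ H th y -> 0 < dot y (uvec th) - t_ th.
  by move=> n; rewrite subr_gt0 ltNge; apply/negP => le; apply: n; exact: le.
have neg th (y : R * R) : 0 < dot y (uvec th) - t_ th -> ~ H th y.
  by rewrite subr_gt0 ltNge => /negP lt le; apply: lt; exact: le.
have Ka : K a by have /(boundaryP cK)[] := gbd u.
have Kb : K b by have /(boundaryP cK)[] := gbd v.
have Kc : K c by have /(boundaryP cK)[] := gbd w.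
have hT x : Tri x <-> [/\ 0 < ((c.1 - b.1) * (x.2 - b.2) - (c.2 - b.2) * (x.1 - b.1)) / T,
    0 < ((a.1 - c.1) * (x.2 - c.2) - (a.2 - c.2) * (x.1 - c.1)) / T &
    0 < ((b.1 - a.1) * (x.2 - a.2) - (b.2 - a.2) * (x.1 - a.1)) / T].
  split.
    move=> [[[Kx n1] n2] n3]; rewrite sd1 sd2 sd3.
    by split; [exact: (quo k2 _ k20).2 (pos _ _ n2)|exact: (quo k3 _ k30).2 (pos _ _ n3)|
      exact: (quo k1 _ k10).2 (pos _ _ n1)].
  move=> [l2 l3 l1]; have Kx : K x.
    have := convex3 Ka Kb Kc l2 l3 l1; rewrite [x]surjective_pairing /=.
    have e : ((c.1 - b.1) * (x.2 - b.2) - (c.2 - b.2) * (x.1 - b.1)) / T +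
      ((a.1 - c.1) * (x.2 - c.2) - (a.2 - c.2) * (x.1 - c.1)) / T +
      ((b.1 - a.1) * (x.2 - a.2) - (b.2 - a.2) * (x.1 - a.1)) / T = 1.
      by rewrite /T; field.
    move=> /(_ e); congr (K (_, _)); rewrite /T; field; exact: T0.
  rewrite sd1 in l1; rewrite sd2 in l2; rewrite sd3 in l3.
  split; last exact: (neg _ _ ((quo k3 _ k30).1 l3)).
  split; last exact: (neg _ _ ((quo k2 _ k20).1 l2)).
  split; first exact: Kx.
  exact: (neg _ _ ((quo k1 _ k10).1 l1)).
have [m1 m2] := triangle_moment T0 bT hT.
have /andP[ar0 arT] := triangle_area_bounds s2 sT bT hT.
have three p' q' r' := aint_three p' q' r' bK (mH t1) (mH t2) (mH t3) o12 o13 o23.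
have capar th : ar (K `&` H th) = delta by exact: (flot_area cK delta0 delta_lt).
have bI th : bmset (K `&` H th) := bmsetI bK (mH th).
have arE : ar K = delta + delta + delta + ar Tri.
  exact: (cap_sum (three 0 0 1) (aint1 bK) (aint1 (bI t1)) (aint1 (bI t2)) (aint1 (bI t3))
    (aint1 bT) (capar t1) (capar t2) (capar t3)).
have sE : ar K - 3 * delta = ar Tri by rewrite arE; ring.
have ln : lam != 0 by exact: lt0r_neq0.
have [p1 p2] := cap_moment t1; have [q1 q2] := cap_moment t2; have [r1 r2] := cap_moment t3.
have x1 := xmE h1; have x2 := xmE h2; have x3 := xmE h3; rewrite gper in x3.
rewrite sE; split; [exact: ar0|exact: arT| |].
  exact: (moment_sum ln (three 1 0 0) p1 q1 r1 m1 (congr1 fst x1) (congr1 fst x2) (congr1 fst x3)).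
exact: (moment_sum ln (three 0 1 0) p2 q2 r2 m2 (congr1 snd x1) (congr1 snd x2) (congr1 snd x3)).
Qed.

Lemma CT_sum u v w u' v' w' : CT u v w -> CT u' v' w' ->
  (g u).1 + (g v).1 + (g w).1 = (g u').1 + (g v').1 + (g w').1 /\
  (g u).2 + (g v).2 + (g w).2 = (g u').2 + (g v').2 + (g w').2.
Proof.
move=> /CT_centroid [s0 _ e1 e2] /CT_centroid [_ _ e1' e2'].
have c0 : 3 * delta / lam + (ar K - 3 * delta) != 0.
  by apply: lt0r_neq0; rewrite addr_gt0 // divr_gt0 // mulr_gt0.
by split; apply: (mulfI c0); rewrite ?e1 ?e2 ?e1' ?e2'.
Qed.

(** By the support property the midpoint of the chord of [u'] and [v'] is not below the line of [u]
    and [v]; as the vertex sums agree, [g w'] cannot be higher than [g w]. *)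
Lemma CT_opposite u v w u' v' w' : CT u v w -> CT u' v' w' -> sigma *
  (((g v).1 - (g u).1) * ((g w').2 - (g w).2) - ((g v).2 - (g u).2) * ((g w').1 - (g w).1)) <= 0.
Proof.
move=> ct ct'; have [e1 e2] := CT_sum ct ct'.
move: ct ct' => [t1 [t2 [t3 [h1 _ _]]]] [t1' [_ [_ [h1' _ _]]]].
have [k k0 sd] := FC_side h1.
have -> : ((g v).1 - (g u).1) * ((g w').2 - (g w).2) - ((g v).2 - (g u).2) * ((g w').1 - (g w).1) =
  k * (dot (g w') (uvec t1) - dot (g w) (uvec t1)).
  have := sd (g w'); have := sd (g w) => H1 H2.
  have -> : k * (dot (g w') (uvec t1) - dot (g w) (uvec t1)) =
    k * (dot (g w') (uvec t1) - t_ t1) - k * (dot (g w) (uvec t1) - t_ t1) by ring.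
  by rewrite -H1 -H2; ring.
rewrite mulrA; apply: mulr_ge0_le0; first exact: ltW.
have := flot_le_xm t1 t1'; rewrite (xmE h1') dot_mid; have [_ d1 d2] := h1 => le.
have E : dot (g u) (uvec t1) + dot (g v) (uvec t1) + dot (g w) (uvec t1) =
  dot (g u') (uvec t1) + dot (g v') (uvec t1) + dot (g w') (uvec t1).
  have -> : dot (g u) (uvec t1) + dot (g v) (uvec t1) + dot (g w) (uvec t1) =
    ((g u).1 + (g v).1 + (g w).1) * cos t1 + ((g u).2 + (g v).2 + (g w).2) * sin t1 by rewrite /dot /uvec /=; ring.
  by rewrite e1 e2 /dot /uvec /=; ring.
by rewrite d1 d2 in E; exact: opposite_le E le.
Qed.

Hypothesis dgper : forall u, dg (u + L) = dg u.
Hypothesis Fdet : forall w, F w = 0 -> det (dg w) (ddg w) = 0.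

Lemma S_low s : exists x, S x <= s.
Proof.
pose X := `|(S 0 - s) / Lam|; pose n := Num.bound X.
have Xn : X < n%:R by exact: archi_boundP (normr_ge0 _).
exists (0 + (- n%:Z)%:~R * L); rewrite Sz mulrNz -pmulrn.
have : (S 0 - s) / Lam <= n%:R by apply: le_trans (ler_norm _) (ltW Xn).
by rewrite ler_pdivrMr //; lra.
Qed.

Lemma S_high s : exists x, s < S x.
Proof.
pose X := `|(s - S 0) / Lam|; pose n := Num.bound X.
have Xn : X < n%:R by exact: archi_boundP (normr_ge0 _).
exists (0 + n%:Z%:~R * L); rewrite Sz -pmulrn.
have : (s - S 0) / Lam < n%:R by apply: le_lt_trans (ler_norm _) Xn.
by rewrite ltr_pdivrMr //; lra.
Qed.

Lemma periodic_bounded (f : R -> R) : continuous f -> (forall u, f (u + L) = f u) ->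
  exists N, forall u, `|f u| <= N.
Proof.
move=> fc fp.
have pz (k : int) u : f (u + k%:~R * L) = f u.
  have := @gperz R (fun u => (f u, f u)) L _ k u; move=> /(_ _)/(congr1 fst) /=; apply.
  by move=> w; rewrite fp.
have nc : {within `[0, L], continuous (fun u => `|f u|)}.
  by apply: continuous_subspaceT => u; apply: cvg_norm; exact: fc.
have [c _ hc] := EVT_max (ltW L0) nc.
exists `|f c| => u; have [k /andP[k1 k2]] := shift_window L0 u.
by rewrite -(pz k u); apply: hc; rewrite in_itv /= k1 ltW.
Qed.

Lemma flotation_ellipse : is_ellipse K.
Proof.
(* [S] grows over a period, so its density is non-zero somewhere; the triangle started there is the
   reference for all constants. *)
have [u0 Fu0] : exists u0, F u0 != 0.
  have [c _ e] := mvt SD L0; exists c; apply/eqP => F0'; move: e.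
  by rewrite F0' mul0r -[L]add0r Sper => e; move: Lam0; lra.
have [v0 [w0 ct0]] := CT_exists (fun x => @S_inj_at u0 x Fu0).
have [s00 _ _ _] := CT_centroid ct0.
pose co := 3 * delta / lam + (ar K - 3 * delta).
have co0 : co != 0 by apply: lt0r_neq0; rewrite addr_gt0 // divr_gt0 // mulr_gt0.
pose G1 := (g u0).1 + (g v0).1 + (g w0).1; pose G2 := (g u0).2 + (g v0).2 + (g w0).2.
have CT_sum' u v w : CT u v w -> (g u).1 + (g v).1 + (g w).1 = G1 /\ (g u).2 + (g v).2 + (g w).2 = G2.
  by move=> ct; have := CT_sum ct ct0.
have CT_T' u v w : CT u v w -> ar K - 3 * delta <= sigma * dt (g u) (g v) (g u) (g w).
  by move=> /CT_centroid [].
have [D _ hD] := body_bounded cK.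
have gD u : `|(g u).1| <= D /\ `|(g u).2| <= D by apply: hD; have /(boundaryP cK)[] := gbd u.
have [N1 hN1] := periodic_bounded (dg1c dg1D) (fun u => congr1 fst (dgper u)).
have [N2 hN2] := periodic_bounded (dg2c dg2D) (fun u => congr1 snd (dgper u)).
have dgN u : `|(dg u).1| <= Num.max N1 N2 /\ `|(dg u).2| <= Num.max N1 N2.
  by rewrite !le_max hN1 hN2 orbT.
have flat al be : al < be -> (forall w, al <= w <= be -> F w = 0) ->
  exists2 c, 0 < c & [/\ (g be).1 - (g al).1 = c * (dg al).1,
    (g be).2 - (g al).2 = c * (dg al).2 &
    exists2 d, 0 < d & (dg be).1 = d * (dg al).1 /\ (dg be).2 = d * (dg al).2].
  move=> ab h; apply: (flat_straight g1D g2D dg1D dg2D dg0 ab) => w hw.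
  exact: Fdet (h w hw).
have str x y : x < y -> S x < S y.
  apply: (S_strict (g := g) (dg := dg) (S := S) (F := F) (L := L) (Lam := Lam) (sigma := sigma)
    (s0 := ar K - 3 * delta) (G1 := G1) (G2 := G2) (CT := CT)); first
    [eassumption|exact: S_nd|exact: S_low|exact: S_high|exact: S_inj_at|exact: CT_rot|exact: CT_S|exact: CT_opposite|exact: CT_exists].
have sinj u x : S x = S u -> x = u.
  by move=> e; have [/str|/str|//] := ltgtP x u; rewrite e ltxx.
have M u v w : CT u v w -> _ := fun h =>
  CT_moments g1D g2D gper dg0 gD dgN SD S_nd S_low S_high Sper S_inj_at s2 s00 flat
   CT_rot CT_S CT_sum' CT_opposite CT_T' CT_exists h ct0.
have rt2 : (Num.sqrt 3 : R) ^+ 2 = 3 by rewrite sqr_sqrtr.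
set rt := Num.sqrt 3 in rt2.
have rt0 : rt != 0 by apply/eqP => e; move: rt2; rewrite e expr0n /= => /esym/eqP; rewrite pnatr_eq0.
pose G := (G1 / 3, G2 / 3).
pose P := ((g u0).1 - G.1, (g u0).2 - G.2).
pose Q := (((g v0).1 - (g w0).1) / rt, ((g v0).2 - (g w0).2) / rt).
pose Dn := P.1 * Q.2 - Q.1 * P.2.
have Dn0 : Dn != 0.
  have sT := CT_sign ct0; set T := _ - _ in sT.
  have E : 3 * rt * Dn = 2 * T by rewrite /Dn /P /Q /G /= /G1 /G2 /T; field.
  apply/eqP => e; move: E sT; rewrite e mulr0 => E.
  have -> : T = 0 by lra.
  by rewrite mulr0 ltxx.
pose nX (x : R * R) := (x.1 - G.1) * Q.2 - (x.2 - G.2) * Q.1.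
pose nY (x : R * R) := P.1 * (x.2 - G.2) - P.2 * (x.1 - G.1).
pose nrm x := nX x ^+ 2 + nY x ^+ 2.
(* Now that [S] is injective, every boundary point is the vertex of a closed triangle. *)
have bN p : boundary K p -> nrm p = Dn ^+ 2.
  rewrite -gsurj => -[u _ <-]; have [v [w ct]] := CT_exists (sinj u).
  have [m1 m2 m3] := M _ _ _ ct; have [e1 e2] := CT_sum' _ _ _ ct.
  exact: (@steiner_ellipse _ (g u0) (g v0) (g w0) (g u) (g v) (g w) rt rt2 rt0 e1 e2 m1 m2 m3).
have Kg u : K (g u) by have /(boundaryP cK)[] := gbd u.
have KG : K G.
  have := convex3 (Kg u0) (Kg v0) (Kg w0) (x := 1 / 3) (y := 1 / 3) (z := 1 / 3).
  rewrite !divr_gt0 // => /(_ isT isT isT) H.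
  have : K (1 / 3 * (g u0).1 + 1 / 3 * (g v0).1 + 1 / 3 * (g w0).1,
     1 / 3 * (g u0).2 + 1 / 3 * (g v0).2 + 1 / 3 * (g w0).2) by apply: H; field.
  by congr (K (_, _)); rewrite /G1 /G2; field.
have nrm_scale (x : R * R) (s : R) : nrm (G.1 + s * (x.1 - G.1), G.2 + s * (x.2 - G.2)) = s ^+ 2 * nrm x.
  by rewrite /nrm /nX /nY /=; ring.
have nrm0 x : 0 <= nrm x by rewrite addr_ge0 // sqr_ge0.
have Dp : 0 < Dn ^+ 2 by rewrite lt_neqAle sqr_ge0 eq_sym sqrf_eq0 Dn0.
have dir (x : R * R) : nrm x != 0 -> (x.1 - G.1, x.2 - G.2) != 0.
  apply: contraNneq => -[h1 h2]; by rewrite /nrm /nX /nY h1 h2 !mul0r !mulr0 !subrr expr0n addr0.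
exists G, P.1, Q.1, P.2, Q.2; split; first exact: Dn0.
apply/seteqP; split => x.
- move=> Kx; have le : nrm x <= Dn ^+ 2.
    rewrite leNgt; apply/negP => lt.
    have np : 0 < nrm x by exact: lt_trans Dp lt.
    (* Leaving [K] from [x] away from [G] leads to a boundary point with at least the norm of [x],
       which would be off the ellipse. *)
    have [s s0 bd] := boundary_exit cK Kx (dir x (lt0r_neq0 np)).
    have := bN _ bd; have -> : (x.1 + s * (x.1 - G.1, x.2 - G.2).1, x.2 + s * (x.1 - G.1, x.2 - G.2).2) =
       (G.1 + (1 + s) * (x.1 - G.1), G.2 + (1 + s) * (x.2 - G.2)) by congr (_, _) => /=; ring.
    rewrite nrm_scale => e; move: lt; rewrite -e ltNge => /negP; apply.
    by rewrite ler_peMl // exprn_ege1 // lerDl.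
  exists (nX x / Dn, nY x / Dn) => /=.
    rewrite !expr_div_n -mulrDl ler_pdivrMr // mul1r; exact: le.
  have h1 : P.1 * nX x + Q.1 * nY x = (x.1 - G.1) * Dn by rewrite /nX /nY /Dn; ring.
  have h2 : P.2 * nX x + Q.2 * nY x = (x.2 - G.2) * Dn by rewrite /nX /nY /Dn; ring.
  have e1 : G.1 + P.1 * (nX x / Dn) + Q.1 * (nY x / Dn) = x.1.
    by rewrite -addrA !mulrA -mulrDl h1 mulfK // addrC subrK.
  have e2 : G.2 + P.2 * (nX x / Dn) + Q.2 * (nY x / Dn) = x.2.
    by rewrite -addrA !mulrA -mulrDl h2 mulfK // addrC subrK.
  by rewrite [RHS]surjective_pairing -e1 -e2.
- move=> [[X Y] /= XY <-]; set z := (_, _).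
  have nz : nrm z = Dn ^+ 2 * (X ^+ 2 + Y ^+ 2) by rewrite /nrm /nX /nY /z /Dn /=; ring.
  have [e|ne] := eqVneq (nrm z) 0.
    have XY0 : X ^+ 2 + Y ^+ 2 = 0 by apply: (mulfI (lt0r_neq0 Dp)); rewrite mulr0 -nz.
    have X0 : X = 0 by apply/eqP; rewrite -sqrf_eq0; apply/eqP; have := sqr_ge0 X; have := sqr_ge0 Y; lra.
    have Y0 : Y = 0 by apply/eqP; rewrite -sqrf_eq0; apply/eqP; have := sqr_ge0 X; have := sqr_ge0 Y; lra.
    have -> : z = G by rewrite /z X0 Y0 !mulr0 !addr0.
    exact: KG.
  (* The ray from [G] through [z] leaves [K] on the ellipse, hence not before [z]; convexity then
     puts [z] into [K]. *)
  have [s s0 bd] := boundary_exit cK KG (dir z ne).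
  have e : s ^+ 2 * nrm z = Dn ^+ 2 by rewrite -nrm_scale; exact: bN _ bd.
  have np : 0 < nrm z by rewrite lt_neqAle eq_sym ne nrm0.
  have s1 : 1 <= s.
    rewrite leNgt; apply/negP => lt.
    have h1 : s ^+ 2 * nrm z < nrm z by rewrite -[X in _ < X]mul1r ltr_pM2r // expr_lt1.
    have h2 : nrm z <= Dn ^+ 2 by rewrite nz ler_piMr // ltW.
    by move: h1; rewrite e ltNge h2.
  have sp : 0 < s by exact: lt_le_trans ltr01 s1.
  have Kp : K (G.1 + s * (z.1 - G.1), G.2 + s * (z.2 - G.2)) by have /(boundaryP cK)[] := bd.
  have s01 : 0 <= s^-1 <= 1 by rewrite invr_ge0 ltW //= invf_le1.
  have aff (c d : R) : s^-1 * (d + s * (c - d)) + (1 - s^-1) * d = c.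
    transitivity (d + (s^-1 * s) * (c - d)); first by ring.
    by rewrite mulVf ?lt0r_neq0 //; ring.
  have : K (s^-1 * (G.1 + s * (z.1 - G.1)) + (1 - s^-1) * G.1,
     s^-1 * (G.2 + s * (z.2 - G.2)) + (1 - s^-1) * G.2) := body_convex cK Kp KG s01.
  by rewrite (aff z.1 G.1) (aff z.2 G.2).
Qed.

End Chords.

(** * Periodicity of derivatives and the final assembly *)

Section Periodic.
Variable R : realType.

Lemma is_derive_shift (f : R -> R) (u L l : R) : is_derive (u + L) 1 f l ->
  is_derive u 1 (fun w => f (w + L)) l.
Proof.
move=> h; apply/is_deriveP => e e0; have [r r0 hr] := (is_deriveP f (u + L) l).1 h e e0.
by exists r => // k hk; have := hr k hk; rewrite [u + k + L]addrAC.
Qed.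

Lemma derive1_periodic (f : R -> R) (L : R) : (forall u, derivable f u 1) ->
  (forall u, f (u + L) = f u) -> forall u, derive1 f (u + L) = derive1 f u.
Proof.
move=> fD fp u.
have D1 : is_derive (u + L) 1 f (derive1 f (u + L)) by rewrite derive1E; exact/derivableP.
have := is_derive_shift D1; have -> : (fun w => f (w + L)) = f by apply/funext.
by move=> h; rewrite [RHS]derive1E; symmetry; exact: derive_val.
Qed.

End Periodic.

Theorem theorem4p15 (R : realType) (K : set (R * R)) (delta : R) :
  convex_body K ->
  0 < delta -> (delta%:E < area K)%E ->
  homothetic (Pi_delta K delta) (Gamma_delta K delta) ->
  (exists (g : R -> R * R) (L : R),
     C2_boundary_param K g L /\
     forall theta : R, exists a b : R,
       [/\ a <= b <= a + L,
           g @` `[a, b] = boundary K `&` halfplane theta (flot K delta theta) &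
           affine_arc_length g a b = 3^-1 * affine_arc_length g 0 L]) ->
  is_ellipse K.
Proof.
move=> cK d0 dK [q [lam [lam0 hom]]] [g [L [[L0 gper [ginj gsurj] [[a1 b1 c1] [a2 b2 c2]] dgn0] arcs]]].
have dlt : delta < ar K by move: dK; rewrite /area (bmset_leb2 (bmset_body cK)) lte_fin.
pose dg u := (derive1 (fun w => (g w).1) u, derive1 (fun w => (g w).2) u).
pose ddg u := (derive1 (derive1 (fun w => (g w).1)) u, derive1 (derive1 (fun w => (g w).2)) u).
have DD (f : R -> R) : (forall u, derivable f u 1) -> forall u : R, is_derive u 1 f (derive1 f u).
  by move=> h u; rewrite derive1E; exact/derivableP.
have g1D : forall u : R, is_derive u 1 (fun w => (g w).1) (dg u).1 := DD _ a1.
have g2D : forall u : R, is_derive u 1 (fun w => (g w).2) (dg u).2 := DD _ a2.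
have dg1D : forall u : R, is_derive u 1 (fun w => (dg w).1) (ddg u).1 := DD _ b1.
have dg2D : forall u : R, is_derive u 1 (fun w => (dg w).2) (ddg u).2 := DD _ b2.
have dg0 : forall u, dg u != 0 := dgn0.
have gbd := gboundary gsurj.
have p1 := derive1_periodic a1 (fun x => congr1 fst (gper x)).
have p2 := derive1_periodic a2 (fun x => congr1 snd (gper x)).
have q1 := derive1_periodic b1 p1; have q2 := derive1_periodic b2 p2.
have dgper u : dg (u + L) = dg u by rewrite /dg p1 p2.
have ddgper u : ddg (u + L) = ddg u by rewrite /ddg q1 q2.
have [sigma s2 [tgi tgK]] : exists2 sigma : R, sigma ^+ 2 = 1 &
  (forall u x, interior K x -> 0 < sigma * tg g dg u x) /\ (forall u x, K x -> 0 <= sigma * tg g dg u x).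
  by apply: orientation; eassumption.
have kge0 u : 0 <= sigma * det (dg u) (ddg u) by apply: curvature_ge0; eassumption.
(* [cbrt] carries the sign of the curvature, which is [sigma] for the whole curve; multiplying by
   [sigma] makes the length function [S] non-decreasing for either orientation of [g]. *)
pose F u := `|det (dg u) (ddg u)| `^ 3^-1.
pose phi u := cbrt (det (dg u) (ddg u)).
have n3 : (3^-1 : R) != 0 by rewrite invr_neq0 // pnatr_eq0.
have phiE u : phi u = sigma * F u.
  rewrite /phi /cbrt /F; have := kge0 u; move: (det _ _) => x sx.
  have [->|ne] := eqVneq x 0; first by rewrite sgr0 mul0r normr0 powR0 // mulr0.
  congr (_ * _); have [se|se] := sgn_cases s2; move: sx; rewrite se => sx.
    by rewrite gtr0_sg // lt_neqAle eq_sym ne -[x]mul1r.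
  by rewrite ltr0_sg // lt_neqAle ne /=; lra.
have detc : continuous (fun u => det (dg u) (ddg u)).
  move=> u; rewrite /det; apply: cvgB; apply: cvgM.
  - exact: is_derive_continuous (dg1D u).
  - exact: c2.
  - exact: is_derive_continuous (dg2D u).
  - exact: c1.
have phic : continuous phi.
  have -> : phi = (fun u => sigma * F u) by apply/funext.
  move=> u; apply: cvgM; first exact: cvg_cst.
  exact: (continuous_comp (detc u) (@continuous_cuberoot R _)).
have [S' [SD' SI]] := antiderivative phic.
pose S u := sigma * S' u.
have SD (u : R) : is_derive u 1 S (F u).
  have := is_derive_lin sigma 0 0 (SD' u) (SD' u).
  have -> : (fun w => sigma * S' w + 0 * S' w + 0) = S by apply/funext => w; rewrite /S; ring.
  have -> : sigma * phi u + 0 * phi u = sigma ^+ 2 * F u by rewrite phiE; ring.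
  by rewrite s2 mul1r.
have F0 u : 0 <= F u by exact: powR_ge0.
have Snd x y : x <= y -> S x <= S y by exact: (ndecr_of_derive SD F0).
have Fdet w : F w = 0 -> det (dg w) (ddg w) = 0.
  by move/eqP; rewrite powR_eq0 normr_eq0 => /andP[/eqP].
have Fper u : F (u + L) = F u by rewrite /F dgper ddgper.
pose Lam := S L - S 0.
have Sper u : S (u + L) = S u + Lam.
  have DS (w : R) : is_derive w 1 (fun w => 1 * S (w + L) + -1 * S w + 0) 0.
    have := is_derive_lin 1 (-1) 0 (is_derive_shift (SD (w + L))) (SD w).
    by have -> : 1 * F (w + L) + -1 * F w = 0 by rewrite Fper; ring.
  have cst x y : x < y -> S (x + L) - S x = S (y + L) - S y.
    by move=> xy; have [c _] := mvt DS xy; rewrite mul0r; lra.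
  have := @cst u 0; have := @cst 0 u; rewrite !add0r /Lam => h1 h2.
  by have [/h2|/h1|->] := ltgtP u 0; [lra|lra|rewrite add0r; ring].
(* Zero total affine length would make the curve straight over a whole period, so that [g L - g 0],
   which is zero, would be a positive multiple of [dg 0]. *)
have Lam0 : 0 < Lam.
  rewrite subr_gt0 lt_neqAle Snd ?ltW // andbT; apply/eqP => e.
  have Fz w : 0 <= w < L -> F w = 0.
    move=> /andP[w0 wL]; apply/eqP; rewrite eq_le F0 andbT.
    apply: (derive_right_le (SD w) wL) => x /andP[_ xL].
    by apply: le_trans (Snd _ _ xL) _; rewrite -e; exact: Snd.
  have Fz' w : 0 <= w <= L -> det (dg w) (ddg w) = 0.
    move=> /andP[w0]; rewrite le_eqVlt => /orP[/eqP ->|wL]; apply: Fdet; last by rewrite Fz ?w0.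
    by rewrite -[L]add0r Fper Fz ?lexx.
  have [c c0 [e1 e2 _]] : exists2 c, 0 < c & [/\ (g L).1 - (g 0).1 = c * (dg 0).1,
    (g L).2 - (g 0).2 = c * (dg 0).2 &
    exists2 d, 0 < d & (dg L).1 = d * (dg 0).1 /\ (dg L).2 = d * (dg 0).2].
    by apply: flat_straight; eassumption.
  have gL : g L = g 0 by rewrite -[L]add0r gper.
  rewrite gL !subrr in e1 e2.
  have d1 : (dg 0).1 = 0 by apply: (mulfI (lt0r_neq0 c0)); rewrite mulr0 -e1.
  have d2 : (dg 0).2 = 0 by apply: (mulfI (lt0r_neq0 c0)); rewrite mulr0 -e2.
  by have := dg0 0; rewrite [dg 0]surjective_pairing d1 d2 eqxx.
have Len a b : a <= b -> affine_arc_length g a b = S' b - S' a by move=> ab; exact: (SI _ _ ab).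
have arcs' th : exists a b, [/\ a <= b <= a + L,
    g @` `[a, b] = boundary K `&` halfplane th (flot K delta th) & S b = S a + Lam / 3].
  have [a [b [ab im len]]] := arcs th; exists a, b; split; [exact: ab|exact: im|].
  case/andP: ab => ab _; move: len; rewrite (Len _ _ ab) (Len _ _ (ltW L0)) => len.
  have eb : S' b = S' a + 3^-1 * (S' L - S' 0) by rewrite -len; ring.
  by rewrite /Lam /S eb; field.
exact: (flotation_ellipse cK d0 dlt L0 gper ginj gsurj g1D g2D dg1D dg2D dg0 s2 tgi tgK SD F0
  Lam0 Sper arcs' lam0 hom dgper Fdet).
Qed.
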